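(* Let $\mathcal{L}_0$ be a relational signature and let $\mathbf{c}$ be a constant symbol. Let $\mathbf{N}$ be an ultrahomogeneous $\mathcal{L}_0 \sqcup \{\mathbf{c}\}$-structure, with countable universe $N$ of cardinality at least $3$, which has the Ramsey property. Then $\mathcal{K}^*(\mathbf{N})$ has the Ramsey property.
   Context: Model theory. Signatures may have relation and function symbols (constants are $0$-ary functions). A structure is ultrahomogeneous if every isomorphism between finitely generated substructures extends to an automorphism. The age of a countable structure is the class of structures isomorphic to its finitely generated substructures. $\binom{\mathbf{B}}{\mathbf{A}}$ denotes the set of embeddings of $\mathbf{A}$ into $\mathbf{B}$. For $k \ge 1$, $\mathbf{C} \to (\mathbf{B})^{\mathbf{A}}_k$ means that $\binom{\mathbf{C}}{\mathbf{A}} \ne \emptyset$ and for every $\gamma\colon \binom{\mathbf{C}}{\mathbf{A}} \to \{0,\ldots,k-1\}$ there is $f \in \binom{\mathbf{C}}{\mathbf{B}}$ such that $\gamma$ is constant on $\{f\circ e : e \in \binom{\mathbf{B}}{\mathbf{A}}\}$. An age $\mathcal{F}$ has the Ramsey property if for all $\mathbf{A},\mathbf{B}\in\mathcal{F}$ in which $\mathbf{A}$ embeds in $\mathbf{B}$ and all $k$ there is $\mathbf{C}\in\mathcal{F}$ with $\mathbf{C}\to(\mathbf{B})^{\mathbf{A}}_k$. An ultrahomogeneous structure has the Ramsey property if its age does. Dendrites. A dendrite is a compact, metrizable, locally connected, uniquely arcwise connected topological space. For a point $x$ of a dendrite $D$, $\hat{x}$ is the set of connected components of $D \setminus \{x\}$;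 $x$ is an endpoint if $|\hat x| = 1$ and a branch point of order $|\hat x|$ if $|\hat x| \ge 3$. Let $n = |N| \in \{3,4,\ldots,\infty\}$. The Ważewski dendrite $W = W_n$ is the unique (up to homeomorphism) dendrite in which every branch point has order $n$ and the set of branch points is dense. $X$ is its (countable) set of branch points and $\widehat X = \bigsqcup_{x\in X}\hat x$. For $x\in X$, $y \ne x$, $\Phi(x,y)\in\hat x$ is the component containing $y$. $[x,y]$ is the unique arc joining $x,y$ and $(x,y)=[x,y]\setminus\{x,y\}$. $K(x,y,z)$ is the unique point of $[x,y]\cap[y,z]\cap[x,z]$. Fix an endpoint $\xi$ of $W$; $\rho(x)\in\hat x$ is the component of $W \setminus\{x\}$ containing $\xi$. Let $c\in N$ be the interpretation of $\mathbf{c}$. A root-kaleidoscopic coloring is a map $\kappa^*\colon\widehat X\to N$ such that for each $x\in X$ the restriction $\kappa^*|_{\hat x}\colon \hat x \to N$ is a bijection, $\kappa^*(\rho(x))=c$, and for all $x\in X$, $y\in(\xi,x)$ and $a\in N\setminus\{c\}$ there is $z\in X\cap(y,x)$ with $\kappa^*(\Phi(z,x))=a$. Fix one such $\kappa^*$ (they exist). The structure $\mathcal{K}^*(\mathbf{N})$. Its universe is $X\sqcup\{\xi\}$; its signature consists of a constant symbol $\boldsymbol{\xi}$ interpreted as $\xi$, a ternary function symbol interpreted as $K$, and the symbols of $\mathcal{L}_0$, which are interpreted not on the universe but on the imaginary sort of components $\widehat X$: for $R\in\mathcal{L}_0$ of arity $k$ and $\bar a = (a_0, \ldots, a_{k-1})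 \in\widehat X^k$, $R(\bar a)$ holds iff there is $x\in X$ with $a_0,\ldots,a_{k-1}\in\hat x$ and $R^{\mathbf{N}}(\kappa^*(a_0),\ldots,\kappa^*(a_{k-1}))$. Formally, the sort of components is the quotient of $\{(x,y) : x\neq y\}$ by the equivalence relation $(x_1,y_1)\sim(x_2,y_2)$ iff $x_1=x_2$ and $K(y_1,x_1,y_2)\neq x_1$, the class of $(x,y)$ representing $\Phi(x,y)$. A substructure is a subset $S$ containing $\xi$ and closed under $K$, with components $\Phi(s,t)$, $s\neq t\in S$ and the induced relations; an embedding is an injective map preserving $\xi$ and $K$ such that the induced injective map on components, $\Phi(s,t)\mapsto\Phi(f(s),f(t))$, preserves and reflects the relations of $\mathcal{L}_0$. The structure $\mathcal{K}^*(\mathbf{N})$ is ultrahomogeneous and does not depend on $\kappa^*$ up to isomorphism. *)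

(* Defs.v *)
From mathcomp Require Import all_boot all_order all_algebra.
From mathcomp Require Import all_classical all_reals all_analysis.

Set Implicit Arguments.
Unset Strict Implicit.
Unset Printing Implicit Defensive.

Import numFieldNormedType.Exports.

Local Open Scope classical_set_scope.
Local Open Scope card_scope.
Local Open Scope ring_scope.

(* The Ramsey property of a class [F] of objects [A] with carriers [car A], the
   embeddings of [A] into [B] being the maps in [emb A B]. It serves both for
   first-order structures and for structures with an imaginary sort. *)
Section Ramsey.
Variables (Obj : Type) (car : Obj -> Type).
Variable emb : forall A B : Obj, set (car A -> car B).

(* A colouring is given on all maps [car A -> car C]; only its values on the
   embeddings matter, and for [0 < k] every [k]-colouring of the embeddings is
   the restriction of such a map. *)
Definition ramsey_arrow (C B A : Obj) (k : nat) : Prop :=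
  @emb A C !=set0 /\
  forall gamma : (car A -> car C) -> 'I_k,
    exists2 f, @emb B C f &
      forall e e', @emb A B e -> @emb A B e' -> gamma (f \o e) = gamma (f \o e').

Definition ramsey_class (F : Obj -> Prop) : Prop :=
  forall A B, F A -> F B -> @emb A B !=set0 ->
    forall k, (0 < k)%N -> exists2 C, F C & ramsey_arrow C B A k.

End Ramsey.

Record signature := Signature {
  fsym : Type;
  far : fsym -> nat;
  rsym : Type;
  rar : rsym -> nat }.

Record structure (L : signature) := Structure {
  carrier :> Type;
  fint : forall f : fsym L, ('I_(far f) -> carrier) -> carrier;
  rint : forall r : rsym L, ('I_(rar r) -> carrier) -> Prop }.

Arguments fint {L M} f _ : rename.
Arguments rint {L M} r _ : rename.

Section FirstOrder.
Variable L : signature.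
Implicit Types M A B : structure L.

Definition embedding A B : set (A -> B) := [set h |
  [/\ injective h,
      forall (f : fsym L) (a : 'I_(far f) -> A),
        h (fint f a) = fint f (h \o a)
    & forall (r : rsym L) (a : 'I_(rar r) -> A),
        rint r a <-> rint r (h \o a)]].

Definition isomorphism A B : set (A -> B) :=
  [set h | bijective h /\ embedding h].

Definition fclosed M (S : set M) : Prop :=
  forall (f : fsym L) (a : 'I_(far f) -> M),
    (forall i, S (a i)) -> S (fint f a).

Definition substructure M (S : set M) (clS : fclosed S) : structure L :=
  @Structure L {x : M | S x}
    (fun f a => exist _ (fint f (fun i => sval (a i)))
                        (clS f _ (fun i => svalP (a i))))
    (fun r a => rint r (fun i => sval (a i))).

Definition finitely_generated M (S : set M) : Prop :=
  exists2 G : set M, finite_set G & S = smallest (@fclosed M) G.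

(* Classes of structures are predicates [structure L -> Prop] and not [set]s,
   which would cause a universe inconsistency below. *)
Definition age M : structure L -> Prop := fun A =>
  exists (S : set M) (clS : fclosed S),
    finitely_generated S /\
    exists h, @isomorphism A (substructure clS) h.

Definition ultrahomogeneous M : Prop :=
  forall (S T : set M) (clS : fclosed S) (clT : fclosed T),
    finitely_generated S -> finitely_generated T ->
    forall h, @isomorphism (substructure clS) (substructure clT) h ->
    exists2 g, @isomorphism M M g &
      forall x : substructure clS, g (sval x) = sval (h x).

Definition ramsey_structure M : Prop :=
  ramsey_class (@embedding) (age M).

End FirstOrder.

Record rel_signature := RelSignature {
  rel_sym : Type;
  rel_ar : rel_sym -> nat }.

Definition add_constant (L0 : rel_signature) : signature :=
  @Signature unit (fun=> 0%N) (rel_sym L0) (@rel_ar L0).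

Definition the_constant (L0 : rel_signature)
    (N : structure (add_constant L0)) : N :=
  fint (M := N) tt (tnth [tuple]).

Inductive tree_symbol := Root | Center.

Definition tree_signature : signature :=
  @Signature tree_symbol (fun f => match f with Root => 0 | Center => 3 end)%N
    void (of_void nat).

Definition center (M : structure tree_signature) (x y z : M) : M :=
  fint (M := M) Center (tnth [tuple x; y; z]).

Definition dpair (T : Type) := {p : T * T | p.1 <> p.2}.

(* A component is an equivalence class of pairs of distinct points, the class
   [Phi p] of [p = (x, y)] standing for the component of [y] at [x]. *)
Section Components.
Variable M : structure tree_signature.

Definition same_component (p q : dpair M) : Prop :=
  (sval p).1 = (sval q).1 /\
  center (sval p).2 (sval p).1 (sval q).2 <> (sval p).1.

Definition component : Type :=
  {C : set (dpair M) | exists p, C = same_component p}.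

Definition Phi (p : dpair M) : component :=
  exist _ (same_component p) (ex_intro _ p erefl).

End Components.

Record comp_structure (L0 : rel_signature) := CompStructure {
  comp_base :> structure tree_signature;
  comp_rel : forall r : rel_sym L0,
    ('I_(rel_ar r) -> component comp_base) -> Prop }.

Arguments comp_rel {L0 M} r _ : rename.

Section ComponentStructures.
Variable L0 : rel_signature.
Implicit Types M A B : comp_structure L0.

Definition comp_embedding A B : set (A -> B) := [set h |
  @embedding _ A B h /\
  forall (r : rel_sym L0) (p : 'I_(rel_ar r) -> dpair A)
      (q : 'I_(rel_ar r) -> dpair B),
    (forall i, sval (q i) = (h (sval (p i)).1, h (sval (p i)).2)) ->
    (comp_rel r (@Phi A \o p) <-> comp_rel r (@Phi B \o q))].

Definition comp_isomorphism A B : set (A -> B) :=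
  [set h | bijective h /\ comp_embedding h].

Definition comp_substructure M (S : set M) (clS : @fclosed _ M S) :
    comp_structure L0 :=
  @CompStructure L0 (substructure clS)
    (fun r c => exists (p : 'I_(rel_ar r) -> dpair (substructure clS))
                       (q : 'I_(rel_ar r) -> dpair M),
       [/\ c = @Phi (substructure clS) \o p,
           forall i, sval (q i) = (sval (sval (p i)).1, sval (sval (p i)).2)
         & comp_rel r (@Phi M \o q)]).

Definition comp_age M : comp_structure L0 -> Prop := fun A =>
  exists (S : set M) (clS : @fclosed _ M S),
    @finitely_generated _ M S /\
    exists h, @comp_isomorphism A (comp_substructure clS) h.

Definition ramsey_comp_structure M : Prop :=
  ramsey_class comp_embedding (comp_age M).

End ComponentStructures.

(* [f] and [g] are mutually inverse homeomorphisms between [A] and [B]. *)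
Definition homeomorphism (S T : topologicalType) (A : set S) (B : set T)
    (f : S -> T) (g : T -> S) : Prop :=
  [/\ {within A, continuous f}, {within B, continuous g},
      set_fun A B f, set_fun B A g
    & {in A, cancel f g} /\ {in B, cancel g f}].

Definition metrizable (R : realType) (T : topologicalType) : Prop :=
  exists (M : metricType R) (f : T -> M) (g : M -> T),
    homeomorphism [set: T] [set: M] f g.

Definition locally_connected (T : topologicalType) : Prop :=
  forall (x : T) (U : set T), nbhs x U ->
    exists V, [/\ open V, V x, connected V & V `<=` U].

Section Dendrites.
Variables (R : realType) (T : topologicalType).
Implicit Types x y z : T.

Definition arc_joining x y : set (set T) := [set A |
  exists (f : R -> T) (g : T -> R),
    [/\ homeomorphism (`[0, 1] : set R) A f g, f 0 = x & f 1 = y]].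

Definition uniquely_arcwise_connected : Prop :=
  forall x y, x <> y -> exists! A, arc_joining x y A.

Definition dendrite : Prop :=
  [/\ compact [set: T], metrizable R T, locally_connected T
    & uniquely_arcwise_connected].

(* [x] is added separately because no arc joins [x] to itself. *)
Definition arc x y : set T := [set x] `|` \bigcup_(A in arc_joining x y) A.

Definition open_arc x y : set T := arc x y `\` [set x; y].

(* The set whose unique point, in a dendrite, is [K(x, y, z)]. *)
Definition centers x y z : set T := arc x y `&` arc y z `&` arc x z.

Definition component_at x y : set T := connected_component [set~ x] y.

Definition components x : set (set T) :=
  [set component_at x y | y in [set~ x]].

Definition endpoint x : Prop := components x #= `I_1.

Definition branch_points : set T := [set x | `I_3 #<= components x].

(* The order [n] of the branch points is given as the cardinality of [N]. *)
Definition wazewski_dendrite (N : Type) : Prop :=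
  [/\ dendrite, forall x, branch_points x -> components x #= [set: N]
    & dense branch_points].

(* The colour of a component [C] at [x] is [kappa x C]; the values of [kappa]
   elsewhere are irrelevant. *)
Definition root_kaleidoscopic (N : Type) (c : N) (xi : T)
    (kappa : T -> set T -> N) : Prop :=
  [/\ forall x, branch_points x -> set_bij (components x) [set: N] (kappa x),
      forall x, branch_points x -> kappa x (component_at x xi) = c
    & forall x y a, branch_points x -> open_arc xi x y -> a <> c ->
        exists2 z, (branch_points `&` open_arc y x) z &
          kappa z (component_at z x) = a].

End Dendrites.

Arguments branch_points : clear implicits.
Arguments wazewski_dendrite : clear implicits.

Section Kaleidoscope.
Variables (R : realType) (W : topologicalType) (xi : W).
Variables (L0 : rel_signature) (N : structure (add_constant L0)).
Variable kappa : W -> set W -> N.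

Definition points : Type := set_type (branch_points W `|` [set xi]).

Definition root_point : points :=
  exist _ xi (mem_set (or_intror erefl : (branch_points W `|` [set xi]) xi)).

(* [points] is closed under [K], so in a dendrite the default [x] is not used. *)
Definition points_center (x y z : points) : points :=
  xget x [set w : points | centers R (val x) (val y) (val z) (val w)].

Definition kaleidoscope_base : structure tree_signature :=
  @Structure tree_signature points
    (fun f => match f return ('I_(@far tree_signature f) -> points) -> points with
       | Root => fun=> root_point
       | Center => fun a => points_center (a (@Ordinal 3 0 isT))
                     (a (@Ordinal 3 1 isT)) (a (@Ordinal 3 2 isT))
       end)
    (fun r => match r with end).

Definition kaleidoscope : comp_structure L0 :=
  @CompStructure L0 kaleidoscope_base
    (fun r c => exists2 x : W, branch_points W x &
       exists p : 'I_(rel_ar r) -> dpair points,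
         [/\ c = @Phi kaleidoscope_base \o p,
             forall i, val (sval (p i)).1 = x
           & rint (M := N) r
               (fun i => kappa x (component_at x (val (sval (p i)).2)))]).

End Kaleidoscope.

(* Main.v *)
From Stdlib Require List.
Require Import Defs.
From mathcomp Require Import all_boot all_order all_algebra.
From mathcomp Require Import all_classical all_reals all_analysis.
From mathcomp Require Import zify lra.

(** Fix the root xi. A finite substructure of the kaleidoscopic structure is xi
    together with a finite set of branch points closed under meets, that is, a
    finite rooted tree in which the branches leaving a node are injectively
    coloured by elements of N other than c, while c marks the direction of the
    root. Recording, for each node, the colours met on the way up from the least
    node turns such a tree into a finite prefix-closed set of words over
    N \ {c} ([exists_representation]). Conversely all words are realized
    simultaneously in the dendrite: every component at a branch point is open,
    so it contains a branch point, and there is one component of each colour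
    ([exists_word_points]). Embeddings of substructures are the maps between
    trees of words that carry the directions at each node to the directions at
    its image by a partial isomorphism of N fixing c ([tree_embed_comp_embedding],
    [comp_embedding_tree_embed]). It remains to prove the Ramsey property for
    trees of words.

    That is done by induction on the height of the tree A whose copies are
    coloured ([word_tree_ramsey]). For a given B, a large C has in every
    colouring a copy of B inside which the colour of a copy of A depends on the
    image of the root only ([root_canonical]); this colours the nodes, and a
    pigeonhole property for nodes ([vertex_ramsey]) concludes. The proof of
    [root_canonical] is by induction on the height of B. A copy of A with its
    root at the root of a tree is a copy of the directions at the root of A
    inside the directions at the root of that tree, together with one copy of
    each branch of A. For a fixed choice of directions, the Ramsey property of
    the branches of A, used one branch at a time, makes the colour independent
    of the copies of the branches ([rooted_product]); the colour then depends on
    the choice of directions alone, and the Ramsey property of N makes it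
    constant. Below the root, the induction hypothesis is applied in every
    branch separately.

    The topological input is that y and z lie in the same component of the
    complement of x exactly when the arc [y, z] avoids x
    ([component_avoiding_arc], [avoiding_arc_component]). Its substance is that
    a connected open set of a locally connected compact metric space contains
    arcs. Chains of small connected open sets, refined again and again, give a
    path ([exists_path]). A maximal open set of times that can be erased from a
    path, each of its intervals being a loop, leaves a path that never comes
    back to a point it has left ([exists_monotone_path]). Such a path is
    reparametrized by a strictly monotone function of the part already covered,
    and becomes an arc ([path_arc]). *)

Set Implicit Arguments.
Unset Strict Implicit.
Unset Printing Implicit Defensive.

Local Open Scope classical_set_scope.
Local Open Scope card_scope.

(** * Finite sets and words *)

(** Letters and points carry no decidable equality; hence the propositional
    membership [List.In]. *)
Lemma finite_listP (T : Type) (X : set T) :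
  finite_set X -> exists s : seq T, forall x, X x <-> List.In x s.
Proof.
pose T' : choiceType := {classic T}.
move=> finX.
have /finite_seqP [s Es] : finite_set (X : set T') by [].
exists s => x; rewrite Es /=; clear.
elim: s => [|y s IH] //=; rewrite inE; split.
- by case/orP => [/eqP -> |/IH]; [left | right].
- by case=> [-> |/IH ->]; rewrite ?eqxx ?orbT.
Qed.

Lemma list_finite (T : Type) (s : seq T) : finite_set [set x | List.In x s].
Proof.
elim: s => [|y s IH] /=; first by rewrite (_ : [set _ | _] = set0) //; exact: finite_set0.
rewrite (_ : [set _ | _] = [set y] `|` [set x | List.In x s]).
  by rewrite finite_setU; split=> //; exact: finite_set1.
by apply/seteqP; split=> x /=; [case=> [->|]; [left|right] | case=> [->|]; [left|right]].
Qed.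

(** There are only finitely many contexts in which one coordinate of a tuple of
    embeddings can vary; this is how that finiteness is used. The default [e0]
    is the default value of [nth]. *)
Lemma finite_functions (U V : Type) (X : set U) (Y : set V) (e0 : U -> V) :
  finite_set X -> finite_set Y ->
  exists L : seq (U -> V), forall e, (forall x, X x -> Y (e x)) ->
    exists2 i, i < size L & forall x, X x -> e x = nth e0 L i x.
Proof.
move=> /finite_listP [s Es] /finite_listP [t Et].
suff [L HL] : exists L : seq (U -> V), forall e, (forall x, List.In x s -> List.In (e x) t) ->
    exists2 i, i < size L & forall x, List.In x s -> e x = nth e0 L i x.
  exists L => e He; have [x /Es Xx|i il Hi] := HL e; first by apply/Et/He.
  by exists i => // x /Es; apply: Hi.
clear; elim: s => [|x s [L HL]]; first by exists [:: e0] => e _; exists 0.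
pose upd (y : V) (e : U -> V) := fun z => if pselect (z = x) then y else e z.
exists (List.flat_map (fun y => map (upd y) L) t) => e He.
have [z zs|i il Hi] := HL e; first by apply: He; right.
have {He}: List.In (e x) t by apply: He; left.
elim: t {HL} => [//|y t IH] /= [yE|/IH [j jl Hj]].
  exists i; first by rewrite size_cat size_map ltn_addr.
  move=> z; rewrite nth_cat size_map il (nth_map e0) // /upd.
  by case: pselect => /= [zx _|zx [xz|zs]]; [rewrite zx | case: zx | exact: Hi].
exists (size L + j); first by rewrite size_cat size_map ltn_add2l.
by move=> z /Hj ->; rewrite nth_cat size_map ltnNge leq_addr /= addKn.
Qed.

Lemma In_nth (T : Type) (x0 : T) (s : seq T) i : i < size s -> List.In (nth x0 s i) s.
Proof. by elim: s i => // x s IH [|i] /= si; [left | right; exact: IH]. Qed.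

Lemma card_ge_inj (T : Type) n (A : set T) (f : nat -> T) : (forall i, (i < n)%N -> A (f i)) ->
  (forall i j, (i < n)%N -> (j < n)%N -> f i = f j -> i = j) -> `I_n #<= A.
Proof.
move=> fA finj; have E : f @` `I_n #= `I_n.
  by apply: inj_card_eq => i j; rewrite !inE; exact: finj.
apply: (@card_le_trans _ _ _ (f @` `I_n)); first by move/card_eqPle: E => -[].
by apply: subset_card_le => _ [i iI <-]; exact: fA.
Qed.

Lemma words_compare (U : Type) (l l' : seq U) : [\/ l = l', exists a m, l' = l ++ a :: m,
  exists a m, l = l' ++ a :: m |
  exists m a b k k', [/\ a <> b, l = m ++ a :: k & l' = m ++ b :: k']].
Proof.
elim: l l' => [|a l IH] [|b l']; first by constructor 1.
- by constructor 2; exists b, l'.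
- by constructor 3; exists a, l.
have [<-|ab] := pselect (a = b); last by constructor 4; exists [::], a, b, l, l'.
case: (IH l') => [->|[x [m ->]]|[x [m ->]]|[m [x [y [k [k' [xy -> ->]]]]]]].
- by constructor 1.
- by constructor 2; exists x, m.
- by constructor 3; exists x, m.
- by constructor 4; exists (a :: m), x, y, k, k'.
Qed.

Lemma not_prefix_self (U : Type) (l : seq U) a m : l ++ a :: m <> l.
Proof. by move/(congr1 size)/eqP; rewrite size_cat /= -{2}[size l]addn0 eqn_add2l. Qed.

Lemma sval_inj (T : Type) (P : T -> Prop) : injective (@sval T P).
Proof. by move=> [x p] [y q] /= e; exact: eq_exist. Qed.

(** * Trees of words *)

Section Words.
Variables (L0 : rel_signature) (N : structure (add_constant L0)).
Notation c := (the_constant N).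
Notation word := (seq N).

Definition with_const (D : set N) : set N := fun a => a = c \/ D a.

(** The finite substructures of N are the sets [with_const D]: a finite set of
    directions [D], together with c for the direction of the root. *)
Definition partial_copy (D F : set N) (phi : N -> N) :=
  [/\ forall a, D a -> F (phi a), phi c = c,
      forall a b, with_const D a -> with_const D b -> phi a = phi b -> a = b
    & forall r (x : 'I_(rel_ar r) -> N), (forall i, with_const D (x i)) ->
        rint (M := N) r x <-> rint (M := N) r (phi \o x)].

Lemma partial_copy_id D : partial_copy D D id.
Proof. by split. Qed.

Lemma partial_copy_sub D D' F F' phi : D `<=` D' -> F' `<=` F ->
  partial_copy D' F' phi -> partial_copy D F phi.
Proof.
move=> DD' FF' [H1 H2 H3 H4].
have DDc a : with_const D a -> with_const D' a by case=> [->|/DD' ?]; [left | right].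
split=> // [a /DD' /H1 /FF' //|a b /DDc ? /DDc ?|r x Hx]; first exact: H3.
by apply: H4 => i; exact: DDc.
Qed.

Lemma partial_copy_comp D E F phi psi :
  partial_copy D E phi -> partial_copy E F psi -> partial_copy D F (psi \o phi).
Proof.
move=> [H1 H2 H3 H4] [K1 K2 K3 K4].
have Hc a : with_const D a -> with_const E (phi a).
  by case=> [->|Da]; [left | right; exact: H1].
split=> [a /H1 /K1 //|/=|a b Da Db /= |r x Hx].
- by rewrite H2.
- by move/(K3 _ _ (Hc _ Da) (Hc _ Db)); exact: H3.
- rewrite H4 // K4 //= => i; exact: Hc.
Qed.

Definition succ (T : set word) (u : word) : set N := [set a | T (u ++ [:: a])].
Definition above (T : set word) (a : N) : set word := [set l | T (a :: l)].

Definition node (F : set N) (s : N -> set word) : set word :=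
  fun l => if l is a :: l' then F a /\ s a l' else True.

Definition word_tree (T : set word) :=
  [/\ finite_set T, T [::], forall u v, T (u ++ v) -> T u
    & forall u v, ~ T (u ++ c :: v)].

(** This local condition amounts to the preservation of meets and of the
    relations between directions: words that branch at [u] with letters [a] and
    [b] are sent to words that branch at [f u] with letters [phi a] and [phi b],
    which differ because [phi] is injective. *)
Definition tree_embed (T T' : set word) (f : word -> word) :=
  forall u, T u -> T' (f u) /\
    exists2 phi, partial_copy (succ T u) (succ T' (f u)) phi &
      forall a l, T (u ++ a :: l) -> exists l', f (u ++ a :: l) = f u ++ phi a :: l'.

(** Colourings are defined on all functions, so that composition needs no proof
    of membership; only the values on [X] may matter. *)
Definition local_on (U V C : Type) (X : set U) (gamma : (U -> V) -> C) :=
  forall e e', (forall x, X x -> e x = e' x) -> gamma e = gamma e'.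

Lemma partial_copy_incl D F : D `<=` F -> partial_copy D F id.
Proof. by move=> DF; split. Qed.

Lemma tree_embed_sub S T T' T'' f : S `<=` T -> T' `<=` T'' ->
  tree_embed T T' f -> tree_embed S T'' f.
Proof.
move=> ST TT Hf u /ST /Hf [/TT ? [phi Hphi Hl]]; split=> //; exists phi.
  by apply: partial_copy_sub Hphi => a; [exact: ST | exact: TT].
by move=> a l /ST; exact: Hl.
Qed.

Lemma tree_embed_id T : tree_embed T T id.
Proof.
move=> u Tu; split=> //; exists id; first exact: partial_copy_id.
by move=> a l _; exists l.
Qed.

Lemma tree_embed_comp T T' T'' f g :
  tree_embed T T' f -> tree_embed T' T'' g -> tree_embed T T'' (g \o f).
Proof.
move=> Hf Hg u /Hf [/Hg [Tgu [psi Hpsi Hgl]] [phi Hphi Hfl]]; split=> //.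
exists (psi \o phi); first exact: partial_copy_comp Hphi Hpsi.
move=> a l Tl; have [l' El] := Hfl _ _ Tl.
have [|l'' El'] := Hgl (phi a) l'; last by exists l''; rewrite /= El.
by rewrite -El; have [] := Hf _ Tl.
Qed.

Lemma finite_succ T u : word_tree T -> finite_set (succ T u).
Proof.
move=> [fT _ _ _].
apply: (@finite_preimage _ _ T (fun a => u ++ [:: a])) => // a b _ _ E.
by have [] := List.app_inv_head _ _ _ E.
Qed.

Lemma succ_const T u : word_tree T -> ~ succ T u c.
Proof. by move=> [_ _ _ /(_ u [::])]. Qed.

Lemma above_tree T a : word_tree T -> T [:: a] -> word_tree (above T a).
Proof.
move=> [fT T0 Tp Tc] Ta; split=> //.
- by apply: (@finite_preimage _ _ T (cons a)) => // x y _ _ [].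
- by move=> u v; exact: (Tp (a :: u)).
- by move=> u v; exact: (Tc (a :: u)).
Qed.

Lemma node_tree F s : finite_set F -> ~ F c -> (forall a, F a -> word_tree (s a)) ->
  word_tree (node F s).
Proof.
move=> fF Fc Hs; split=> //.
- have -> : node F s = [set [::]] `|` \bigcup_(a in F) (cons a @` s a).
    apply/seteqP; split=> [[_|a l [Fa sl]]|l]; [by left| |].
      by right; exists a => //; exists l.
    by case=> [-> //|[a Fa [l' sl' <-]]].
  rewrite finite_setU; split; first exact: finite_set1.
  by apply: bigcup_finite => // a /Hs [fs _ _ _]; exact: finite_image.
- by case=> [//|a u] v [Fa su]; have [_ _ sp _] := Hs _ Fa; split=> //; exact: sp su.
- case=> [|a u] v [Fa]; first by case: (Fc Fa).
  by have [_ _ _ sc] := Hs _ Fa; exact: sc.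
Qed.

(** Finitely many trees have a common extension for free, because all of them
    consist of words over the same alphabet. *)
Lemma union_tree (I : finType) (T : I -> set word) (i0 : I) :
  (forall i, word_tree (T i)) -> word_tree (\bigcup_i T i).
Proof.
move=> HT; split.
- by apply: bigcup_finite => [|i _]; [exact: finite_finset | have [] := HT i].
- by exists i0 => //; have [] := HT i0.
- by move=> u v [i _ Ti]; exists i => //; have [_ _ Tp _] := HT i; exact: Tp Ti.
- by move=> u v [i _]; have [_ _ _ Tc] := HT i; exact: Tc.
Qed.

(** A map that fixes the root is the same thing as a map of directions together
    with one map for each branch. *)
Definition assemble (phi : N -> N) (g : N -> word -> word) : word -> word :=
  fun l => if l is a :: l' then phi a :: g a l' else [::].

Lemma assemble_embed A F C phi g : word_tree A -> (forall a, C a [::]) ->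
  partial_copy (succ A [::]) F phi ->
  (forall a, A [:: a] -> tree_embed (above A a) (C (phi a)) (g a)) ->
  tree_embed A (node F C) (assemble phi g).
Proof.
move=> [_ A0 Ap _] C0 [H1 H2 H3 H4] Hg [_|a u] /=.
  split; [exact: I | exists phi; last by move=> a l _; exists (g a l)].
  split=> // a Aa; exact: (conj (H1 _ Aa) (C0 _)).
move=> Aau; have Aa : A [:: a] by apply: (Ap [:: a] u).
have [Cg [psi Hpsi Hl]] := Hg _ Aa _ Aau; split; [by split=> //; exact: H1|].
exists psi; last by move=> b l /Hl [l' /= ->]; exists l'.
by apply: partial_copy_sub Hpsi => // b Cb; split=> //; exact: H1.
Qed.

Lemma above_embed A B a e :
  tree_embed A B e -> tree_embed (above A a) B (fun l => e (a :: l)).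
Proof.
move=> He u Au; have [Be [phi Hphi Hl]] := He _ Au; split=> //.
by exists phi => // b l; exact: Hl.
Qed.

Lemma behead_embed A B b e : (forall l, A l -> exists l', e l = b :: l') ->
  tree_embed A B e -> tree_embed A (above B b) (behead \o e).
Proof.
move=> Hb He u Au; have [Be [phi Hphi Hl]] := He _ Au.
have [m Em] := Hb _ Au; rewrite /= Em /=; rewrite Em in Be Hphi Hl; split=> //.
by exists phi => // a l /Hl [l' /= ->]; exists l'.
Qed.

(** The directions taken at the root are kept as an explicit parameter [phi],
    since the colour will first be made to depend on them alone. *)
Definition root_embed A F s phi e := [/\ tree_embed A (node F s) e, e [::] = [::]
  & forall a l, A (a :: l) -> exists l', e (a :: l) = phi a :: l'].

Lemma root_embed_copy A F s phi e : root_embed A F s phi e ->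
  forall a, A [:: a] -> F (phi a).
Proof.
move=> [He e0 Hl] a Aa; have [l' El] := Hl _ _ Aa.
by have [] := He _ Aa; rewrite El => -[].
Qed.

Lemma root_embed_inj A F s phi e : word_tree A -> root_embed A F s phi e ->
  forall a b, A [:: a] -> A [:: b] -> phi a = phi b -> a = b.
Proof.
move=> [_ A0 _ _] [He e0 Hl] a b Aa Ab; have [_ [psi [_ _ Hinj _] Hpsi]] := He _ A0.
have Epsi x : A [:: x] -> psi x = phi x.
  by move=> Ax; have [l El] := Hl _ _ Ax; have [l' ] := Hpsi _ _ Ax; rewrite e0 /= El => -[].
by move=> Eab; apply: Hinj; [right | right | rewrite !Epsi].
Qed.

Lemma root_embed_branch A F s phi e a : word_tree A -> root_embed A F s phi e ->
  A [:: a] -> tree_embed (above A a) (s (phi a)) (behead \o (fun l => e (a :: l))).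
Proof.
move=> tA [He e0 Hl] Aa.
apply: (@tree_embed_sub (above A a) (above A a) (above (node F s) (phi a))) => // [l [] //|].
apply: (@behead_embed _ _ _ (fun l => e (a :: l))) => [l Al|]; last exact: above_embed.
exact: Hl.
Qed.

Definition lift f := assemble id f.

Lemma lift_embed F s C f : finite_set F -> ~ F c ->
  (forall a, word_tree (s a)) -> (forall a, word_tree (C a)) ->
  (forall a, tree_embed (s a) (C a) (f a)) -> tree_embed (node F s) (node F C) (lift f).
Proof.
move=> fF Fc Hs HC Hf; apply: assemble_embed; first exact: node_tree.
  by move=> a; have [] := HC a.
  by apply: partial_copy_incl => a [].
by move=> a _; apply: tree_embed_sub (Hf a) => // l [].
Qed.

Lemma root_embed_lift A F s C f phi e : finite_set F -> ~ F c ->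
  (forall a, word_tree (s a)) -> (forall a, word_tree (C a)) ->
  (forall a, tree_embed (s a) (C a) (f a)) ->
  root_embed A F s phi e -> root_embed A F C phi (lift f \o e).
Proof.
move=> fF Fc Hs HC Hf [He e0 Hl]; split.
- by apply: tree_embed_comp He _; exact: lift_embed.
- by rewrite /= e0.
- by move=> a l /Hl [l' /= ->]; exists (f (phi a) l').
Qed.

(** * The Ramsey property of trees of words *)
Definition ramsey A := forall B k, word_tree B ->
  exists2 C, word_tree C & forall gamma : (word -> word) -> 'I_k.+1, local_on A gamma ->
    exists2 f, tree_embed B C f & forall e e', tree_embed A B e -> tree_embed A B e' ->
      gamma (f \o e) = gamma (f \o e').

Lemma local_comp A k (gamma : (word -> word) -> 'I_k) (f : word -> word) :
  local_on A gamma -> local_on A (fun e => gamma (f \o e)).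
Proof. by move=> Hg e e' ee'; apply: Hg => x /ee' /= ->. Qed.

(** Iterating the Ramsey property makes finitely many colourings constant on the
    same copy, which replaces a colouring by tuples of colours. *)
Lemma ramsey_multi A : ramsey A -> forall n B k, word_tree B ->
  exists2 C, word_tree C & forall gamma : nat -> (word -> word) -> 'I_k.+1,
    (forall i, local_on A (gamma i)) ->
    exists2 f, tree_embed B C f & forall i, i < n ->
      forall e e', tree_embed A B e -> tree_embed A B e' ->
      gamma i (f \o e) = gamma i (f \o e').
Proof.
move=> RA; elim=> [|n IH] B k tB; first by exists B => // gamma _; exists id => //; exact: tree_embed_id.
have [C tC HC] := IH _ k tB; have [D tD HD] := RA _ k tC; exists D => // gamma Hg.
have [g Hge Hgc] := HD _ (Hg n).
have [f Hfe Hfc] := HC (fun i e => gamma i (g \o e)) (fun i => local_comp g (Hg i)).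
exists (g \o f); first exact: tree_embed_comp Hfe Hge.
move=> i; rewrite ltnS leq_eqVlt => /orP [/eqP -> e e' He He'|]; last exact: Hfc.
by apply: Hgc; [exact: tree_embed_comp He Hfe | exact: tree_embed_comp He' Hfe].
Qed.

Lemma lift_id : lift (fun=> id) = id.
Proof. by apply: funext => -[]. Qed.

Lemma lift_comp f g : lift (fun a => f a \o g a) = lift f \o lift g.
Proof. by apply: funext => -[]. Qed.

(** One branch of [A] at a time: an embedding that follows [phi] makes it injective
    on the directions of [A], so that only the branch [a] is sent to the branch
    [phi a] of the target, which alone has to be enlarged. Every choice of the other branches gives a colouring
    of the copies of the branch [a], and [ramsey_multi] treats these finitely many
    colourings together. *)
Lemma branch_step A a F phi : word_tree A -> finite_set F -> ~ F c ->
  (A [:: a] -> ramsey (above A a)) ->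
  forall s k, (forall b, word_tree (s b)) ->
  exists2 C, (forall b, word_tree (C b)) &
    forall gamma : (word -> word) -> 'I_k.+1, local_on A gamma ->
    exists2 f, (forall b, tree_embed (s b) (C b) (f b)) &
      forall e e', root_embed A F s phi e -> root_embed A F s phi e' ->
        (forall b l, b <> a -> A (b :: l) -> e (b :: l) = e' (b :: l)) ->
        gamma (lift f \o e) = gamma (lift f \o e').
Proof.
move=> tA fF Fc Ra s k Hs.
have [Aa|nAa] := pselect (A [:: a]); last first.
  exists s => // gamma Hg; exists (fun=> id); first by move=> b; exact: tree_embed_id.
  move=> e e' [_ e0 _] [_ e0' _] Hee; rewrite lift_id; apply: Hg => -[_|b l Abl] /=.
    by rewrite e0 e0'.
  apply: Hee => // Eba; apply: nAa; rewrite -Eba.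
  by have [_ _ Ap _] := tA; apply: Ap (l) _.
have [Hinj|nHinj] := pselect (forall b, A [:: b] -> phi b = phi a -> b = a); last first.
  exists s => // gamma Hg; exists (fun=> id); first by move=> b; exact: tree_embed_id.
  move=> e e' /root_embed_inj He _; case: nHinj => b Ab; exact: He.
have [L HL] := @finite_functions _ _ _ _ (id : word -> word)
  (let: And4 x _ _ _ := tA in x)
  (let: And4 x _ _ _ := node_tree fF Fc (fun b _ => Hs b) in x).
have [C1 tC1 HC1] := ramsey_multi (Ra Aa) (size L) k (Hs (phi a)).
exists (fun b => if pselect (b = phi a) then C1 else s b).
  by move=> b /=; case: pselect => _ /=; [exact: tC1 | exact: Hs].
move=> gamma Hg.
(* the [i]-th context, completed by the copy [h] of the branch [a] *)
pose patch (i : nat) (h : word -> word) : word -> word := fun l => if l is b :: l' then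
  (if pselect (b = a) then phi a :: h l' else nth id L i l) else [::].
have Hpatch i : local_on (above A a) (fun h => gamma (patch i h)).
  move=> h h' hh; apply: Hg => -[|b l] //= Al; case: pselect => //= Eb.
  by rewrite hh // /above -Eb.
have [g Hge Hgc] := HC1 (fun i h => gamma (patch i h)) Hpatch.
exists (fun b => if pselect (b = phi a) then g else id).
  by move=> b /=; case: pselect => /= [->|_] //; exact: tree_embed_id.
move=> e e' He He' Hee.
have [i il Hi] := HL e (fun l Al => let: conj x _ := (let: And3 x _ _ := He in x) l Al in x).
pose m h : word -> word := behead \o (fun l => h (a :: l)).
have key h : root_embed A F s phi h ->
    (forall b l, b <> a -> A (b :: l) -> e (b :: l) = h (b :: l)) ->
    gamma (lift (fun b => if pselect (b = phi a) then g else id) \o h) = gamma (patch i (g \o m h)).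
  move=> [_ h0 Hh] Heh; apply: Hg => -[|b l] /= Al; first by rewrite h0.
  case: pselect => /= [Eb|nEb].
    rewrite Eb in Al *; have [l' El'] := Hh _ _ Al.
    by rewrite /m /= El' /=; case: pselect.
  rewrite -Heh // Hi //.
  have [l' El'] := Hh _ _ Al; rewrite -Hi // Heh // El' /=.
  case: pselect => //= Eb; case: nEb; apply: Hinj => //.
  by have [_ _ Ap _] := tA; apply: Ap (l) _.
rewrite (key e) // (key e') //; apply: Hgc => //.
  exact: root_embed_branch He _.
exact: root_embed_branch He' _.
Qed.

Lemma root_embed_eq A F s phi phi' e : word_tree A ->
  (forall a, A [:: a] -> phi a = phi' a) -> root_embed A F s phi e -> root_embed A F s phi' e.
Proof.
move=> [_ _ Ap _] Epp [He e0 Hl]; split=> // a l Aal.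
by have [l' ->] := Hl _ _ Aal; exists l'; rewrite Epp //; apply: Ap (l) _.
Qed.

(** The conclusion of [branch_step] survives the passage to a smaller copy, so it
    can be obtained in succession for all directions [phi] and all branches [a],
    finitely many up to their values on the tree. *)
Lemma rooted_product A F : word_tree A -> finite_set F -> ~ F c ->
  (forall a, A [:: a] -> ramsey (above A a)) ->
  forall s k, (forall b, word_tree (s b)) ->
  exists2 C, (forall b, word_tree (C b)) &
    forall gamma : (word -> word) -> 'I_k.+1, local_on A gamma ->
    exists2 f, (forall b, tree_embed (s b) (C b) (f b)) &
      forall phi e e', root_embed A F s phi e -> root_embed A F s phi e' ->
        gamma (lift f \o e) = gamma (lift f \o e').
Proof.
move=> tA fF Fc RA s k Hs.
have tasks (ts : seq ((N -> N) * N)) : exists2 C, (forall b, word_tree (C b)) &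
    forall gamma : (word -> word) -> 'I_k.+1, local_on A gamma ->
    exists2 f, (forall b, tree_embed (s b) (C b) (f b)) &
      forall t, List.In t ts ->
      forall e e', root_embed A F s t.1 e -> root_embed A F s t.1 e' ->
        (forall b l, b <> t.2 -> A (b :: l) -> e (b :: l) = e' (b :: l)) ->
        gamma (lift f \o e) = gamma (lift f \o e').
  elim: ts => [|[phi a] ts [C HC IH]].
    exists s => // gamma _; exists (fun=> id) => // b; exact: tree_embed_id.
  have [D HD step] := branch_step phi tA fF Fc (RA a) k HC.
  exists D => // gamma Hg; have [g Hge Hgc] := step _ Hg.
  have [f Hfe Hfc] := IH (fun e => gamma (lift g \o e)) (local_comp (lift g) Hg).
  exists (fun b => g b \o f b); first by move=> b; exact: tree_embed_comp (Hfe b) (Hge b).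
  rewrite lift_comp => t [<- /=|/Hfc //] e e' He He' Hee.
  apply: (Hgc (lift f \o e) (lift f \o e')).
  - exact: root_embed_lift He.
  - exact: root_embed_lift He'.
  - by move=> b l ba Abl /=; rewrite (Hee b).
have [L HL] := finite_functions id (finite_succ [::] tA) fF.
have [Dl HDl] := finite_listP (finite_succ [::] tA).
have [C HC HCg] := tasks (List.list_prod L Dl).
exists C => // gamma Hg; have [f Hfe Hfc] := HCg _ Hg; exists f => // phi e e' He He'.
have [i il Hi] := HL phi (root_embed_copy He).
have {}He := root_embed_eq tA Hi He; have {}He' := root_embed_eq tA Hi He'.
set psi := nth id L i in He He'.
have {}Hfc a h h' : A [:: a] -> root_embed A F s psi h -> root_embed A F s psi h' ->
    (forall b l, b <> a -> A (b :: l) -> h (b :: l) = h' (b :: l)) ->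
    gamma (lift f \o h) = gamma (lift f \o h').
  move=> Aa; apply: (Hfc (psi, a)); apply/List.in_prod_iff; split; first exact: In_nth.
  exact/HDl.
(* [e] is changed into [e'] one branch at a time, [la] listing the branches
   that are still to be changed *)
suff : forall la h, List.incl la Dl -> root_embed A F s psi h ->
    (forall b l, ~ List.In b la -> A (b :: l) -> h (b :: l) = e' (b :: l)) ->
    gamma (lift f \o h) = gamma (lift f \o e').
  apply=> // [|b l nb Abl]; first exact: List.incl_refl.
  by case: nb; apply/HDl; have [_ _ Ap _] := tA; apply: Ap (l) _.
elim=> [|a la IH] h Hla Hh Hhe.
  apply: Hg => -[|b l] Al /=; last by rewrite Hhe.
  by case: Hh He' => _ -> _ [_ -> _].
have Aa : A [:: a] by apply/HDl/Hla; left.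
pose h' l := if l is b :: l' then (if pselect (b = a) then e' l else h l) else [::].
have Hh' : root_embed A F s psi h'.
  case: Hh He' => He0 h0 Hhl [He'0 e'0 He'l]; split=> // [[|b u] Au|b l Abl]; last first.
  - by rewrite /h'; case: pselect => /= _; [exact: He'l | exact: Hhl].
  - rewrite /h' /=; case: pselect => /= ba; first exact: (He'0 (b :: u) Au).
    exact: (He0 (b :: u) Au).
  have [H1 [phi0 H2 H3]] := He0 _ Au; rewrite h0 in H2 H3.
  have Ephi0 b l : A (b :: l) -> phi0 b = psi b.
    by move=> Abl; have [l1 ] := Hhl _ _ Abl; have [l2 /= ->] := H3 _ _ Abl => -[].
  split; first exact: I.
  exists phi0 => // b l Abl; rewrite /h' /=; case: pselect => /= _; last exact: H3.
  by rewrite (Ephi0 _ _ Abl); have [l' ->] := He'l _ _ Abl; exists l'.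
rewrite (Hfc a h h') // => [|b l ba _]; last by rewrite /h'; case: pselect.
apply: IH => // [b bla|b l nbl Abl]; first by apply: Hla; right.
rewrite /h'; case: pselect => //= ba; apply: Hhe => // -[ab|//]; exact: ba.
Qed.
Lemma root_embed_assemble A F s phi g : word_tree A -> (forall a, word_tree (s a)) ->
  partial_copy (succ A [::]) F phi ->
  (forall a, A [:: a] -> tree_embed (above A a) (s (phi a)) (g a)) ->
  root_embed A F s phi (assemble phi g).
Proof.
move=> tA Hs Hphi Hg; split=> //; last by move=> a l _; exists (g a l).
by apply: assemble_embed => // a; have [] := Hs a.
Qed.

(** This is the Ramsey property of N for its finite substructures, stated with
    total functions on N. *)
Definition ramsey_const (D : set N) := forall E k, finite_set E -> ~ E c ->
  exists F, [/\ finite_set F, ~ F c &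
    forall gamma : (N -> N) -> 'I_k.+1, local_on D gamma ->
    exists2 psi, partial_copy E F psi & forall phi phi',
      partial_copy D E phi -> partial_copy D E phi' ->
      gamma (psi \o phi) = gamma (psi \o phi')].

(** The target is a node whose set of directions [F] comes from the Ramsey property
    of N. All its branches are enlargements of one tree [C1], which is canonical
    for the union [Bs] of all branches of [B]: the direction of [F] that a branch
    of [B] will follow is not known in advance. *)
Lemma root_canonical A : word_tree A -> ramsey_const (succ A [::]) ->
  (forall a, A [:: a] -> ramsey (above A a)) ->
  forall n B k, word_tree B -> (forall l, B l -> size l <= n) ->
  exists2 C, word_tree C & forall gamma : (word -> word) -> 'I_k.+1, local_on A gamma ->
    exists2 f, tree_embed B C f & forall e e', tree_embed A B e -> tree_embed A B e' ->
      e [::] = e' [::] -> gamma (f \o e) = gamma (f \o e').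
Proof.
move=> tA RN RA; elim=> [|n IH] B k tB Bn.
  exists B => // gamma Hg; exists id; first exact: tree_embed_id.
  have B0 l : B l -> l = [::] by move/Bn; case: l.
  by move=> e e' He He' _; apply: Hg => l Al /=;
    have [/B0 -> _] := He _ Al; have [/B0 -> _] := He' _ Al.
have [fB B0 Bp Bc] := tB.
pose Bs : set word := fun l => l = [::] \/ exists b, B (b :: l).
have tBs : word_tree Bs.
  split; [|by left| |].
  - apply: (@sub_finite_set _ _ ([set [::]] `|` behead @` B)) => [l [->|[b Bb]]|].
    + by left.
    + by right; exists (b :: l).
    + by rewrite finite_setU; split; [exact: finite_set1 | exact: finite_image].
  - move=> u v [|[b Bb]]; first by case: u => // _; left.
    by right; exists b; apply: (Bp (b :: u) v).
  - move=> u v [|[b]]; first by case: u.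
    exact: (Bc (b :: u) v).
have Bsn l : Bs l -> size l <= n by case=> [-> //|[b /Bn]].
have aboveBs b : above B b `<=` Bs by move=> l Bl; right; exists b.
have [C1 tC1 HC1] := IH Bs k tBs Bsn.
have [F [fF Fc HF]] := RN _ k (finite_succ [::] tB) (@succ_const _ [::] tB).
have [C2 tC2 HC2] := rooted_product tA fF Fc RA k (fun=> tC1).
exists (node F C2); first exact: node_tree.
move=> gamma Hg; have [f2 Hf2 Hprod] := HC2 _ Hg.
have /boolp.choice [h Hh] : forall j, exists h, tree_embed Bs C1 h /\
    forall e e', tree_embed A Bs e -> tree_embed A Bs e' -> e [::] = e' [::] ->
    gamma (fun l => j :: f2 j (h (e l))) = gamma (fun l => j :: f2 j (h (e' l))).
  move=> j; have Hj : local_on A (fun e => gamma (fun l => j :: f2 j (e l))).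
    by move=> e e' ee'; apply: Hg => l Al; rewrite ee'.
  by have [h Hh Hhc] := HC1 _ Hj; exists h.
(* [d] only serves to name the colour that [rooted_product] makes constant *)
have [d Hd] : exists d : N -> word -> word, forall a, (exists g, tree_embed (above A a) C1 g) ->
    tree_embed (above A a) C1 (d a).
  have /boolp.choice [d Hd] : forall a, exists g, (exists g, tree_embed (above A a) C1 g) ->
      tree_embed (above A a) C1 g.
    move=> a; have [[g Hgg]|ng] := pselect (exists g, tree_embed (above A a) C1 g).
      by exists g.
    by exists id => /ng.
  by exists d.
pose chi phi := gamma (lift f2 \o assemble phi d).
have Hchi : local_on (succ A [::]) chi.
  move=> phi phi' pp; apply: Hg => -[|a l] //= Aal; rewrite pp //.
  by have [_ _ Ap _] := tA; apply: Ap (l) _.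
have [psi Hpsi Hpsic] := HF _ Hchi.
exists (assemble psi (fun b => f2 (psi b) \o h (psi b))).
  apply: assemble_embed => // [a|a Ba]; first by have [] := tC2 a.
  apply: tree_embed_comp (Hf2 _); apply: tree_embed_sub (Hh (psi a)).1 => //.
move=> e e' He He' Ee.
have A0 : A [::] by case: tA.
case Ee0: (e [::]) => [|b u].
  have key h0 : tree_embed A B h0 -> h0 [::] = [::] ->
      exists2 phi, partial_copy (succ A [::]) (succ B [::]) phi &
      gamma (assemble psi (fun b => f2 (psi b) \o h (psi b)) \o h0) = chi (psi \o phi).
    move=> Hh0 h00; have [_ [phi]] := Hh0 _ A0; rewrite h00 => Hphi Hl.
    exists phi => //.
    pose m a := behead \o (fun l => h0 (a :: l)).
    have Hm a : A [:: a] -> tree_embed (above A a) C1 (h (psi (phi a)) \o m a).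
      move=> Aa; apply: tree_embed_comp (Hh _).1.
      apply: (@tree_embed_sub (above A a) (above A a) (above B (phi a))) => //.
      apply: (@behead_embed _ _ _ (fun l => h0 (a :: l))) => [l Al|]; last exact: above_embed.
      exact: (Hl a l Al).
    pose eh := assemble (psi \o phi) (fun a => h (psi (phi a)) \o m a).
    have Heh : root_embed A F (fun=> C1) (psi \o phi) eh.
      by apply: root_embed_assemble => //; exact: partial_copy_comp Hphi Hpsi.
    rewrite /chi -(Hprod (psi \o phi) eh) //.
      apply: Hg => -[|a l] /= Aal; first by rewrite h00.
      by have [l' /= El'] := Hl _ _ Aal; rewrite /m /= El'.
    apply: root_embed_assemble => //; first exact: partial_copy_comp Hphi Hpsi.
    by move=> a Aa; apply: Hd; exists (h (psi (phi a)) \o m a); exact: Hm.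
  have [phi Hphi ->] := key _ He Ee0.
  have [phi' Hphi' ->] := key _ He' (etrans (esym Ee) Ee0).
  exact: Hpsic.
have key h0 : tree_embed A B h0 -> h0 [::] = b :: u ->
   tree_embed A Bs (behead \o h0) /\
   gamma (assemble psi (fun b => f2 (psi b) \o h (psi b)) \o h0) =
   gamma (fun l => psi b :: f2 (psi b) (h (psi b) ((behead \o h0) l))).
  move=> Hh0 h00; have [_ [phi _]] := Hh0 _ A0; rewrite h00 => Hl.
  have Hb l : A l -> exists l', h0 l = b :: l'.
    case: l => [_|a l Aal]; first by exists u.
    by have [l' /= ->] := Hl _ _ Aal; exists (u ++ phi a :: l').
  split; first by apply: tree_embed_sub (behead_embed Hb Hh0).
  by apply: Hg => l /Hb [l' /= ->].
have [H1 ->] := key _ He Ee0; have [H2 ->] := key _ He' (etrans (esym Ee) Ee0).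
by apply: (Hh (psi b)).2 => //=; rewrite Ee.
Qed.

Lemma cons_embed F s a : F a -> tree_embed (s a) (node F s) (cons a).
Proof.
move=> Fa u su; split=> //; exists id; last by move=> b l _; exists l.
by apply: partial_copy_incl => b sb; split.
Qed.

(** The induction is on the sum of the heights of the trees [B i]. If the root of
    the target has colour [i], each branch of [B i] is sought in colour [i] in the
    branch of the target with the same letter; where this fails, the induction
    hypothesis gives there a copy of some other [B j] in its colour [j]. The letters
    at the root of the target are those of all the [B i], because the colour of the
    root is not known in advance. *)
Lemma vertex_ramsey k n : forall (B : 'I_k.+1 -> set word) (d : 'I_k.+1 -> nat),
  (forall i, word_tree (B i)) -> (forall i l, B i l -> size l <= d i) ->
  \sum_i d i < n ->
  exists2 C, word_tree C & forall gamma : word -> 'I_k.+1,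
    exists i, exists2 f, tree_embed (B i) C f & forall u, B i u -> gamma (f u) = i.
Proof.
elim: n => // n IH B d tB Bd dn.
pose upd i T := fun j : 'I_k.+1 => if j == i then T else B j.
have /boolp.choice [C1 HC1] : forall p : 'I_k.+1 * N, exists C, word_tree C /\
    (B p.1 [:: p.2] -> forall gamma : word -> 'I_k.+1,
    exists i, exists2 f, tree_embed (upd p.1 (above (B p.1) p.2) i) C f &
      forall u, upd p.1 (above (B p.1) p.2) i u -> gamma (f u) = i).
  move=> [i a] /=; have [Ba|nBa] := pselect (B i [:: a]); last by exists (B i).
  have [j|j l||C tC HC] := IH (upd i (above (B i) a))
    (fun j => if j == i then (d i).-1 else d j).
  - by rewrite /upd; case: ifP => // _; exact: above_tree.
  - by rewrite /upd; case: ifP => [_ /Bd /= ?|_ /Bd //]; lia.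
  - rewrite (bigD1 i) //= eqxx (eq_bigr d) => [|j /negbTE -> //].
    move: dn; rewrite (bigD1 i) //=.
    by have /= := Bd _ _ Ba; lia.
  - by exists C.
pose F : set N := \bigcup_i succ (B i) [::].
pose J a := \bigcup_i C1 (i, a).
have fF : finite_set F.
  by apply: bigcup_finite => [|i _]; [exact: finite_finset | exact: finite_succ].
have Fc : ~ F c by case=> i _; exact: succ_const.
have tJ a : word_tree (J a) by apply: (union_tree ord0) => i; exact: (HC1 (i, a)).1.
exists (node F J); first exact: node_tree.
move=> gamma; set i := gamma [::].
have Fi a : B i [:: a] -> F a by exists i.
have CJ a : C1 (i, a) `<=` J a by move=> l Cl; exists i.
have [[a [Ba [j [ji [f Hf Hfg]]]]]|no] := pselect (exists a, B i [:: a] /\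
    exists j, j != i /\ exists2 f, tree_embed (B j) (C1 (i, a)) f &
      forall u, B j u -> gamma (a :: f u) = j).
  exists j; exists (cons a \o f) => //.
  apply: tree_embed_comp (cons_embed (Fi _ Ba)); exact: tree_embed_sub Hf.
have /boolp.choice [g Hg] : forall a, exists f, B i [:: a] ->
    tree_embed (above (B i) a) (C1 (i, a)) f /\
    forall u, above (B i) a u -> gamma (a :: f u) = i.
  move=> a; have [Ba|nBa] := pselect (B i [:: a]); last by exists id => /nBa.
  have [_ /(_ Ba (fun l => gamma (a :: l))) [j [f]]] := HC1 (i, a); rewrite /upd /=.
  case: ifPn => [/eqP -> Hf Hfg|ji Hf Hfg]; first by exists f.
  by case: no; exists a; split=> //; exists j; split=> //; exists f.
exists i, (assemble id g).
  apply: assemble_embed => //; first by move=> a; have [] := tJ a.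
  by move=> a /Hg [Hga _]; apply: tree_embed_sub Hga.
move=> [|a u] Bu //=; apply: (Hg a _).2 => //.
by have [_ _ Bp _] := tB i; apply: Bp (u) _.
Qed.

Lemma finite_words_bounded (T : set word) : finite_set T ->
  exists n, forall l, T l -> size l <= n.
Proof.
move=> /finite_listP [s Es]; suff [n Hn] : exists n, forall l, List.In l s -> size l <= n.
  by exists n => l /Es; exact: Hn.
elim: s {Es} => [|x s [n Hn]]; first by exists 0.
exists (maxn (size x) n) => l /= [<-|/Hn ln]; first exact: leq_maxl.
exact: leq_trans ln (leq_maxr _ _).
Qed.

Theorem word_tree_ramsey : (forall D, finite_set D -> ~ D c -> ramsey_const D) ->
  forall A, word_tree A -> ramsey A.
Proof.
move=> RN A tA; have [n] := finite_words_bounded (let: And4 x _ _ _ := tA in x).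
rewrite (_ : (forall l, _ -> _) = (forall l, A l -> size l < n.+1)) //.
elim: n.+1 A tA => {n} [|n IH] A tA An; first by have [_ /An] := tA.
have RA a : A [:: a] -> ramsey (above A a).
  by move=> Aa; apply: IH => [|l /An //]; exact: above_tree.
have RA0 := RN _ (finite_succ [::] tA) (@succ_const _ [::] tA).
move=> B k tB; have [m Bm] := finite_words_bounded (let: And4 x _ _ _ := tB in x).
have [B1 tB1 HB1] := @vertex_ramsey k _ (fun=> B) (fun=> m) (fun=> tB) (fun=> Bm) (ltnSn _).
have [m1 B1m] := finite_words_bounded (let: And4 x _ _ _ := tB1 in x).
have [C tC HC] := root_canonical tA RA0 RA k tB1 B1m.
exists C => // gamma Hg; have [f Hf Hfc] := HC _ Hg.
have /boolp.choice [e0 He0] : forall u, exists e0, forall e, tree_embed A B1 e -> e [::] = u ->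
    tree_embed A B1 e0 /\ e0 [::] = u.
  move=> u; have [[e [He eu]]|ne] := pselect (exists e, tree_embed A B1 e /\ e [::] = u).
    by exists e.
  by exists id => e He eu; case: ne; exists e.
have [i [g Hge Hgc]] := HB1 (fun u => gamma (f \o e0 u)).
have A0 : A [::] by case: tA.
exists (f \o g); first exact: tree_embed_comp Hge Hf.
have key e : tree_embed A B e -> gamma ((f \o g) \o e) = i.
  move=> He; have [Be _] := He _ A0; rewrite -(Hgc _ Be).
  have Hge' := tree_embed_comp He Hge.
  by have [H1 H2] := He0 _ _ Hge' erefl; apply: (Hfc (g \o e)).
by move=> e e' /key -> /key ->.
Qed.
End Words.

(** * The Ramsey property of the structure of colours *)
Section ConstantRamsey.
Variables (L0 : rel_signature) (N : structure (add_constant L0)).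
Notation c := (the_constant N).

Lemma fint_const (f : Defs.fsym (add_constant L0)) (a : 'I_(far f) -> N) : fint (M := N) f a = c.
Proof. by case: f a => a; congr fint; apply: funext => -[]. Qed.

Lemma with_const_closed D : @Defs.fclosed _ N (with_const D).
Proof. by move=> f a _; left; exact: fint_const. Qed.

Lemma finite_with_const (D : set N) : finite_set D -> finite_set (with_const D).
Proof.
move=> fD; rewrite (_ : with_const D = [set c] `|` D); last by apply/seteqP; split.
by rewrite finite_setU; split=> //; exact: finite_set1.
Qed.

Lemma finite_generation (L : signature) (M : structure L) (S : set M) :
  Defs.fclosed S -> finite_set S -> finitely_generated S.
Proof.
move=> clS fS; exists S => //; apply/seteqP; split; last exact: smallest_sub.
exact: sub_gen_smallest.
Qed.

Lemma embedding_id (L : signature) (M : structure L) : @embedding _ M M id.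
Proof. by split. Qed.

Lemma age_substructure (L : signature) (M : structure L) (S : set M) (clS : Defs.fclosed S) :
  finite_set S -> age M (substructure clS).
Proof.
move=> fS; exists S, clS; split; first exact: finite_generation.
by exists id; split; [exists id | exact: embedding_id].
Qed.

Lemma finitely_generated_finite (S : set N) : finitely_generated S -> finite_set S.
Proof.
case=> G fG ->; apply: sub_finite_set (finite_with_const fG).
apply: smallest_sub => [|x Gx]; [exact: with_const_closed | by right].
Qed.

Lemma ramsey_structure_const : ramsey_structure N ->
  forall D : set N, finite_set D -> ~ D c -> ramsey_const D.
Proof.
move=> RN D fD Dc E k fE Ec.
pose A := substructure (@with_const_closed D).
pose B := substructure (@with_const_closed E).
have Eext phi : partial_copy D E phi -> forall x : A, with_const E (phi (sval x)).
  by move=> [H1 H2 _ _] [x /= [->|Dx]]; [left | right; exact: H1].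
pose emb phi (Hphi : partial_copy D E phi) : A -> B :=
  fun x => exist _ (phi (sval x)) (Eext phi Hphi x).
have embP phi (Hphi : partial_copy D E phi) : @embedding _ A B (emb phi Hphi).
  case: (Hphi) => H1 H2 H3 H4; split.
  - move=> [x Dx] [y Dy] /= [] /(H3 _ _ Dx Dy) exy; exact: eq_exist.
  - move=> f a; apply: eq_exist; rewrite /= !fint_const //.
  - by move=> r a; apply: H4 => i; exact: (svalP (a i)).
have [[e He]|no] := pselect (exists e, @embedding _ A B e); last first.
  exists E; split=> // gamma _; exists id; first exact: partial_copy_id.
  by move=> phi phi' Hphi; case: no; exists (emb _ Hphi); exact: embP.
have [C [S [clS [fgS [h [hb [hinj hf hr]]]]]] [_ HC]] :=
  RN A B (age_substructure (@with_const_closed D) (finite_with_const fD))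
     (age_substructure (@with_const_closed E) (finite_with_const fE))
     (ex_intro _ e He) k.+1 isT.
have Sc : S c by rewrite -(fint_const (f := tt) (fun i : 'I_0 => c)); apply: (clS) => -[].
have WS : with_const (S `\ c) = S.
  by apply/seteqP; split=> x; [case=> [->|[]] | have [->|] := pselect (x = c); [left|right]].
exists (S `\ c); split; [by apply: finite_setD; exact: finitely_generated_finite | by case=> _; apply |].
move=> gamma Hg.
pose ext (X : set N) (m : {x | X x} -> C) : N -> N :=
  fun x => if pselect (X x) is left p then sval (h (m (exist _ x p))) else x.
have extE (X : set N) (m : {x | X x} -> C) x (p : X x) : ext X m x = sval (h (m (exist _ x p))).
  rewrite /ext; case: pselect => [q|//]; by rewrite (Prop_irrelevance p q).
have [f [finj ff fr] Hf] := HC (fun m => gamma (ext (with_const D) m)).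
pose psi := ext (with_const E) f.
have psic : psi c = c.
  have Wc : with_const E c by left.
  rewrite /psi (extE _ _ _ Wc).
  have -> : exist _ c Wc = fint (M := B) (tt : Defs.fsym (add_constant L0)) (fun i : 'I_0 => exist _ c Wc).
    by apply: eq_exist; rewrite fint_const.
  by rewrite ff hf /= fint_const.
have psiinj a b : with_const E a -> with_const E b -> psi a = psi b -> a = b.
  move=> Ea Eb; rewrite /psi (extE _ _ _ Ea) (extE _ _ _ Eb).
  by move=> /sval_inj /hinj /finj [].
exists psi.
  split=> //.
  - move=> a Ea; split; last first.
      move=> psia; apply: Ec; rewrite -(psiinj a c) //; [by right | by left|by rewrite psic].
    by rewrite /psi (extE _ _ _ (or_intror Ea)); exact: svalP.
  - move=> r x Hx.
    have := fr r (fun i => exist _ (x i) (Hx i)); rewrite hr /= => ->.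
    rewrite (_ : (fun i => _) = psi \o x) //.
    by apply: funext => i; rewrite /psi /= (extE _ _ _ (Hx i)).
move=> phi phi' Hphi Hphi'.
have key p (Hp : partial_copy D E p) : gamma (psi \o p) = gamma (ext (with_const D) (f \o emb p Hp)).
  apply: Hg => x Dx; have Wx : with_const D x by right.
  rewrite (extE _ _ _ Wx) /= /psi.
  by rewrite (extE _ _ _ (Eext _ Hp (exist _ x Wx))).
by rewrite (key _ Hphi) (key _ Hphi'); apply: Hf; exact: embP.
Qed.
End ConstantRamsey.

(** * Embeddings of structures with components *)
Section ComponentEmbeddings.
Variable L0 : rel_signature.

Lemma comp_embedding_id (A : comp_structure L0) : comp_embedding (id : A -> A).
Proof.
split; first by split.
move=> r p q Eq; have -> : p = q by apply: funext => i; apply: sval_inj; rewrite Eq; case: (sval (p i)).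
by [].
Qed.

Lemma comp_embedding_comp (A B C : comp_structure L0) (f : A -> B) (g : B -> C) :
  comp_embedding f -> comp_embedding g -> comp_embedding (g \o f).
Proof.
move=> [[fi ff fr] fc] [[gi gf gr] gc]; split; first split.
- exact: inj_comp.
- by move=> s a /=; rewrite ff gf.
- by move=> r a; apply: iff_trans (fr r a) _; exact: gr.
- move=> r p q Eq.
  have ne i : f (sval (p i)).1 <> f (sval (p i)).2 by move=> /fi; exact: (svalP (p i)).
  pose m i : Defs.dpair B := exist (fun q : B * B => q.1 <> q.2) (f (sval (p i)).1, f (sval (p i)).2) (ne i).
  by apply: iff_trans (fc r p m _) _ => //; apply: gc => i; rewrite Eq.
Qed.

Lemma comp_embedding_inverse (A B : comp_structure L0) (h : A -> B) (g : B -> A) :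
  cancel h g -> cancel g h -> comp_embedding h -> comp_embedding g.
Proof.
move=> hK gK [[hi hf hr] hc]; split; first split.
- exact: can_inj gK.
- move=> f a; apply: hi; rewrite gK hf; congr fint; apply: funext => i /=; by rewrite gK.
- move=> r a; rewrite hr; have -> : h \o (g \o a) = a by apply: funext => i /=; rewrite gK.
  by [].
- move=> r p q Eq; apply: iff_sym; apply: hc => i; rewrite Eq /= !gK; by case: (sval (p i)).
Qed.

End ComponentEmbeddings.

Import Order.TTheory GRing.Theory Num.Theory.
Import numFieldNormedType.Exports.

(** * Paths in locally connected compact metric spaces *)
Lemma connected_locally_constant (T : topologicalType) (V : set T) (Q : T -> Prop) :
  connected V ->
  (forall v, V v -> exists G, [/\ open G, G v & forall w, G w -> V w -> (Q v <-> Q w)]) ->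
  forall u v, V u -> V v -> Q u -> Q v.
Proof.
move=> cV loc u v Vu Vv Qu.
pose U (P : T -> Prop) := \bigcup_(G in [set G | open G /\ forall w, G w -> V w -> P w]) G.
have oU P : open (U P) by apply: bigcup_open => G [].
have E : V `&` U Q = V.
  apply: cV.
  - have [G [oO Ou HO]] := loc _ Vu; exists u; split=> //; exists G => //.
    by split=> // w Ow Vw; apply/(HO w).
  - by exists (U Q).
  - exists (~` U (fun w => ~ Q w)); first exact: open_closedC.
    apply/seteqP; split=> w [Vw].
      by case=> G [oO HO] Ow; split=> // -[G' [oO' HO'] G'w]; apply: (HO' w); last exact: HO.
    move=> nU; split=> //; have [G [oO Ow HO]] := loc _ Vw; exists G => //; split=> // w' Ow' Vw'.
    apply/(HO w' Ow' Vw'); apply: contrapT => nQ; apply: nU; exists G => //; split=> // z Oz Vz.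
    by move/(HO z Oz Vz).
by move: Vv; rewrite -E => -[Vv [G [_ HO] Ov]]; exact: HO.
Qed.

Section RealFunctions.
Local Open Scope ring_scope.
Variable R : realType.

Lemma within_continuousP (f : R -> R) (A : set R) :
  (forall t e, A t -> 0 < e -> exists2 del : R, 0 < del & forall s, A s -> `|s - t| < del -> `|f t - f s| < e) ->
  {within A, continuous f}.
Proof.
move=> H; apply/subspace_continuousP => t At; apply/cvgrPdist_lt => e e0.
have [del del0 Hdel] := H t e At e0.
near=> s; apply: Hdel.
  by near: s; exact: withinT.
near: s; apply: cvg_within; exists del => // s /=; by rewrite distrC.
Unshelve. all: by end_near.
Qed.

(** The minimum of the larger of [v] and [e - u] is positive, and it is the bound
    wanted. Applied in both directions to two functions with the same fibres on
    the unit interval, this makes the induced bijection of the quotients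
    bicontinuous. *)
Lemma unit_interval_modulus (u v : R -> R) :
  {within `[0, 1], continuous u} -> {within `[0, 1], continuous v} ->
  (forall t : R, 0 <= t <= 1 -> 0 <= v t) -> (forall t : R, 0 <= t <= 1 -> v t = 0 -> u t = 0) ->
  forall e, 0 < e -> exists2 del : R, 0 < del & forall t : R, 0 <= t <= 1 -> v t < del -> u t < e.
Proof.
move=> cu cv v0 vu e e0.
have cw : {within `[0, 1], continuous (v \max (cst e - u))}.
  by move=> t; apply: continuous_max; [exact: cv | apply: continuousB; [exact: cst_continuous | exact: cu]].
have [c c01 Hc] := EVT_min ler01 cw.
rewrite in_itv /= in c01.
have {}Hc t : 0 <= t <= 1 -> Num.max (v c) (e - u c) <= Num.max (v t) (e - u t).
  by move=> t01; apply: Hc; rewrite in_itv.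
have M0 : 0 < Num.max (v c) (e - u c).
  rewrite lt_max; have [/vu -> //|nv] := eqVneq (v c) 0; first by rewrite subr0 e0 orbT.
  by rewrite lt_neqAle eq_sym nv v0.
exists (Num.max (v c) (e - u c)) => // t t01 vt.
have := Hc t t01; move: (Num.max (v c) _) M0 vt => M M0 vt.
by rewrite le_max leNgt vt /=; lra.
Qed.
End RealFunctions.

Section Dendrite.
Local Open Scope ring_scope.
Variables (R : realType) (W : topologicalType) (d : W -> W -> R).

(** A bound by 1 loses no generality, and it allows an arbitrary connected open set
    to be the first link of a chain. *)
Definition metrizes :=
  [/\ forall x, d x x = 0, forall x y, d x y = 0 -> x = y,
      forall x y, d x y = d y x, forall y x z, d x z <= d x y + d y z
    & (forall x y, d x y <= 1) /\
      forall x (A : set W), nbhs x A <-> exists2 e : R, 0 < e & forall y, d x y < e -> A y].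

Hypotheses (d_metric : metrizes) (W_compact : compact [set: W])
  (W_lc : locally_connected W) (W_uac : uniquely_arcwise_connected R W).

Let dxx x : d x x = 0. Proof. by have [] := d_metric. Qed.
Let d_eq0 x y : d x y = 0 -> x = y. Proof. by have [_ H _ _ _] := d_metric; exact: H. Qed.
Let dC x y : d x y = d y x. Proof. by have [] := d_metric. Qed.
Let dtri y x z : d x z <= d x y + d y z. Proof. by have [_ _ _ H _] := d_metric. Qed.
Let d_le1 x y : d x y <= 1. Proof. by have [_ _ _ _ []] := d_metric. Qed.
Let d_nbhs x (A : set W) : nbhs x A <-> exists2 e : R, 0 < e & forall y, d x y < e -> A y.
Proof. by have [_ _ _ _ []] := d_metric. Qed.
Let d_ge0 x y : 0 <= d x y.
Proof. by have := dtri y x x; rewrite dxx (dC y x); lra. Qed.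

(** A path is defined on the whole line, which spares the restriction to the unit
    interval when paths are glued and reparametrized. *)
Definition cpath (p : R -> W) :=
  forall t e, 0 < e -> exists2 del : R, 0 < del & forall s, `|s - t| < del -> d (p t) (p s) < e.

Notation rad k := ((2^-1 : R) ^+ k).

Definition small_link (k : nat) (C : set W) :=
  [/\ open C, connected C & forall u v, C u -> C v -> d u v <= rad k].

Lemma exists_small_link k (U : set W) x : open U -> U x ->
  exists C, [/\ small_link k C, C x & C `<=` U].
Proof.
move=> oU Ux; pose B := [set y | d x y < rad k / 2].
have /W_lc [C [oC Cx cC CU]] : nbhs x (U `&` B).
  apply: filterI; first exact: open_nbhs_nbhs.
  by apply/d_nbhs; exists (rad k / 2) => //; rewrite divr_gt0 ?exprn_gt0.
exists C; split=> //; last by move=> y /CU [].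
split=> // u v /CU [_ Bu] /CU [_ Bv].
have := dtri x u v; rewrite (dC u x); rewrite /B /= in Bu Bv; lra.
Qed.

(** The chain is constant from [m] on, so that finitely many chains can be given the
    same length. *)
Definition chain k (C : set W) (m : nat) (r : nat -> W) (D : nat -> set W) (u v : W) :=
  [/\ r 0%N = u, forall j, (m <= j)%N -> r j = v
    & forall j, [/\ small_link k (D j), D j `<=` C, D j (r j) & D j (r j.+1)]].

(** The points that a chain joins to [u] form a relatively clopen subset of [C]. *)
Lemma exists_chain k (C : set W) u v : open C -> connected C -> C u -> C v ->
  exists m r D, chain k C m r D u v /\ (u = v -> m = 0%N).
Proof.
move=> oC cC Cu Cv.
have refl : exists r D, chain k C 0 r D u u.
  have [D [sD Du DC]] := exists_small_link k oC Cu.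
  by exists (fun=> u), (fun=> D).
have [<-|uv] := pselect (u = v).
  by have [r [D H]] := refl; exists 0%N, r, D.
suff [m [r [D H]]] : exists m r D, chain k C m r D u v by exists m, r, D.
pose Q v := exists m r D, chain k C m r D u v.
apply: (@connected_locally_constant W C Q cC _ u v Cu Cv); last first.
  by have [r [D H]] := refl; exists 0%N, r, D.
move=> w Cw; have [D [sD Dw DC]] := exists_small_link k oC Cw.
have ext a b : D a -> D b -> Q a -> Q b.
  move=> Da Db [m [r [E [r0 rm HE]]]].
  exists m.+1, (fun j => if (j <= m)%N then r j else b), (fun j => if (j < m)%N then E j else D).
  split=> [//|j mj|j]; first by rewrite leqNgt mj.
  have [jm|mj] := ltnP j m; first by have := HE j; rewrite (ltnW jm).
  split=> //; case: ifP => // jm; by rewrite rm.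
have [oD _ _] := sD; exists D; split=> // z Dz Cz; split; exact: ext.
Qed.

Lemma rad_lt (e : R) : 0 < e -> exists k, rad k < e.
Proof.
move=> e0; exists (Num.truncn e^-1); rewrite exprVn invf_plt ?posrE ?exprn_gt0 //.
apply: lt_le_trans (truncnS_gt _) _.
by rewrite -natrX ler_nat ltn_expl.
Qed.

Lemma divn_modnS M i : (0 < M)%N ->
  [/\ ((i %% M).+1 < M)%N, (i.+1 %/ M = i %/ M)%N & (i.+1 %% M = (i %% M).+1)%N] \/
  [/\ (i %% M).+1 = M, (i.+1 %/ M = (i %/ M).+1)%N & (i.+1 %% M = 0)%N].
Proof.
move=> M0; have := ltn_pmod i M0; rewrite leq_eqVlt => /orP [/eqP E|iM]; [right|left].
  have -> : i.+1 = ((i %/ M).+1 * M)%N by rewrite {1}(divn_eq i M) -addnS E mulSn addnC.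
  by rewrite mulnK // modnMl.
have -> : i.+1 = (i %/ M * M + (i %% M).+1)%N by rewrite addnS -divn_eq.
by rewrite divnMDl // (divn_small iM) addn0 modnMDl (modn_small iM).
Qed.

(** The position of [t] at one level determines its position at the coarser
    levels. *)
Lemma truncn_divn (t : R) (P M : nat) : (0 < M)%N ->
  (Num.truncn (t * (P * M)%:R) %/ M)%N = Num.truncn (t * P%:R).
Proof.
move=> M0; have E n : (Num.truncn (t * (P * M)%:R) %/ M <= n)%N = (Num.truncn (t * P%:R) <= n)%N.
  rewrite -ltnS ltn_divLR // truncn_le_nat natrM mulrA -(ltr_pM2r (x := M%:R)) ?ltr0n //.
  by rewrite -natrM -[(n.+1 * M)%N]prednK ?muln_gt0 // ltnS truncn_le_nat.
by apply/eqP; rewrite eqn_leq E leqnn -E leqnn.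
Qed.

(** A level divides the unit interval into [P] steps, with a point at the beginning
    of each step and a link that contains the points at both ends of the step. A
    finer level divides each step into the same number [M] of steps, whose links
    lie in the link of that step. The step functions so defined converge uniformly,
    and their jumps tend to 0. *)
Lemma exists_path (U : set W) a b : open U -> connected U -> U a -> U b ->
  exists p : R -> W, [/\ cpath p, forall t, t <= 0 -> p t = a, forall t, 1 <= t -> p t = b &
    forall t, closure U (p t)].
Proof.
move=> oU cU Ua Ub.
pose level := (nat * (nat -> W) * (nat -> set W))%type.
pose lP k (l : level) := [/\ (0 < l.1.1)%N, l.1.2 0%N = a,
  forall i, (l.1.1 <= i)%N -> l.1.2 i = b &
  forall i, [/\ small_link k (l.2 i), l.2 i `<=` U, l.2 i (l.1.2 i) & l.2 i (l.1.2 i.+1)]].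
pose refines (l l' : level) := exists M, [/\ (0 < M)%N, l'.1.1 = (l.1.1 * M)%N &
  forall j, l'.2 j `<=` l.2 (j %/ M)%N].
have step (kl : nat * level) : exists l', lP kl.1 kl.2 -> lP kl.1.+1 l' /\ refines kl.2 l'.
  case: kl => k [[P q] C] /=; have [HlP|nlP] := pselect (lP k (P, q, C)); last by exists (P, q, C).
  have [/= P0 q0 qP HC] := HlP.
  have /boolp.choice [f Hf] : forall i, exists t : nat * (nat -> W) * (nat -> set W),
      chain k.+1 (C i) t.1.1 t.1.2 t.2 (q i) (q i.+1) /\ (q i = q i.+1 -> t.1.1 = 0%N).
    move=> i; have [[oC cC _] _ Ci Ci'] := HC i.
    by have [m [r [D H]]] := exists_chain k.+1 oC cC Ci Ci'; exists (m, r, D).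
  pose M := (\max_(i < P) (f i).1.1).+1.
  have mM i : ((f i).1.1 < M)%N.
    rewrite ltnS; have [iP|Pi] := ltnP i P; first exact: (leq_bigmax (Ordinal iP)).
    by rewrite (Hf i).2 // !qP // leqW.
  exists (P * M, fun j => (f (j %/ M)%N).1.2 (j %% M)%N, fun j => (f (j %/ M)%N).2 (j %% M)%N)%N => _.
  have M0 : (0 < M)%N by [].
  split; last by exists M; split=> // j /=; have [_ _ /(_ (j %% M)%N) []] := (Hf (j %/ M)%N).1.
  split=> /= [|||i].
  - by rewrite muln_gt0 P0.
  - by rewrite div0n mod0n; have [-> _ _] := (Hf 0%N).1.
  - move=> i; rewrite -leq_divRL // => Pi.
    have [_ -> //] := (Hf (i %/ M)%N).1; first by rewrite qP // leqW.
    by rewrite (Hf _).2 // !qP // leqW.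
  have [r0 rm /(_ (i %% M)%N) [sD DC Di Di']] := (Hf (i %/ M)%N).1; split=> //.
    by move=> x /DC; have [_ CU _ _] := HC (i %/ M)%N; exact: CU.
  have [[iM -> ->]|[iM -> ->]] := divn_modnS i M0; first by [].
  have [-> _ _] := (Hf (i %/ M).+1).1; rewrite -(rm (i %% M).+1) //.
  by rewrite iM ltnW.
have [nxt Hnxt] := boolp.choice step.
pose L := fix L k : level := if k is k'.+1 then nxt (k', L k')
  else (1%N, fun i => if i is 0%N then a else b, fun=> U).
have HL k : lP k (L k).
  elim: k => [|k IH]; last by have [] := Hnxt (k, L k) IH.
  by split=> // [[]|i] //=; split=> //; case: i => // i; split=> // x y _ _; rewrite expr0.
have HLr k : refines (L k) (L k.+1) by have [] := Hnxt (k, L k) (HL k).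
pose idx k (t : R) := Num.truncn (t * (L k).1.1%:R).
pose f k t := (L k).1.2 (idx k t).
have Cnest k j t : (k <= j)%N -> (L j).2 (idx j t) `<=` (L k).2 (idx k t).
  elim: j => [|j IH]; first by rewrite leqn0 => /eqP ->.
  rewrite leq_eqVlt => /orP [/eqP <- //|/IH kj] x Cx; apply: kj.
  have [M [M0 HM HC]] := HLr j.
  by have := HC _ _ Cx; rewrite /idx HM truncn_divn.
have fC k j t : (k <= j)%N -> (L k).2 (idx k t) (f j t).
  by move=> /Cnest; apply; have [_ _ _ /(_ (idx j t)) []] := HL j.
have fd k j t : (k <= j)%N -> d (f k t) (f j t) <= rad k.
  by move=> kj; have [_ _ _ /(_ (idx k t)) [[_ _ Hd] _ Ck _]] := HL k; apply: Hd => //; exact: fC.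
(* compactness provides the limit: a cluster point of the step functions at [t] *)
have /boolp.choice [p Hp] : forall t, exists y, forall k, d (f k t) y <= rad k.
  move=> t; have [|y [_ Hy]] := W_compact (F := (fun k => f k t) @ \oo).
    exact: filterT.
  exists y => k; apply/ler_addgt0Pr => e e0.
  have [z [[j kj <-] /= yz]] : [set f j t | j in [set j | (k <= j)%N]] `&` [set z | d y z < e] !=set0.
    apply: Hy; last by apply/d_nbhs; exists e.
    by exists k => // j /= kj; exists j.
  have := dtri (f j t) (f k t) y; have := fd _ _ t kj; rewrite /= in yz; rewrite (dC (f j t) y).
  by move=> *; lra.
have eq0 x y : (forall k, d x y <= rad k) -> x = y.
  have [_ H _ _ _] := d_metric; move=> xy; apply: H; apply/eqP; rewrite eq_le; apply/andP; split.
    apply/ler_addgt0Pr => e /rad_lt [k ke]; rewrite add0r; exact: le_trans (xy k) (ltW ke).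
  by have := dtri y x x; rewrite dxx (dC y x); lra.
exists p; split.
- move=> t e e0; have [k ke] := rad_lt (divr_gt0 e0 (ltr0n R 3)).
  have P0 : 0 < (L k).1.1%:R :> R by rewrite ltr0n; have [] := HL k.
  exists ((L k).1.1%:R^-1); first by rewrite invr_gt0.
  have near s s' : s <= s' -> s' < s + (L k).1.1%:R^-1 -> d (f k s) (f k s') <= rad k.
    move=> ss' s's; have [_ _ _ /(_ (idx k s)) [[_ _ Hd] _ C1 C2]] := HL k; apply: Hd => //.
    rewrite /f; have : (idx k s <= idx k s')%N by apply: le_truncn; rewrite ler_pM2r.
    rewrite leq_eqVlt => /orP [/eqP <- //|lt].
    suff -> : idx k s' = (idx k s).+1 by [].
    apply/eqP; rewrite eqn_leq lt andbT /idx truncn_le_nat -natr1.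
    apply: (@lt_trans _ _ (s * (L k).1.1%:R + 1)); last by rewrite ltrD2r truncnS_gt.
    by rewrite -(ltr_pM2r P0) mulrDl mulVf ?gt_eqF in s's.
  move: (_^-1) near => del near s; rewrite ltr_norml => /andP [s1 s2].
  have H : d (f k t) (f k s) <= rad k.
    have [ts|/ltW st] := lerP t s; first by apply: near => //; lra.
    by rewrite dC; apply: near => //; lra.
  have := dtri (f k t) (p t) (p s); have := dtri (f k s) (f k t) (p s).
  have := Hp t k; have := Hp s k; rewrite (dC (p t) (f k t)); lra.
- move=> t t0; apply/esym/eq0 => k; rewrite -[a](_ : f k t = a) //.
  rewrite /f /idx; have [P0 q0 _ _] := HL k.
  suff -> : Num.truncn (t * (L k).1.1%:R) = 0%N by [].
  apply/eqP; rewrite -leqn0 truncn_le_nat.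
  by apply: (@le_lt_trans _ _ 0) => //; rewrite pmulr_lle0 ?ltr0n.
- move=> t t1; apply/esym/eq0 => k; rewrite -[b](_ : f k t = b) //.
  have [P0 _ qP _] := HL k; apply: qP.
  apply: leq_trans (le_truncn (_ : (L k).1.1%:R <= t * (L k).1.1%:R)); first by rewrite natrK.
  by rewrite ler_peMl.
- move=> t B /d_nbhs [e e0 HB]; have [k ke] := rad_lt e0.
  exists (f k t); split; last by apply: HB; rewrite dC; exact: le_lt_trans (Hp t k) ke.
  have [_ _ _ /(_ (idx k t)) [_ CU Cf _]] := HL k; exact: CU.
Qed.

(** * From paths to arcs *)
Lemma open_ballP (G : set R) t : open G -> G t ->
  exists2 e : R, 0 < e & forall s, `|s - t| < e -> G s.
Proof.
move=> oG Gt; have /nbhs_ballP [e e0 He] := open_nbhs_nbhs (conj oG Gt).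
by exists e => // s st; apply: He; rewrite -ball_normE /= distrC.
Qed.

Lemma last_outside (G : set R) s m : open G -> s <= m -> ~ G s ->
  exists l, [/\ s <= l <= m, ~ G l & forall r, l < r -> r <= m -> G r].
Proof.
move=> oG sm nGs; pose E := [set r | r <= m /\ ~ G r].
have ubE : ubound E m by move=> r [].
have sE : E s by [].
have hub : has_ubound E by exists m.
have hE : has_sup E by split=> //; exists s.
exists (sup E); split.
- by apply/andP; split; [exact: (ub_le_sup hub sE) | exact: (ge_sup (ex_intro _ s sE) ubE)].
- move=> GE; have [e e0 He] := open_ballP oG GE.
  have [r [rm nGr] lr] := sup_adherent e0 hE.
  apply: (nGr); apply: He.
  have rl : r <= sup E by exact: (ub_le_sup hub (conj rm nGr)).
  by rewrite ler0_norm; lra.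
- move=> r lr rm; apply: contrapT => nGr; have rl : r <= sup E by exact: (ub_le_sup hub (conj rm nGr)).
  by move: rl; rewrite leNgt lr.
Qed.

Lemma first_outside (G : set R) m t : open G -> m <= t -> ~ G t ->
  exists l, [/\ m <= l <= t, ~ G l & forall r, m <= r -> r < l -> G r].
Proof.
move=> oG mt nGt.
have [||//|l [lm nGl Hl]] := @last_outside (-%R @^-1` G) (- t) (- m).
- by apply: open_comp => // x _; exact: opp_continuous.
- by rewrite lerN2.
- by rewrite /= opprK.
exists (- l); split=> //; first lra.
by move=> r mr rl; have := Hl (- r); rewrite /= opprK; apply; lra.
Qed.

Section Erase.
Variable p : R -> W.
Hypothesis cp : cpath p.

(** An open set of times can be erased when each of its intervals carries a loop,
    that is, when the path takes the same value at the two ends. *)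
Definition erasable (G : set R) := [/\ open G, forall r, G r -> 0 < r < 1
  & forall s t, s < t -> ~ G s -> ~ G t -> (forall r, s < r < t -> G r) -> p s = p t].

(** If the ends of an interval of the union had distinct images, two disjoint
    neighbourhoods of them would contain the images of short intervals at both
    ends. By compactness the rest of the interval lies in a single member of the
    chain, whose interval around it ends in these short intervals and is a loop. *)
Lemma erasable_chain (F : set (set R)) : F `<=` erasable -> total_on F subset ->
  erasable (\bigcup_(G in F) G).
Proof.
move=> Fe Ft; split.
- by apply: bigcup_open => G /Fe [].
- by move=> r [G /Fe [_ H _]]; exact: H.
move=> s t st nGs nGt Gst; apply: contrapT => pst.
have e0 : 0 < d (p s) (p t) / 2.
  by rewrite divr_gt0 // lt_neqAle d_ge0 andbT eq_sym; apply/eqP => /d_eq0.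
have [d1 d10 H1] := cp s e0; have [d2 d20 H2] := cp t e0.
have [del [del0 dl1 dl2 dl3]] : exists del : R, [/\ 0 < del, del < d1, del < d2 & del * 2 < t - s].
  have m0 : 0 < Num.min (Num.min d1 d2) (t - s) by rewrite !lt_min d10 d20 subr_gt0.
  have m1 : Num.min (Num.min d1 d2) (t - s) <= d1 by rewrite !ge_min lexx.
  have m2 : Num.min (Num.min d1 d2) (t - s) <= d2 by rewrite !ge_min lexx orbT.
  have m3 : Num.min (Num.min d1 d2) (t - s) <= t - s by rewrite ge_min lexx orbT.
  by exists (Num.min (Num.min d1 d2) (t - s) / 3); split; lra.
have [G FG sub] : exists2 G, F G & forall r, s + del <= r <= t - del -> G r.
  pose V : set R := [set` `[s + del, t - del]].
  have V1 : V (s + del) by rewrite /V /= in_itv /= lexx /=; lra.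
  have V2 : V (t - del) by rewrite /V /= in_itv /= lexx andbT; lra.
  pose Q w := exists2 G, F G & forall r, s + del <= r <= w -> G r.
  have inF r : V r -> exists2 G, F G & G r.
    by rewrite /V /= in_itv /= => Vr; apply: Gst; lra.
  apply: (@connected_locally_constant _ V Q _ _ _ _ V1 V2); first exact: segment_connected.
    move=> v Vv; have [G FG Gv] := inF _ Vv; have [oG _ _] := Fe _ FG.
    have [e ee0 He] := open_ballP oG Gv.
    have ext v1 v2 : `|v1 - v| < e -> `|v2 - v| < e -> Q v1 -> Q v2.
      move=> v1e v2e [G' FG' HG'].
      have near r : ~ r <= v1 -> r <= v2 -> G r.
        move=> /negP; rewrite -ltNge => v1r rv2; apply: He; move: v1e v2e.
        by rewrite !ltr_norml; lra.
      have [GG'|G'G] := Ft _ _ FG FG'; [exists G'|exists G] => // r /andP [r1 r2];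
        have [rv1|nrv1] := pselect (r <= v1).
      + by apply: HG'; rewrite r1 rv1.
      + by apply: GG'; exact: near.
      + by apply: G'G; apply: HG'; rewrite r1 rv1.
      + exact: near.
    exists (ball v e); split; [exact: ball_open | exact: ballxx |].
    move=> w; rewrite -ball_normE /= distrC => vw _; split; apply: ext => //; by rewrite subrr normr0.
  by have [G FG Gv] := inF _ V1; exists G => // r r1; rewrite (_ : r = s + del) //; lra.
have [oG _ HG] := Fe _ FG.
have nG x : ~ (\bigcup_(G in F) G) x -> ~ G x by move=> nx Gx; apply: nx; exists G.
have [|l [l1 nGl Hl]] := last_outside oG _ (nG _ nGs) (m := s + del); first lra.
have [|l' [l'1 nGl' Hl']] := first_outside oG _ (nG _ nGt) (m := t - del); first lra.
have El : p l = p l'.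
  apply: HG => // [|r /andP [r1 r2]]; first lra.
  have [r3|r3] := lerP r (s + del); first exact: Hl.
  have [r4|r4] := lerP (t - del) r; first exact: Hl'.
  by apply: sub; lra.
have := H1 l; have := H2 l'; rewrite !ltr_norml => /(_ _) H3 /(_ _) H4.
have {}H3 : d (p t) (p l') < d (p s) (p t) / 2 by apply: H3; lra.
have {}H4 : d (p s) (p l) < d (p s) (p t) / 2 by apply: H4; lra.
have := dtri (p l) (p s) (p t); rewrite {2}El (dC (p l')); lra.
Qed.

(** Outside a maximal erasable set the path comes back to a point only across an
    interval of that set: otherwise the interval between the two times could be
    erased as well. *)
Lemma exists_maximal_erasable : exists2 G, erasable G &
  forall s t, 0 <= s -> s < t -> t <= 1 -> ~ G s -> ~ G t -> p s = p t ->
    forall r, s < r < t -> G r.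
Proof.
have [G [eG maxG]] := Zorn_bigcup erasable_chain.
exists G => // s t s0 st t1 nGs nGt pst r srt; apply: contrapT => nGr.
have [oG G01 HG] := eG.
apply: (maxG (G `|` `]s, t[)).
  split; first by move=> x Gx; left.
  by move=> /(_ r) H; apply: nGr; apply: H; right; rewrite /= in_itv.
split.
- by apply: openU => //; exact: interval_open.
- by move=> x [/G01 //|]; rewrite /= in_itv /= => H; lra.
move=> s1 t1' st1 /not_orP [nGs1 ns1] /not_orP [nGt1 nt1] Gst1.
have [[x [x1 nGx]]|nx] := pselect (exists x, s1 < x < t1' /\ ~ G x); last first.
  by apply: HG => // x xI; apply: contrapT => nGx; apply: nx; exists x.
rewrite /= in_itv /= in ns1; rewrite /= in_itv /= in nt1.
have xst : s < x < t by have [//|] := Gst1 _ x1; rewrite /= in_itv.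
have Es : s1 = s.
  apply/eqP; rewrite eq_le; apply/andP; split; rewrite leNgt; apply/negP => lt; first by apply: ns1; lra.
  by have [|//|] := Gst1 s; [lra | rewrite /= in_itv /=; lra].
have Et : t1' = t.
  apply/eqP; rewrite eq_le; apply/andP; split; rewrite leNgt; apply/negP => lt; last by apply: nt1; lra.
  by have [|//|] := Gst1 t; [lra | rewrite /= in_itv /=; lra].
by rewrite Es Et.
Qed.

(** Each time [t] is replaced by the last time [c t] before it that is not erased.
    This function jumps at the right end of an erased interval only, where the two
    values have the same image. *)
Lemma exists_monotone_path : exists q : R -> W, [/\ cpath q, q 0 = p 0, q 1 = p 1,
  forall t, 0 <= t <= 1 -> exists2 s, 0 <= s <= 1 & q t = p s &
  forall s t r, 0 <= s -> s <= r <= t -> t <= 1 -> q s = q t -> q r = q s].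
Proof.
have [G [oG G01 HG] maxG] := exists_maximal_erasable.
have nG r : r <= 0 \/ 1 <= r -> ~ G r by move=> H /G01; lra.
have /boolp.choice [c Hc] : forall t, exists l, [/\ l <= t, ~ G l & forall r, l < r -> r <= t -> G r].
  move=> t; have nGm : ~ G (Num.min t 0) by apply: nG; left; rewrite ge_min lexx orbT.
  have [|l [/andP [_ lt] nGl Hl]] := last_outside oG _ nGm (m := t); last by exists l.
  by rewrite ge_min lexx.
have c_le t : c t <= t by have [] := Hc t.
have nGc t : ~ G (c t) by have [] := Hc t.
have Hcr t r : c t < r -> r <= t -> G r by have [_ _] := Hc t; exact.
have c_uniq t x : x <= t -> ~ G x -> (forall r, x < r -> r <= t -> G r) -> c t = x.
  move=> xt nGx Hx; apply/eqP; rewrite eq_le; apply/andP; split; rewrite leNgt; apply/negP => lt.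
    by apply: (nGc t); exact: Hx.
  by apply: nGx; exact: Hcr lt xt.
have c_id t : ~ G t -> c t = t by move=> nGt; apply: c_uniq => // r tr /(lt_le_trans tr); rewrite ltxx.
have c_ge t x : x <= t -> ~ G x -> x <= c t.
  by move=> xt nGx; rewrite leNgt; apply/negP => lt; apply: nGx; exact: Hcr lt xt.
have c_mono s t : s <= t -> c s <= c t.
  by move=> st; apply: c_ge (nGc s); exact: le_trans (c_le s) st.
have c0 : c 0 = 0 by apply: c_id; apply: nG; left.
have c1 : c 1 = 1 by apply: c_id; apply: nG; right.
have c01 t : 0 <= t <= 1 -> 0 <= c t <= 1.
  by move=> /andP [t0 t1]; move: (c_mono _ _ t0) (c_mono _ _ t1); rewrite c0 c1; lra.
exists (p \o c); split; rewrite /= ?c0 ?c1 //.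
- move=> t e e0 /=; have [Gt|nGt] := pselect (G t).
    have [eta eta0 Heta] := open_ballP oG Gt.
    have ct : c t < t.
      by rewrite lt_neqAle c_le andbT; apply/eqP => E; apply: (nGc t); rewrite E.
    exists (Num.min eta (t - c t)); first by rewrite lt_min eta0 subr_gt0.
    move=> s; rewrite lt_min => /andP [s1 s2].
    suff -> : c s = c t by rewrite dxx.
    rewrite ltr_norml in s2; apply: c_uniq => // [|r r1 r2]; first lra.
    have [rt|tr] := lerP r t; first exact: Hcr r1 rt.
    by apply: Heta; move: s1; rewrite !ltr_norml; lra.
  have [del del0 Hdel] := cp t e0; rewrite (c_id t nGt).
  have right s : t <= s -> `|s - t| < del -> d (p t) (p (c s)) < e.
    move=> ts sd; apply: Hdel; have := c_ge _ _ ts nGt; have := c_le s; move: sd.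
    by rewrite !ltr_norml; lra.
  have [[r [r1 r2 nGr]]|nr] := pselect (exists r, [/\ t - del < r, r < t & ~ G r]).
    exists (t - r); first by rewrite subr_gt0.
    move=> s sd; have [ts|st] := lerP t s; first by apply: right => //; move: sd; rewrite !ltr_norml; lra.
    apply: Hdel; have rats : r <= s by move: sd; rewrite ltr_norml; lra.
    by have := c_ge _ _ rats nGr; have := c_le s; rewrite !ltr_norml; lra.
  exists del => // s sd; have [ts|st] := lerP t s; first exact: right.
  suff -> : p (c s) = p t by rewrite dxx.
  apply: HG => // [|x /andP [x1 x2]]; first exact: le_lt_trans (c_le s) st.
  have [xs|sx] := lerP x s; first exact: Hcr x1 xs.
  by apply: contrapT => nGx; apply: nr; exists x; split=> //; move: sd; rewrite ltr_norml; lra.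
- by move=> t /c01 ct; exists (c t).
- move=> s t r s0 /andP [sr rt] t1 pst.
  have csr := c_mono _ _ sr; have crt := c_mono _ _ rt.
  have [Est|nEst] := eqVneq (c s) (c t).
    by congr p; apply/eqP; rewrite eq_le csr Est crt.
  have cst : c s < c t by rewrite lt_neqAle nEst (le_trans csr crt).
  have cs0 : 0 <= c s by rewrite -c0; exact: c_mono.
  have ct1 : c t <= 1 by rewrite -c1; exact: c_mono.
  have mid := maxG _ _ cs0 cst ct1 (nGc s) (nGc t) pst.
  have [->//|n1] := eqVneq (c r) (c s); have [->//|n2] := eqVneq (c r) (c t).
  case: (nGc r); apply: mid; rewrite !lt_neqAle csr crt n2 eq_sym n1 //.
Qed.
End Erase.

Lemma cpath_dist_continuous (p : R -> W) y (A : set R) : cpath p ->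
  {within A, continuous (fun t => d (p t) y)}.
Proof.
move=> cp; apply: within_continuousP => t e _ e0; have [del del0 Hdel] := cp t e e0.
exists del => // s _ /Hdel ts; have := dtri (p s) (p t) y; have := dtri (p t) (p s) y.
by rewrite (dC (p s) (p t)) ltr_norml; lra.
Qed.

(** ** The reparametrization

    The function [m i t] is the distance from the i-th of countably many dense
    points of the path to the part covered up to time [t]. It decreases with [t],
    and whenever the path moves to a new point some [m i] decreases strictly. The
    weighted sum [g] of the functions [m i] is therefore a continuous monotone
    function with the same fibres as [q]. *)
Section Monotone.
Variable q : R -> W.
Hypotheses (cq : cpath q) (q_convex : forall s t r : R, 0 <= s -> s <= r <= t -> t <= 1 ->
  q s = q t -> q r = q s).

Let rats (i : nat) : R := if (unpickle i : option rat) is Some x then ratr x else 0.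

Let rats_dense t e : 0 < e -> exists i, `|rats i - t| < e.
Proof.
move=> e0; have [x] : exists x : rat, ratr x \in `]t, (t + e)[ by apply: rat_in_itvoo; lra.
rewrite in_itv /= => xI; exists (pickle x); rewrite /rats pickleK ltr_norml; lra.
Qed.

Let E i t := [set d (q s) (q (rats i)) | s in [set s | 0 <= s <= t]].
Let m i t := inf (E i t).

Let m_le i t s : 0 <= s <= t -> m i t <= d (q s) (q (rats i)).
Proof. by move=> st; apply: ge_inf; [exists 0 => _ [r _ <-] | exists s]. Qed.

Let m_ge i t x : 0 <= t -> (forall s, 0 <= s <= t -> x <= d (q s) (q (rats i))) -> x <= m i t.
Proof.
move=> t0 Hx; apply: lb_le_inf; last by move=> _ [r r0 <-]; exact: Hx.
by exists (d (q 0) (q (rats i))); exists 0 => //=; rewrite lexx.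
Qed.

Let m_anti i s t : 0 <= s -> s <= t -> m i t <= m i s.
Proof. by move=> s0 st; apply: m_ge => // r rats'; apply: m_le; lra. Qed.

Let m_osc i s t eta : 0 <= s -> s <= t -> 0 <= eta -> (forall r, s <= r <= t -> d (q s) (q r) <= eta) ->
  m i s <= m i t + eta.
Proof.
move=> s0 st eta0 H; rewrite -lerBlDr; apply: m_ge => [|r rt]; first lra.
have [rats'|sr] := lerP r s.
  have : m i s <= d (q r) (q (rats i)) by apply: m_le; lra.
  lra.
have : m i s <= d (q s) (q (rats i)) by apply: m_le; lra.
have : d (q s) (q r) <= eta by apply: H; lra.
by have := dtri (q r) (q s) (q (rats i)); lra.
Qed.

Let part n t := \sum_(i < n) rad i * m i t.
(* the sum of the series, as a supremum of partial sums with nonnegative terms *)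
Let g t := sup (range (part^~ t)).

Let sum_rad n : \sum_(i < n) rad i = 2 - 2 * rad n :> R.
Proof.
elim: n => [|n IH]; first by rewrite big_ord0 expr0; lra.
by rewrite big_ord_recr /= IH exprS; lra.
Qed.

Let rad_gt0 n : 0 < rad n :> R.
Proof. by rewrite exprn_gt0 // invr_gt0. Qed.

Let part_le n s t eta : 0 <= eta -> (forall i, m i s <= m i t + eta) -> part n s <= part n t + eta * 2.
Proof.
move=> eta0 H; have : part n s <= part n t + eta * \sum_(i < n) rad i.
  rewrite mulr_sumr -big_split /=; apply: ler_sum => i _.
  by rewrite [eta * _]mulrC -mulrDr ler_wpM2l // ltW.
by rewrite sum_rad; have := mulr_ge0 eta0 (ltW (rad_gt0 n)); lra.
Qed.

Let m_ge0 i t : 0 <= t -> 0 <= m i t.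
Proof. by move=> t0; apply: m_ge. Qed.

Let g_ub n t : 0 <= t -> part n t <= g t.
Proof.
move=> t0; apply: ub_le_sup; last by exists n.
exists 2 => _ [k _ <-]; have : \sum_(i < k) rad i * m i t <= \sum_(i < k) rad i.
  apply: ler_sum => i _; rewrite -[X in _ <= X]mulr1 ler_wpM2l ?(ltW (rad_gt0 i)) //.
  by apply: le_trans (d_le1 (q 0) (q (rats i))); apply: m_le; rewrite lexx.
by rewrite sum_rad /part; have := rad_gt0 k; lra.
Qed.

Let g_lub t x : (forall n, part n t <= x) -> g t <= x.
Proof. by move=> H; apply: ge_sup => [|_ [n _ <-] //]; exists (part 0%N t); exists 0%N. Qed.

Let g_osc s t eta : 0 <= s -> s <= t -> 0 <= eta ->
  (forall r, s <= r <= t -> d (q s) (q r) <= eta) -> g s <= g t + eta * 2.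
Proof.
move=> s0 st eta0 H; apply: g_lub => n.
have := part_le n eta0 (fun i => m_osc i s0 st eta0 H).
have : part n t <= g t by apply: g_ub; lra.
lra.
Qed.

Let part_mono n k t : 0 <= t -> (n <= k)%N -> part n t <= part k t.
Proof.
move=> t0 /subnK <-; elim: (k - n)%N => // j IH; apply: (le_trans IH).
by rewrite addSn {2}/part big_ord_recr /= lerDl mulr_ge0 ?m_ge0 // ltW.
Qed.

Let g_jump s t j : 0 <= s -> s <= t -> g t + rad j * (m j s - m j t) <= g s.
Proof.
move=> s0 st; rewrite -lerBrDr; apply: g_lub => n; rewrite lerBrDr.
have t0 : 0 <= t by lra.
apply: le_trans (g_ub (n + j.+1) s0).
apply: (@le_trans _ _ (part (n + j.+1) t + rad j * (m j s - m j t))).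
  by rewrite lerD2r part_mono // leq_addr.
have jn : (j < n + j.+1)%N by rewrite addnS ltnS leq_addl.
rewrite /part (bigD1 (Ordinal jn)) //= [X in _ <= X](bigD1 (Ordinal jn)) //=.
have : \sum_(i < n + j.+1 | i != Ordinal jn) rad i * m i t <=
       \sum_(i < n + j.+1 | i != Ordinal jn) rad i * m i s :> R.
  by apply: ler_sum => i _; rewrite ler_wpM2l ?(ltW (rad_gt0 i)) // m_anti.
by rewrite mulrBr; lra.
Qed.

Let g_anti s t : 0 <= s -> s <= t -> g t <= g s.
Proof.
move=> s0 st; apply: le_trans (g_jump 0 s0 st).
by rewrite lerDl mulr_ge0 ?subr_ge0 ?m_anti // ltW.
Qed.

(* The point [q t] is at a positive distance from the compact part of the path
   covered up to [s], and some [m j] with a nearby point detects it. *)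
Let g_strict s t : 0 <= s -> s <= t -> t <= 1 -> q s <> q t -> g t < g s.
Proof.
move=> s0 st t1 qst.
have [c cI Hc] := EVT_min s0 (cpath_dist_continuous (y := q t) (A := [set` `[0, s]]) cq).
rewrite in_itv /= in cI.
have delta0 : 0 < d (q c) (q t).
  rewrite lt_neqAle d_ge0 andbT eq_sym; apply/eqP => /d_eq0 qct; apply: qst.
  by rewrite -qct; apply: q_convex qct; lra.
have delta2 : 0 < d (q c) (q t) / 2 by lra.
have [eta eta0 Heta] := cq t delta2; have [j /Heta Hj] := rats_dense t eta0.
apply: lt_le_trans (g_jump j s0 st).
rewrite ltrDl mulr_gt0 // subr_gt0.
apply: (@lt_le_trans _ _ (d (q c) (q t) / 2)).
  by apply: le_lt_trans Hj; apply: m_le; lra.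
apply: m_ge => // r rI; have := Hc r; rewrite in_itv /= => /(_ rI).
by have := dtri (q (rats j)) (q r) (q t); rewrite (dC (q (rats j))); lra.
Qed.

Let g_eq s t : 0 <= s -> s <= t -> t <= 1 -> q s = q t -> g s = g t.
Proof.
move=> s0 st t1 qst; apply/eqP; rewrite eq_le (g_anti s0 st) andbT.
have := @g_osc s t 0 s0 st (lexx 0); rewrite mul0r addr0; apply=> r rI.
by rewrite (@q_convex s t r) // dxx.
Qed.

Let g_inj s t : 0 <= s <= 1 -> 0 <= t <= 1 -> (g s = g t <-> q s = q t).
Proof.
wlog st : s t / s <= t.
  move=> H sI tI; have [st|ts] := lerP s t; first exact: H.
  by split=> /esym/(H _ _ (ltW ts) tI sI)/esym.
move=> /andP [s0 s1] /andP [t0 t1]; split=> [gst|]; last exact: g_eq.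
by apply: contrapT => /(g_strict s0 st t1); rewrite gst ltxx.
Qed.

Let g_near t e : [set` `[0, 1]] t -> 0 < e -> exists2 del : R, 0 < del &
  forall s, [set` `[0, 1]] s -> `|s - t| < del -> `|g t - g s| < e.
Proof.
rewrite /= in_itv /= => tI e0.
have e4 : 0 < e / 5 by lra.
have [del del0 Hdel] := cq t e4; exists del => // s; rewrite /= in_itv /= => sI st.
have near r : `|r - t| <= `|s - t| -> d (q t) (q r) < e / 5.
  by move=> rt; apply: Hdel; exact: le_lt_trans rt st.
have near2 a b : `|a - t| <= `|s - t| -> `|b - t| <= `|s - t| -> d (q a) (q b) <= e / 5 * 2.
  by move=> /near Ha /near Hb; have := dtri (q t) (q a) (q b); rewrite (dC (q a) (q t)); lra.
have e40 : 0 <= e / 5 * 2 by lra.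
have tt : `|t - t| <= `|s - t| by rewrite subrr normr0.
have [ts|/ltW s_t] := lerP t s.
  have := @g_osc t s (e / 5 * 2); have := @g_anti t s.
  move=> /(_ _ ts) H1 /(_ _ ts e40) H2.
  have {}H1 : g s <= g t by apply: H1; lra.
  have {}H2 : g t <= g s + e / 5 * 2 * 2.
    apply: H2 => [|r rI]; first lra.
    by apply: near2 => //; rewrite !ger0_norm; lra.
  by rewrite ger0_norm; lra.
have := @g_osc s t (e / 5 * 2); have := @g_anti s t.
move=> /(_ _ s_t) H1 /(_ _ s_t e40) H2.
have {}H1 : g t <= g s by apply: H1; lra.
have {}H2 : g s <= g t + e / 5 * 2 * 2.
  apply: H2 => [|r rI]; first lra.
  by apply: near2 => //; rewrite !ler0_norm; lra.
by rewrite ler0_norm; lra.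
Qed.

Let g_continuous : {within `[0, 1], continuous g}.
Proof. exact: within_continuousP g_near. Qed.

Let g_dist_continuous x : {within `[0, 1], continuous (fun t => `|g t - x|)}.
Proof.
apply: within_continuousP => t e tI e0; have [del del0 Hdel] := g_near tI e0.
exists del => // s sI /(Hdel _ sI); apply: le_lt_trans.
by apply: le_trans (ler_dist_dist _ _) _; rewrite opprB addrA subrK.
Qed.

Lemma within_continuous_toW (f : R -> W) (A : set R) :
  (forall t e, A t -> 0 < e -> exists2 del : R, 0 < del &
     forall s, A s -> `|s - t| < del -> d (f t) (f s) < e) ->
  {within A, continuous f}.
Proof.
move=> H; apply/subspace_continuousP => t At B /d_nbhs [e e0 HB].
have [del del0 Hdel] := H t e At e0; apply/nbhs_ballP; exists del => // s.
by rewrite -ball_normE /= distrC => ts As; apply: HB; exact: Hdel.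
Qed.

Lemma within_continuous_fromW (f : W -> R) (A : set W) :
  (forall y e, A y -> 0 < e -> exists2 del : R, 0 < del &
     forall z, A z -> d y z < del -> `|f y - f z| < e) ->
  {within A, continuous f}.
Proof.
move=> H; apply/subspace_continuousP => y Ay; apply/cvgrPdist_lt => e e0.
have [del del0 Hdel] := H y e Ay e0; apply/d_nbhs; exists del => // z yz Az.
exact: Hdel.
Qed.

(** Both [q] and [g] identify the same times, so that they induce inverse bijections
    between the image of the path and an interval; both bijections are continuous
    by [unit_interval_modulus]. *)
Lemma monotone_path_arc : q 0 <> q 1 ->
  arc_joining R (q 0) (q 1) [set q t | t in [set t | 0 <= t <= 1]].
Proof.
move=> q01; have g01 : g 1 < g 0 by apply: g_strict => //; exact: ler01.
pose D := g 0 - g 1; have D0 : 0 < D by rewrite subr_gt0.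
have /boolp.choice [tau Htau] : forall v, exists t, 0 <= v <= 1 -> 0 <= t <= 1 /\ g t = g 0 - v * D.
  move=> v; have [vI|nv] := pselect (0 <= v <= 1); last by exists 0.
  have v1 : v * D <= D by rewrite -[X in _ <= X]mul1r ler_pM2r //; lra.
  have v2 : 0 <= v * D by apply: mulr_ge0; [lra | exact: ltW].
  have gD : g 1 = g 0 - D by rewrite /D; lra.
  have [|t tI gt] := @IVT R g 0 1 (g 0 - v * D) ler01 g_continuous; last by exists t; rewrite in_itv /= in tI.
  rewrite (min_r (ltW g01)) (max_l (ltW g01)) gD; apply/andP; split; lra.
have /boolp.choice [sig Hsig] : forall y, exists t,
    [set q t | t in [set t | 0 <= t <= 1]] y -> 0 <= t <= 1 /\ q t = y.
  move=> y; have [[t tI <-]|ny] := pselect ([set q t | t in [set t | 0 <= t <= 1]] y).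
    by exists t.
  by exists 0.
have I0 : 0 <= (0 : R) <= 1 by apply/andP; split; lra.
have I1 : 0 <= (1 : R) <= 1 by apply/andP; split; lra.
have gI t : 0 <= t <= 1 -> 0 <= (g 0 - g t) / D <= 1.
  move=> /andP [t0 t1]; have := g_anti (lexx 0) t0; have := g_anti t0 t1 => H1 H2.
  apply/andP; split; first by apply: divr_ge0; [lra | exact: ltW].
  by rewrite ler_pdivrMr // mul1r lerD2l lerN2.
exists (q \o tau), (fun y => (g 0 - g (sig y)) / D); split; last first.
- have [tI gt] := Htau _ I1; apply/(g_inj tI I1); rewrite gt /D; lra.
- have [tI gt] := Htau _ I0; apply/(g_inj tI I0); rewrite gt; lra.
split.
- apply: within_continuous_toW => v e; rewrite /= in_itv /= => vI e0.
  have [tI gt] := Htau _ vI.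
  have zero t : 0 <= t <= 1 -> `|g t - g (tau v)| = 0 -> d (q t) (q (tau v)) = 0.
    by move=> tI' /eqP; rewrite normr_eq0 subr_eq0 => /eqP /(g_inj tI' tI) ->; rewrite dxx.
  have [del del0 Hdel] := unit_interval_modulus
    (cpath_dist_continuous (y := q (tau v)) (A := [set` `[0, 1]]) cq)
    (@g_dist_continuous (g (tau v))) (fun t _ => normr_ge0 _) zero e0.
  exists (del / D); first by rewrite divr_gt0.
  move=> s; rewrite /= in_itv /= => sI sv; have [t'I gt'] := Htau _ sI.
  rewrite dC; apply: Hdel => //; rewrite gt gt'.
  have -> : g 0 - s * D - (g 0 - v * D) = - ((s - v) * D) by lra.
  by rewrite normrN normrM (gtr0_norm D0) -ltr_pdivlMr.
- apply: within_continuous_fromW => y e Ay e0; have [tI qt] := Hsig _ Ay.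
  have eD : 0 < e * D by rewrite mulr_gt0.
  have zero t : 0 <= t <= 1 -> d (q t) (q (sig y)) = 0 -> `|g t - g (sig y)| = 0.
    by move=> tI' /d_eq0 /(g_inj tI' tI) ->; rewrite subrr normr0.
  have [del del0 Hdel] := unit_interval_modulus (@g_dist_continuous (g (sig y)))
    (cpath_dist_continuous (y := q (sig y)) (A := [set` `[0, 1]]) cq) (fun t _ => d_ge0 _ _) zero eD.
  exists del => // z Az yz; have [t'I qt'] := Hsig _ Az.
  have -> : (g 0 - g (sig y)) / D - (g 0 - g (sig z)) / D = (g (sig z) - g (sig y)) / D.
    by rewrite -mulrBl; congr (_ / _); lra.
  rewrite normrM normfV (gtr0_norm D0) ltr_pdivrMr //; apply: Hdel => //.
  by rewrite qt qt' dC.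
- move=> v; rewrite /= in_itv /= => vI; have [tI _] := Htau _ vI; by exists (tau v).
- by move=> y Ay; have [tI _] := Hsig _ Ay; rewrite /= in_itv /=; exact: gI.
- split=> [v|y]; rewrite inE.
  + rewrite /= in_itv /= => vI; have [tI gt] := Htau _ vI.
    have Ay : [set q t | t in [set t | 0 <= t <= 1]] (q (tau v)) by exists (tau v).
    have [t'I qt'] := Hsig _ Ay; rewrite (g_inj t'I tI).2 // gt.
    by rewrite opprB addrC subrK mulfK // gt_eqF.
  + move=> Ay /=; have [tI qt] := Hsig _ Ay; have [t'I gt'] := Htau _ (gI _ tI).
    rewrite -[RHS]qt; apply/(g_inj t'I tI); rewrite gt' divfK ?gt_eqF //; lra.
Qed.
End Monotone.

Theorem path_arc (p : R -> W) : cpath p -> p 0 <> p 1 ->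
  exists2 A, arc_joining R (p 0) (p 1) A & forall y, A y -> exists2 t, 0 <= t <= 1 & y = p t.
Proof.
move=> cp p01; have [q [cq q0 q1 qp qc]] := exists_monotone_path cp.
exists [set q t | t in [set t | 0 <= t <= 1]].
  by rewrite -q0 -q1; apply: monotone_path_arc => //; rewrite q0 q1.
by move=> _ [t tI <-]; exact: qp.
Qed.

(** * Arcs and components in a dendrite *)
Notation arc := (@Defs.arc R W).

Lemma metrizes_hausdorff : hausdorff_space W.
Proof.
move=> x y xy; apply: d_eq0; apply/eqP; rewrite eq_le d_ge0 andbT.
apply/ler_addgt0Pr => e e0.
have [z [/= xz yz]] : [set z | d x z < e / 2] `&` [set z | d y z < e / 2] !=set0.
  by apply: xy; apply/d_nbhs; exists (e / 2) => //; lra.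
by have := dtri z x y; rewrite (dC z y); lra.
Qed.

Lemma cpath_continuous (p : R -> W) : cpath p -> continuous p.
Proof.
move=> cp t B /d_nbhs [e e0 HB]; have [del del0 Hdel] := cp t e e0.
apply/nbhs_ballP; exists del => // s; rewrite -ball_normE /= distrC => ts.
by apply: HB; exact: Hdel.
Qed.

Lemma cpath_affine (p : R -> W) a b : cpath p -> cpath (fun t => p (a + b * t)).
Proof.
move=> cp t e e0; have [del del0 Hdel] := cp (a + b * t) e e0.
have b0 : 0 < `|b| + 1 by have := normr_ge0 b; lra.
exists (del / (`|b| + 1)); first by rewrite divr_gt0.
move=> s; rewrite ltr_pdivlMr // => sd; apply: Hdel; apply: le_lt_trans sd.
have -> : a + b * s - (a + b * t) = (s - t) * b by lra.
by rewrite normrM ler_wpM2l //; lra.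
Qed.

Lemma cpath_glue (p q : R -> W) c : cpath p -> cpath q -> p c = q c ->
  cpath (fun t => if t <= c then p t else q t).
Proof.
move=> cp cq E t e e0; have [d1 d10 H1] := cp t e e0; have [d2 d20 H2] := cq t e e0.
case: (ltrgtP t c) => tc.
- exists (Num.min d1 (c - t)); first by rewrite lt_min d10 subr_gt0.
  move=> s; rewrite lt_min => /andP [sd1 sc]; rewrite ifT; first exact: H1.
  by move: sc; rewrite ltr_norml; lra.
- exists (Num.min d2 (t - c)); first by rewrite lt_min d20 subr_gt0.
  move=> s; rewrite lt_min => /andP [sd1 sc]; rewrite ifF; first exact: H2.
  by apply/negP; move: sc; rewrite ltr_norml; lra.
- exists (Num.min d1 d2); first by rewrite lt_min d10.
  move=> s; rewrite lt_min => /andP [sd1 sd2]; case: ifP => _; first exact: H1.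
  by rewrite tc E -tc; exact: H2.
Qed.

Definition parametrizes (p : R -> W) x y := [/\ cpath p, p 0 = x, p 1 = y,
  forall s t, 0 <= s <= 1 -> 0 <= t <= 1 -> p s = p t -> s = t &
  arc x y = [set p t | t in [set t | 0 <= t <= 1]]].

Lemma arc_param x y : x <> y -> exists p, parametrizes p x y.
Proof.
move=> xy; have [A [[f [g [[cf cg ff gf [fK gK]] f0 f1]]] Auniq]] := W_uac xy.
pose cl (t : R) := Num.max 0 (Num.min 1 t).
have clI t : 0 <= cl t <= 1 by rewrite /cl le_max lexx /= ge_max ler01 ge_min lexx.
have clE t : 0 <= t <= 1 -> cl t = t.
  by move=> /andP [t0 t1]; rewrite /cl (min_r t1) (max_r t0).
have clL s t : `|cl s - cl t| <= `|s - t|.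
  have h1 : s - t <= `|s - t| by exact: ler_norm.
  have h2 : - (s - t) <= `|s - t| by rewrite -normrN; exact: ler_norm.
  rewrite /cl ler_norml; have [?|?] := lerP 1 s; have [?|?] := lerP 1 t;
    rewrite ?(max_r ler01); have [?|?] := lerP 0 s; have [?|?] := lerP 0 t; lra.
have inI t : 0 <= t <= 1 -> t \in [set` `[0, 1]] by move=> tI; rewrite inE /= in_itv.
exists (f \o cl); split.
- move=> t e e0.
  have tI : [set` `[(0:R), 1]] (cl t) by rewrite /= in_itv /=; exact: clI.
  move/subspace_continuousP: cf => /(_ _ tI) cf.
  have /cf /nbhs_ballP [del del0 Hdel] : nbhs (f (cl t)) [set z | d (f (cl t)) z < e].
    by apply/d_nbhs; exists e.
  exists del => // s st; apply: Hdel; last by rewrite /= in_itv /=; exact: clI.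
  rewrite -ball_normE /= distrC; exact: le_lt_trans (clL s t) st.
- by rewrite /= clE // lexx ler01.
- by rewrite /= clE // lexx ler01.
- move=> s t sI tI /=; rewrite !clE // => /(congr1 g); rewrite !fK //; exact: inI.
apply/seteqP; split=> z.
  case=> [->|[B jB Bz]].
    by exists 0; rewrite /= ?clE ?lexx ?ler01.
  rewrite -(Auniq _ jB) in Bz.
  have gI := gf _ Bz; rewrite /= in_itv /= in gI.
  by exists (g z) => //=; rewrite clE // gK // inE.
case=> t tI <-; right; exists A; first by exists f, g.
by apply: ff; rewrite /= in_itv /=; exact: clI.
Qed.

Lemma arcxx x : arc x x = [set x].
Proof.
apply/seteqP; split=> [z [//|[A [f [g [[_ _ _ _ [fK _]] f0 f1]]]]]|z ->]; last by left.
have I0 : (0 : R) \in [set` `[0, 1]] by rewrite inE /= in_itv /= lexx ler01.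
have I1 : (1 : R) \in [set` `[0, 1]] by rewrite inE /= in_itv /= lexx ler01.
have := fK _ I0; rewrite f0 -f1 fK // => /eqP; by rewrite oner_eq0.
Qed.

(** The path contains an arc with the same ends, and arcs are unique. All the
    properties of arcs below follow from this one, by gluing paths or by
    restricting them. *)
Lemma arc_sub_path (p : R -> W) s t z : cpath p -> s <= t -> arc (p s) (p t) z ->
  exists2 r, s <= r <= t & z = p r.
Proof.
move=> cp st; have [<-|ne] := pselect (p s = p t).
  by rewrite arcxx => ->; exists s; rewrite // lexx st.
have cp' := @cpath_affine p s (t - s) cp.
have E0 : s + (t - s) * 0 = s by lra.
have E1 : s + (t - s) * 1 = t by lra.
have ne' : p (s + (t - s) * 0) <> p (s + (t - s) * 1) by rewrite E0 E1.
have [A jA HA] := path_arc cp' ne'.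
rewrite E0 E1 in jA; have [A' [_ A'uniq]] := W_uac ne.
case=> [->|[B jB Bz]]; first by exists s; rewrite // lexx st.
have {}Bz : A z by rewrite -(A'uniq _ jA) (A'uniq _ jB).
have [r /andP [r0 r1] ->] := HA _ Bz; exists (s + (t - s) * r) => //.
have H1 : 0 <= (t - s) * r by apply: mulr_ge0; lra.
have H2 : (t - s) * r <= (t - s) * 1 by apply: ler_wpM2l; lra.
by apply/andP; split; lra.
Qed.

Lemma arc_l x y : arc x y x. Proof. by left. Qed.

Lemma arc_r x y : arc x y y.
Proof.
have [->|xy] := pselect (x = y); first exact: arc_l.
have [p [_ _ p1 _ ->]] := arc_param xy; exists 1 => //=; by rewrite lexx ler01.
Qed.

Lemma arc_sub_sym x y : arc y x `<=` arc x y.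
Proof.
have [->//|xy] := pselect (x = y) => z.
have [p [cp p0 p1 _ ->]] := arc_param xy.
have := @arc_sub_path (fun t => p (1 + (- 1) * t)) 0 1 z (cpath_affine 1 (- 1) cp) ler01.
have -> : 1 + -1 * 0 = 1 :> R by lra.
have -> : 1 + -1 * 1 = 0 :> R by lra.
rewrite p0 p1 => H /H [r rI ->]; exists (1 + -1 * r) => //=; lra.
Qed.

Lemma arcC x y : arc x y = arc y x.
Proof. by apply/seteqP; split; exact: arc_sub_sym. Qed.

Lemma arc_path x y : exists p, [/\ cpath p, p 0 = x, p 1 = y &
  forall t, 0 <= t <= 1 -> arc x y (p t)].
Proof.
have [->|xy] := pselect (x = y).
  exists (fun=> y); split=> // [t e e0|t _]; last exact: arc_r.
  by exists 1 => // s _; rewrite dxx.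
by have [p [cp p0 p1 _ ->]] := arc_param xy; exists p; split=> // t tI; exists t.
Qed.

Lemma arc_triangle z x y : arc x y `<=` arc x z `|` arc z y.
Proof.
have [p [cp p0 p1 Hp]] := arc_path x z; have [q [cq q0 q1 Hq]] := arc_path z y.
move=> w; have := @cpath_glue p (fun t => q (- 1 + 1 * t)) 1 cp (cpath_affine (-1) 1 cq).
have -> : -1 + 1 * 1 = 0 :> R by lra.
rewrite p1 q0 => /(_ erefl) cr; have l02 : (0 : R) <= 2 by lra.
have := arc_sub_path (z := w) cr l02; rewrite ler01 /= p0.
have -> : (2 <= 1 :> R) = false by apply/negP; lra.
have -> : -1 + 1 * 2 = 1 :> R by lra.
rewrite q1 => H /H [r rI ->]; case: ifP => r1; [left; apply: Hp; lra | right; apply: Hq].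
by move/negbT: r1; rewrite -ltNge; lra.
Qed.

(** In an injective parametrization of the arc, the part before [z] and the part
    after [z] have only [z] in common. *)
Lemma arc_between x y z : arc x y z ->
  arc x z `<=` arc x y /\ forall w, arc x z w -> arc z y w -> w = z.
Proof.
have [->|xy] := pselect (x = y); first by rewrite arcxx => ->; rewrite arcxx; split.
have [p [cp p0 p1 pinj ->]] := arc_param xy => -[t /andP [t0 t1] <-].
have H1 w : arc x (p t) w -> exists2 r, 0 <= r <= t & w = p r.
  by rewrite -p0; exact: arc_sub_path.
have H2 w : arc (p t) y w -> exists2 r, t <= r <= 1 & w = p r.
  by rewrite -p1; exact: arc_sub_path.
split; first by move=> w /H1 [r rI ->]; exists r => //=; lra.
move=> w /H1 [r rI ->] /H2 [r' r'I] /pinj E; congr p.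
have : r = r' by apply: E; lra.
by move=> ?; apply/eqP; rewrite eq_le; apply/andP; split; lra.
Qed.

Lemma arc_compact x y : compact (arc x y).
Proof.
have [->|xy] := pselect (x = y); first by rewrite arcxx; exact: compact_set1.
have [p [cp _ _ _ ->]] := arc_param xy.
rewrite (_ : [set t | _] = [set` `[0, 1]]); last by apply/seteqP; split=> t /=; rewrite in_itv.
apply: continuous_compact; last exact: segment_compact.
exact/continuous_subspaceT/cpath_continuous.
Qed.

Lemma arc_closed x y : closed (arc x y).
Proof. exact: compact_closed metrizes_hausdorff (@arc_compact x y). Qed.

Lemma arc_connected x y : connected (arc x y).
Proof.
have [->|xy] := pselect (x = y); first by rewrite arcxx; exact: connected1.
have [p [cp _ _ _ ->]] := arc_param xy.
rewrite (_ : [set t | _] = [set` `[0, 1]]); last by apply/seteqP; split=> t /=; rewrite in_itv.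
apply: connected_continuous_connected; first exact: segment_connected.
exact/continuous_subspaceT/cpath_continuous.
Qed.

(** By [arc_triangle] the arc from [w] to [y] lies in the arc from [y] to [z], except
    perhaps for the point [w]; it remains to take the closure. *)
Lemma arc_join y w z : (forall v, arc y w v -> arc w z v -> v = w) -> arc y z w.
Proof.
move=> H; have [->|wy] := pselect (w = y); first exact: arc_l.
have [p [cp p0 p1 pinj Ep]] := arc_param wy.
apply: contrapT => nw.
have /d_nbhs [e e0 He] : nbhs w (~` arc y z).
  by apply: open_nbhs_nbhs; split=> //; apply: closed_openC; exact: arc_closed.
rewrite -p0 in He; have [del del0 Hdel] := cp 0 e e0.
pose t := Num.min 1 (del / 2).
have t0 : 0 < t by rewrite lt_min ltr01 /=; lra.
have t1 : t <= 1 by rewrite ge_min lexx.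
have td : t <= del / 2 by rewrite ge_min lexx orbT.
have wt : arc w y (p t) by rewrite Ep; exists t => //=; lra.
have /He : d (p 0) (p t) < e by apply: Hdel; rewrite subr0 ger0_norm; lra.
apply; rewrite arcC in wt; have [//|] := arc_triangle z wt.
rewrite arcC => zt; have E := H _ wt zt; rewrite -p0 in E.
have : t = 0 by apply: pinj => //; apply/andP; split; lra.
by move=> t00; rewrite t00 ltxx in t0.
Qed.

(** The median is the last point of the arc from [x] to [y] that belongs to the arc
    from [x] to [z]. *)
Lemma median_exists x y z : exists w, [/\ arc x y w, arc y z w & arc x z w].
Proof.
have [->|xy] := pselect (x = y).
  by exists y; split; [exact: arc_l | exact: arc_l | exact: arc_l].
have [p [cp p0 p1 pinj Ep]] := arc_param xy.
pose G : set R := p @^-1` (~` arc x z).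
have oG : open G.
  apply: open_comp => [t _|]; first exact: cpath_continuous.
  by apply: closed_openC; exact: arc_closed.
have nG0 : ~ G 0 by rewrite /G /= p0 => H; apply: H; exact: arc_l.
have [l [/andP [l0 l1] nGl Hl]] := last_outside oG ler01 nG0.
have xyl : arc x y (p l) by rewrite Ep; exists l => //=; rewrite l0.
have xzl : arc x z (p l) by apply: contrapT.
exists (p l); split=> //; apply: arc_join => v yv zv.
have [r /andP [r0 r1] Er] : exists2 r, l <= r <= 1 & v = p r.
  by apply: arc_sub_path => //; rewrite p1 arcC.
have [lr|] := ltrP l r; last by move=> rl; rewrite Er; congr p; apply/eqP; rewrite eq_le rl.
case: (Hl r lr r1); rewrite -Er.
rewrite arcC in xzl; have [sub _] := arc_between xzl.
by rewrite arcC; apply: sub; rewrite arcC.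
Qed.

(** By [arc_triangle] another such point lies in two of the three arcs that join [w]
    to [x], [y] and [z], and these arcs meet only at [w]. *)
Lemma median_unique x y z w w' : arc x y w -> arc y z w -> arc x z w ->
  arc x y w' -> arc y z w' -> arc x z w' -> w' = w.
Proof.
move=> H1 H2 H3 K1 K2 K3.
have [_ XY] := arc_between H1; have [_ YZ] := arc_between H2; have [_ XZ] := arc_between H3.
have [X|Y] := arc_triangle w K1.
  by have [Y|Z] := arc_triangle w K2; [apply: XY => //; rewrite arcC | exact: XZ].
by have [X|Z] := arc_triangle w K3; [exact: XY | apply: YZ => //; rewrite arcC].
Qed.

Lemma component_open (x y : W) : open (component_at x y).
Proof.
rewrite openE => z Cz; have xz : z <> x by have := connected_component_sub Cz.
have d0 : 0 < d z x by rewrite lt_neqAle d_ge0 andbT eq_sym; apply/eqP => /d_eq0.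
have /W_lc [V [oV Vz cV VB]] : nbhs z [set w | d z w < d z x] by apply/d_nbhs; exists (d z x).
apply: filterS (open_nbhs_nbhs (conj oV Vz)) => w Vw.
apply: connected_component_trans Cz _.
by exists V => //; split=> // v /VB /= zv vx; move: zv; rewrite vx ltxx.
Qed.

Lemma component_at_id (x y : W) : y <> x -> component_at x y y.
Proof. by move=> yx; exact: connected_component_refl. Qed.

Lemma component_at_eq (x y z : W) : component_at x y z -> component_at x y = component_at x z.
Proof.
move=> Cz; apply/seteqP; split=> w Cw.
  by apply: connected_component_trans Cw; exact: connected_component_sym.
exact: connected_component_trans Cz Cw.
Qed.

Lemma avoiding_arc_component x y z : y <> x -> z <> x -> ~ arc y z x ->
  component_at x y = component_at x z.
Proof.
move=> yx zx nx; apply: component_at_eq; exists (arc y z); last exact: arc_r.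
by split; [exact: arc_l | move=> v yzv vx; apply: nx; rewrite -vx | exact: arc_connected].
Qed.

(** It suffices that near each point [v] of the component no arc from [v] passes
    through [x]. Near [v] there is a small connected open set whose closure avoids
    [x], and it contains paths by [exists_path]. *)
Lemma component_avoiding_arc x y z : z <> x -> component_at x y z -> ~ arc y z x.
Proof.
move=> zx Cz; have yx : y <> x.
  move=> yx; move: Cz; rewrite yx => -[B [Bx BX _] _]; exact: (BX _ Bx).
pose Q v := ~ arc y v x.
apply: (@connected_locally_constant W (component_at x y) Q _ _ y z) => //.
- exact: component_connected.
- move=> v Cv; have vx : v <> x by have := connected_component_sub Cv.
  have d0 : 0 < d v x / 2.
    by rewrite divr_gt0 // lt_neqAle d_ge0 andbT eq_sym; apply/eqP => /d_eq0.
  have /W_lc [U [oU Uv cU UB]] : nbhs v [set w | d v w < d v x / 2].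
    by apply/d_nbhs; exists (d v x / 2).
  have near w : U w -> ~ arc v w x.
    move=> Uw; have [p [cp p0 p1 pU]] := exists_path oU cU Uv Uw.
    have := @arc_sub_path p 0 1 x cp ler01; rewrite p0 // p1 // => H /H [r rI xr].
    have /pU : nbhs (p r) [set w | d x w < d v x / 2] by apply/d_nbhs; exists (d v x / 2); rewrite -?xr.
    by case=> u [/UB /= vu /= xu]; have := dtri u v x; rewrite (dC u x); lra.
  exists U; split=> // w Uw _; split=> nQ yx'.
    have [yvx|] := arc_triangle v yx'; first exact: nQ.
    exact: near.
  have [ywx|] := arc_triangle w yx'; first exact: nQ.
  by rewrite arcC; exact: near.
- exact: component_at_id.
- by rewrite /Q arcxx => xy; apply: yx.
Qed.

(** * The kaleidoscopic structure *)
Section Kaleidoscope.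
Variables (L0 : rel_signature) (N : structure (add_constant L0)) (xi : W)
  (kappa : W -> set W -> N).
Notation c := (the_constant N).
Notation branch := (branch_points W).
Hypotheses (xi_endpoint : endpoint xi) (branch_dense : dense branch)
  (kappa_bij : forall x, branch x -> set_bij (components x) [set: N] (kappa x))
  (kappa_root : forall x, branch x -> kappa x (component_at x xi) = c).
Notation P := (points xi).
Notation root := (root_point xi).
Notation K := (kaleidoscope R xi kappa).

Lemma xi_not_branch : ~ branch xi.
Proof.
move=> bxi; have [le1 _] := (card_eqPle _ _).1 xi_endpoint.
by have := card_le_trans bxi le1; rewrite card_le_II.
Qed.

Lemma components_at (x y : W) : y <> x -> components x (component_at x y).
Proof. by move=> yx; exists y. Qed.

(** An arc passing through the endpoint would meet two components of its
    complement. *)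
Lemma endpoint_arc v v' : arc v v' xi -> v = xi \/ v' = xi.
Proof.
move=> vv'; have [->|nv] := pselect (v = xi); first by left.
have [->|nv'] := pselect (v' = xi); first by right.
case: (@component_avoiding_arc xi v v' nv') => //.
suff -> : component_at xi v = component_at xi v' by exact: component_at_id.
apply: contrapT => ne.
have : `I_2 #<= components xi.
  apply: (@card_ge_inj _ _ _ (fun i => if i is 0%N then component_at xi v else component_at xi v')).
    by case=> [|i] _; exact: components_at.
  by case=> [|[|i]] [|[|j]] //= _ _ E; case: ne.
have [le1 _] := (card_eqPle _ _).1 xi_endpoint.
by move=> /card_le_trans /(_ le1); rewrite card_le_II.
Qed.

Definition color_at (u v : W) : N := kappa u (component_at u v).

(** Equality of colours is thus expressed by arcs, and so by [center]; this is why
    embeddings act on colours. *)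
Lemma color_eq u v v' : branch u -> v <> u -> v' <> u -> (color_at u v = color_at u v' <-> ~ arc v v' u).
Proof.
move=> bu vu v'u; split=> [E|nu]; last by rewrite /color_at (avoiding_arc_component vu v'u nu).
apply: component_avoiding_arc => //.
have [_ inj _] := kappa_bij bu.
have -> : component_at u v = component_at u v'.
  by apply: inj => //; rewrite inE; exact: components_at.
exact: component_at_id.
Qed.

Lemma color_neq u v v' : branch u -> v <> u -> v' <> u -> arc v v' u -> color_at u v <> color_at u v'.
Proof. by move=> bu vu v'u uI /(color_eq bu vu v'u). Qed.

Lemma branch_neq_xi u : branch u -> xi <> u.
Proof. by move=> bu E; apply: xi_not_branch; rewrite E. Qed.

Lemma color_root u : branch u -> color_at u xi = c.
Proof. exact: kappa_root. Qed.

Lemma branch_in_open (G : set W) : open G -> G !=set0 -> exists2 v, branch v & G v.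
Proof.
by move=> oG G0; have [v [Gv bv]] := branch_dense G0 oG; exists v.
Qed.

Lemma color_surj u a : branch u -> exists v, [/\ branch v, v <> u & color_at u v = a].
Proof.
move=> bu; have [_ _ surj] := kappa_bij bu.
have [C [y yu <-] Ea] := surj a I.
have [v bv Cv] := @branch_in_open (component_at u y) (@component_open u y)
  (ex_intro _ y (component_at_id yu)).
exists v; split=> //; first by have := connected_component_sub Cv.
by rewrite /color_at -(component_at_eq Cv).
Qed.

(** The order of the tree rooted at [xi]. *)
Definition below (u v : W) := arc xi v u.

Lemma below_trans u v w : below u v -> below v w -> below u w.
Proof. by move=> uv /arc_between [H _]; exact: H. Qed.

Lemma below_stop u v w : below u v -> arc v w u -> below v w -> u = v.
Proof. by move=> uv uvw /arc_between [_ H]; exact: H. Qed.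

Lemma below_anti u v : below u v -> below v u -> u = v.
Proof. by move=> uv vu; apply: below_stop uv _ vu; exact: arc_r. Qed.

Lemma below_color u v : branch u -> v <> u -> (below u v <-> color_at u v <> c).
Proof.
move=> bu vu; have xu := branch_neq_xi bu; rewrite -(color_root bu); split.
  by move=> uv /esym; exact: color_neq.
by move=> ne; apply: contrapT => nuv; apply/ne/esym/(color_eq bu xu vu).
Qed.

(** The points [x], [y] and [z] lie in three different components of the complement
    of [w]. *)
Lemma median_point x y z w : arc x y w -> arc y z w -> arc x z w ->
  w <> x -> w <> y -> w <> z -> branch w.
Proof.
move=> xyw yzw xzw wx wy wz.
have ne a b : arc a b w -> b <> w -> component_at w a <> component_at w b.
  move=> abw bw E; apply: (@component_avoiding_arc w a b bw) => //.
  by rewrite E; exact: component_at_id.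
have [nxy nyz nxz] : [/\ component_at w x <> component_at w y,
    component_at w y <> component_at w z & component_at w x <> component_at w z].
  by split; apply: ne => // /esym.
apply: (@card_ge_inj _ _ _ (fun i => component_at w (if i is 0%N then x else if i is 1%N then y else z))).
  by case=> [|[|i]] _; apply: components_at => /esym.
by case=> [|[|[|i]]] [|[|[|j]]] //= _ _ E;
  solve [by case: nxy | by case: nyz | by case: nxz
        | by case: nxy; exact: esym E | by case: nyz; exact: esym E | by case: nxz; exact: esym E].
Qed.

Lemma point_cases (x : P) : x = root \/ branch (val x).
Proof. by have /set_mem [bx|E] := valP x; [right | left; exact: val_inj]. Qed.

Lemma point_of (w : W) : branch w \/ w = xi -> exists p : P, val p = w.
Proof. by move=> bw; exists (exist _ w (mem_set bw)). Qed.

Lemma center_spec (x y z : P) : let w := val (Defs.center (M := K) x y z) in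
  [/\ arc (val x) (val y) w, arc (val y) (val z) w & arc (val x) (val z) w].
Proof.
rewrite /= /Defs.center /= !(tnth_nth x) /= /points_center; set Q := (X in xget x X).
suff : Q (xget x Q) by case=> -[].
apply: xgetPex; have [w [H1 H2 H3]] := median_exists (val x) (val y) (val z).
have [|p Ep] := @point_of w; last by exists p; rewrite /Q /= /centers Ep.
have pw (p : P) : branch (val p) \/ val p = xi by case: (point_cases p) => [->|]; [right | left].
have [->|wx] := pselect (w = val x); first exact: pw.
have [->|wy] := pselect (w = val y); first exact: pw.
have [->|wz] := pselect (w = val z); first exact: pw.
by left; exact: median_point H1 H2 H3 wx wy wz.
Qed.

Lemma center_unique (x y z w : P) : arc (val x) (val y) (val w) -> arc (val y) (val z) (val w) ->
  arc (val x) (val z) (val w) -> Defs.center (M := K) x y z = w.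
Proof.
move=> H1 H2 H3; apply: val_inj; have [K1 K2 K3] := center_spec x y z.
exact: median_unique H1 H2 H3 K1 K2 K3.
Qed.

(** Betweenness is definable from [center]. *)
Lemma center_eqP (x y z : P) : Defs.center (M := K) x y z = y <-> arc (val x) (val z) (val y).
Proof.
split=> [E|xzy]; first by have [_ _] := center_spec x y z; rewrite E.
by apply: center_unique => //; [exact: arc_r | exact: arc_l].
Qed.

Lemma same_componentP (p q : Defs.dpair K) : same_component p q <->
  (sval p).1 = (sval q).1 /\ ~ arc (val (sval p).2) (val (sval q).2) (val (sval p).1).
Proof. by rewrite /same_component -center_eqP. Qed.

Lemma same_component_refl (p : Defs.dpair K) : same_component p p.
Proof.
apply/same_componentP; split=> //; rewrite arcxx => E; apply: (svalP p).
exact: val_inj.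
Qed.

Lemma same_component_sym (p q : Defs.dpair K) : same_component p q -> same_component q p.
Proof. by move=> /same_componentP [E n]; apply/same_componentP; rewrite arcC -E. Qed.

Lemma same_component_trans (p q r : Defs.dpair K) :
  same_component p q -> same_component q r -> same_component p r.
Proof.
move=> /same_componentP [E n] /same_componentP [E' n']; apply/same_componentP.
rewrite E; split=> // /(arc_triangle (val (sval q).2)) [|//].
by rewrite -E.
Qed.

Lemma Phi_eqP (p q : Defs.dpair K) : Phi (M := K) p = Phi q <-> same_component p q.
Proof.
split=> [[E]|pq]; first by rewrite E; exact: same_component_refl.
apply: eq_exist; apply: funext => r; apply: propext; split.
  exact: same_component_trans (same_component_sym pq).
exact: same_component_trans pq.
Qed.

Definition pair_color (q : Defs.dpair K) : N := color_at (val (sval q).1) (val (sval q).2).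

Lemma Phi_pair_color (p q : Defs.dpair K) : branch (val (sval p).1) ->
  Phi (M := K) p = Phi q -> pair_color p = pair_color q.
Proof.
move=> bp /Phi_eqP /same_componentP [E n]; rewrite /pair_color -E.
apply/color_eq => // E'; first by apply: (svalP p); apply: val_inj.
by apply: (svalP q); rewrite -E; apply: val_inj.
Qed.

(** Taking [u] as given covers the relations of arity 0, whose truth does not
    determine a branch point. *)
Lemma comp_rel_pair_color r (q : 'I_(rel_ar r) -> Defs.dpair K) u : branch u ->
  (forall i, val (sval (q i)).1 = u) ->
  comp_rel (M := K) r (Phi (M := K) \o q) <-> rint (M := N) r (pair_color \o q).
Proof.
move=> bu qu; split=> [[x bx [p [E px Hp]]]|Hr].
  rewrite (_ : pair_color \o q = fun i => kappa x (component_at x (val (sval (p i)).2))) //.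
  apply: funext => i /=; have Ei : Phi (M := K) (q i) = Phi (M := K) (p i) := congr1 (fun f => f i) E.
  by rewrite (Phi_pair_color _ Ei) ?qu // /pair_color px.
exists u => //; exists q; split=> //.
rewrite (_ : (fun i => _) = pair_color \o q) //.
by apply: funext => i; rewrite /= /pair_color qu.
Qed.

Lemma comp_rel_base r (q : 'I_(rel_ar r) -> Defs.dpair K) :
  comp_rel (M := K) r (Phi (M := K) \o q) ->
  exists2 u, branch u & forall i, val (sval (q i)).1 = u.
Proof.
case=> x bx [p [E px _]]; exists x => // i.
have /Phi_eqP /same_componentP [-> _] : Phi (M := K) (q i) = Phi (M := K) (p i) := congr1 (fun f => f i) E.
exact: px.
Qed.

(** * Representation by trees of words *)
Definition represents (T : set (seq N)) (iota : seq N -> W) :=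
  (forall l, T l -> branch (iota l)) /\
  forall m a l, T (m ++ a :: l) ->
    iota (m ++ a :: l) <> iota m /\ color_at (iota m) (iota (m ++ a :: l)) = a.

Section Representation.
Variables (T : set (seq N)) (iota : seq N -> W).
Hypotheses (tT : word_tree T) (repT : represents T iota).

Let Tp u v : T (u ++ v) -> T u. Proof. by have [_ _ H _] := tT; exact: H. Qed.
Let Tc u a v : T (u ++ a :: v) -> a <> c.
Proof. by have [_ _ _ H] := tT => Tu E; rewrite E in Tu; exact: H Tu. Qed.
Let Tb l : T l -> branch (iota l). Proof. by have [H _] := repT; exact: H. Qed.

Lemma rep_neq m a l : T (m ++ a :: l) -> iota (m ++ a :: l) <> iota m.
Proof. by have [_ H] := repT => /H []. Qed.

Lemma rep_color_prefix m a l : T (m ++ a :: l) -> color_at (iota m) (iota (m ++ a :: l)) = a.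
Proof. by have [_ H] := repT => /H []. Qed.

Lemma rep_below m a l : T (m ++ a :: l) -> below (iota m) (iota (m ++ a :: l)).
Proof.
move=> Tm; apply/(below_color (Tb (Tp Tm)) (rep_neq Tm)); rewrite rep_color_prefix //.
exact: Tc Tm.
Qed.

Lemma rep_diverge m a b k k' : a <> b -> T (m ++ a :: k) -> T (m ++ b :: k') ->
  arc (iota (m ++ a :: k)) (iota (m ++ b :: k')) (iota m).
Proof.
move=> ab Ta Tb'; apply: contrapT => n; apply: ab.
rewrite -(rep_color_prefix Ta) -(rep_color_prefix Tb').
exact/(color_eq (Tb (Tp Ta)) (rep_neq Ta) (rep_neq Tb')).
Qed.

(** A node that is not above [l] is seen from [l] in the direction of the root. *)
Lemma rep_color_other l l' : T l -> T l' -> l <> l' -> ~ (exists a m, l' = l ++ a :: m) ->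
  iota l' <> iota l /\ color_at (iota l) (iota l') = c.
Proof.
move=> Tl Tl' ll' nx.
suff H : ~ below (iota l) (iota l') /\ iota l' <> iota l.
  case: H => nb ne; split=> //; apply: contrapT => nc; apply: nb.
  exact/(below_color (Tb Tl) ne).
case: (words_compare l l') => [//|//|[a [m E]]|[m [a [b [k [k' [ab E E']]]]]]].
  rewrite E in Tl *; have B := rep_below Tl; split=> [B'|].
    by case: (rep_neq Tl); exact: below_anti B' B.
  by move=> EE; case: (rep_neq Tl); rewrite EE.
rewrite E in Tl *; rewrite E' in Tl' *.
have B := rep_below Tl; have B' := rep_below Tl'; have D := rep_diverge ab Tl Tl'.
split=> [BB|EE].
  by apply: (rep_neq Tl); rewrite -(below_stop B D BB).
apply: ab; by rewrite -(rep_color_prefix Tl) -(rep_color_prefix Tl') EE.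
Qed.

Lemma rep_injective l l' : T l -> T l' -> iota l = iota l' -> l = l'.
Proof.
move=> Tl Tl' E; apply: contrapT => ne.
have [[a [m E']]|nx] := pselect (exists a m, l' = l ++ a :: m).
  by rewrite E' in Tl' E; case: (rep_neq Tl'); rewrite E.
by have [ne' _] := rep_color_other Tl Tl' ne nx; case: ne'.
Qed.

Lemma rep_color_const l l' : T l -> T l' -> l <> l' ->
  iota l' <> iota l /\ with_const (succ T l) (color_at (iota l) (iota l')).
Proof.
move=> Tl Tl' ne; have [[a [m E]]|nx] := pselect (exists a m, l' = l ++ a :: m).
  rewrite E in Tl' *; split; first exact: rep_neq.
  by right; rewrite rep_color_prefix // /succ /=; apply: (@Tp _ m); rewrite -catA.
by have [ne' ->] := rep_color_other Tl Tl' ne nx; split=> //; left.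
Qed.
End Representation.

(** The partial copy of the definition of [tree_embed] controls the letters above
    [u]; a node that is not above [u] has colour c seen from [u], and its image is
    not above the image of [u] because [e] respects branchings. *)
Lemma tree_embed_color T T' iota iota' e u : word_tree T -> word_tree T' ->
  represents T iota -> represents T' iota' -> tree_embed T T' e -> T u ->
  exists2 phi, partial_copy (succ T u) (succ T' (e u)) phi & forall v, T v -> v <> u ->
    e v <> e u /\ color_at (iota' (e u)) (iota' (e v)) = phi (color_at (iota u) (iota v)).
Proof.
move=> tT tT' rT rT' He Tu; have [T'u [phi Hphi Hl]] := He _ Tu; exists phi => // v Tv vu.
have uv : u <> v by move=> E; apply: vu.
have T'v : T' (e v) by have [] := He _ Tv.
have Tp m l : T (m ++ l) -> T m by have [_ _ H _] := tT; exact: H.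
have [[a [m E]]|nx] := pselect (exists a m, v = u ++ a :: m).
  rewrite E in Tv T'v *; have [l' El'] := Hl _ _ Tv; rewrite El' in T'v *; split.
    exact: not_prefix_self.
  by rewrite (rep_color_prefix rT) // (rep_color_prefix rT').
have [_ ->] := rep_color_other tT rT Tu Tv uv nx; have [_ -> _ _] := Hphi.
suff [ne nx'] : e v <> e u /\ ~ (exists a m, e v = e u ++ a :: m).
  have un : e u <> e v by move=> E; apply: ne.
  by have [_ ->] := rep_color_other tT' rT' T'u T'v un nx'.
case: (words_compare u v) => [//|//|[a [m E]]|[m [a [b [k [k' [ab E E']]]]]]].
  have [_ [psi _ Hpsi]] := He _ Tv; rewrite E in Tu; have [l' El'] := Hpsi _ _ Tu.
  rewrite E El'; split=> [/esym|[x [y]]]; first exact: not_prefix_self.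
  by rewrite -catA => /esym; exact: not_prefix_self.
rewrite E in Tu; rewrite E' in Tv.
have [_ [psi [_ _ inj _] Hpsi]] := He _ (Tp _ _ Tu).
have [l1 E1] := Hpsi _ _ Tu; have [l2 E2] := Hpsi _ _ Tv.
have nab : psi a <> psi b.
  move=> Eab; apply: ab; apply: inj => //; right.
    by apply: (Tp _ k); rewrite -catA.
  by apply: (Tp _ k'); rewrite -catA.
rewrite E E' E1 E2; split=> [|[x [y]]].
  by move/List.app_inv_head => -[] /esym.
by rewrite -catA => /List.app_inv_head -[] /esym.
Qed.

Lemma fint_centerE (a : 'I_3 -> P) : fint (M := kaleidoscope_base R xi) Center a =
  Defs.center (M := K) (a (@Ordinal 3 0 isT)) (a (@Ordinal 3 1 isT)) (a (@Ordinal 3 2 isT)).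
Proof. by rewrite /Defs.center /= !(tnth_nth root). Qed.

Section Substructures.
Variables (S : set P) (clS : @Defs.fclosed _ (kaleidoscope_base R xi) S).
Notation sub := (comp_substructure (M := K) clS).

Definition dpair_val (p : Defs.dpair sub) : Defs.dpair K :=
  exist (fun q : K * K => q.1 <> q.2) (sval (sval p).1, sval (sval p).2) (fun E => svalP p (sval_inj E)).

Lemma sub_centerE (x y z : sub) :
  sval (Defs.center (M := sub) x y z) = Defs.center (M := K) (sval x) (sval y) (sval z).
Proof.
rewrite /Defs.center /=; congr points_center; by rewrite !(tnth_nth x).
Qed.

Lemma sub_same_component (p q : Defs.dpair sub) :
  same_component p q <-> same_component (dpair_val p) (dpair_val q).
Proof.
split=> -[E n]; split.
- by rewrite /= E.
- by move=> E'; apply: n; apply: sval_inj; rewrite sub_centerE.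
- exact: sval_inj.
- move=> E'; apply: n; apply: etrans (congr1 sval E'); exact: esym (sub_centerE _ _ _).
Qed.

Lemma sub_Phi (p q : Defs.dpair sub) : Phi (M := sub) p = Phi q ->
  Phi (M := K) (dpair_val p) = Phi (dpair_val q).
Proof.
case=> E; apply/Phi_eqP/sub_same_component; rewrite E.
exact/sub_same_component/same_component_refl.
Qed.

Lemma sub_comp_rel r (p : 'I_(rel_ar r) -> Defs.dpair sub) :
  comp_rel (M := sub) r (Phi (M := sub) \o p) <->
  comp_rel (M := K) r (Phi (M := K) \o (dpair_val \o p)).
Proof.
split=> [[p' [q' [E Eq H]]]|H]; last by exists p, (dpair_val \o p).
rewrite (_ : _ \o _ = Phi (M := K) \o q') //.
apply: funext => i /=.
rewrite (sub_Phi (congr1 (fun f => f i) E)); congr Phi.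
by apply: sval_inj; rewrite Eq.
Qed.
End Substructures.

Definition spans (S : set P) (T : set (seq N)) (iota : seq N -> W) :=
  forall x : P, S x <-> x = root \/ exists2 l, T l & val x = iota l.

Lemma branch_root_neq u : branch u -> val root <> u.
Proof. exact: branch_neq_xi. Qed.

Section Transfer.
Variables (S S' : set P) (T T' : set (seq N)) (iota iota' : seq N -> W).
Variables (clS : @Defs.fclosed _ (kaleidoscope_base R xi) S)
  (clS' : @Defs.fclosed _ (kaleidoscope_base R xi) S').
Hypotheses (tT : word_tree T) (tT' : word_tree T') (rT : represents T iota)
  (rT' : represents T' iota') (sS : spans S T iota) (sS' : spans S' T' iota').
Notation sub := (comp_substructure (M := K) clS).
Notation sub' := (comp_substructure (M := K) clS').

Let rootS : S root. Proof. by apply/sS; left. Qed.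
Let rootS' : S' root. Proof. by apply/sS'; left. Qed.

Lemma spans_cases (x : sub) : sval x = root \/ exists2 l, T l & val (sval x) = iota l.
Proof. exact/sS/(svalP x). Qed.

(** Away from its ends, a point [w] lies on the arc from [x] to [y] when the colours
    of [x] and [y] seen from [w] differ. Colours being transformed injectively at
    each node, betweenness is preserved, hence so is [center]. *)
Lemma tree_embed_comp_embedding e : tree_embed T T' e -> exists2 h : sub -> sub',
  comp_embedding h & forall x, (sval x = root -> sval (h x) = root) /\
    forall l, T l -> val (sval x) = iota l -> val (sval (h x)) = iota' (e l).
Proof.
move=> He.
have T'e l : T l -> T' (e l) by move=> Tl; have [] := He _ Tl.
have bT l : T l -> branch (iota l) by have [H _] := rT; exact: H.
have bT' l : T' l -> branch (iota' l) by have [H _] := rT'; exact: H.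
have /boolp.choice [h Hh] : forall x : sub, exists y : sub', (sval x = root -> sval y = root) /\
    forall l, T l -> val (sval x) = iota l -> val (sval y) = iota' (e l).
  move=> x; have [Ex|[l Tl Ex]] := spans_cases x.
    exists (exist _ root rootS'); split=> // l Tl; rewrite Ex => E.
    by case: (branch_root_neq (bT _ Tl)).
  have [|y Ey] := @point_of (iota' (e l)); first by left; exact/bT'/T'e.
  have S'y : S' y by apply/sS'; right; exists (e l) => //; exact: T'e.
  exists (exist _ y S'y); split=> [Er|l' Tl' El'].
    by case: (branch_root_neq (bT _ Tl)); rewrite -Ex Er.
  by rewrite /= Ey; congr (iota' (e _)); apply: (rep_injective tT rT) => //; rewrite -Ex -El'.
have hroot x : sval x = root -> sval (h x) = root by have [] := Hh x.
have hiota x l : T l -> val (sval x) = iota l -> val (sval (h x)) = iota' (e l).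
  by have [_ H] := Hh x; exact: H.
exists h => //.
(* a single partial copy transforms all the colours seen from [x] *)
have hcol x l : T l -> val (sval x) = iota l ->
    exists2 phi, partial_copy (succ T l) (succ T' (e l)) phi & forall y, sval y <> sval x ->
      [/\ sval (h y) <> sval (h x), with_const (succ T l) (color_at (val (sval x)) (val (sval y))) &
      color_at (val (sval (h x))) (val (sval (h y))) = phi (color_at (val (sval x)) (val (sval y)))].
  move=> Tl Ex; have [phi Hphi Hcol] := tree_embed_color tT tT' rT rT' He Tl; exists phi => // y yx.
  have Ehx := hiota _ _ Tl Ex; have bx' := bT' _ (T'e _ Tl).
  have [Ey|[l' Tl' Ey]] := spans_cases y.
    rewrite (hroot _ Ey) Ey Ehx Ex; split.
    - by move=> E; apply: (branch_root_neq bx'); rewrite -Ehx -E.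
    - by left; exact: color_root (bT _ Tl).
    - have -> : val root = xi by [].
      by rewrite (color_root bx') (color_root (bT _ Tl)); have [_ -> _ _] := Hphi.
  have l'l : l' <> l by move=> E; apply: yx; apply: val_inj; rewrite Ey E Ex.
  have [ne E] := Hcol _ Tl' l'l; rewrite Ehx (hiota _ _ Tl' Ey) Ex Ey; split=> //.
    move=> E'; apply: ne; apply: (rep_injective tT' rT') => //; try exact: T'e.
    by rewrite -Ehx -(hiota _ _ Tl' Ey) E'.
  have ll' : l <> l' by move=> E'; apply: l'l.
  by have [] := rep_color_const tT rT Tl Tl' ll'.
have hne x y : sval y <> sval x -> sval (h y) <> sval (h x).
  move=> yx; have [Ex|[l Tl Ex]] := spans_cases x.
    have [Ey|[l' Tl' Ey]] := spans_cases y; first by case: yx; rewrite Ex Ey.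
    rewrite (hroot _ Ex) => E; apply: (branch_root_neq (bT' _ (T'e _ Tl'))).
    by rewrite -(hiota _ _ Tl' Ey) E.
  by have [phi _ Hphi] := hcol _ _ Tl Ex; have [] := Hphi _ yx.
have harc x y w : arc (val (sval x)) (val (sval y)) (val (sval w)) ->
    arc (val (sval (h x))) (val (sval (h y))) (val (sval (h w))).
  move=> xyw; have [Ewx|wx] := pselect (sval x = sval w).
    by rewrite (sval_inj Ewx); exact: arc_l.
  have [Ewy|wy] := pselect (sval y = sval w).
    by rewrite (sval_inj Ewy); exact: arc_r.
  have [Ew|[l Tl Ew]] := spans_cases w.
    rewrite Ew /= in xyw; have [Ex|Ey] := endpoint_arc xyw.
      by case: wx; rewrite Ew; exact: val_inj.
    by case: wy; rewrite Ew; exact: val_inj.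
  have [phi [_ _ inj _] Hphi] := hcol _ _ Tl Ew.
  have [nx cx Ex] := Hphi _ wx; have [ny cy Ey] := Hphi _ wy.
  have bw' : branch (val (sval (h w))) by rewrite (hiota _ _ Tl Ew); exact/bT'/T'e.
  have vne (a b : P) : a <> b -> val a <> val b by move=> ne /val_inj.
  apply: contrapT => nar.
  have := (color_eq bw' (vne _ _ nx) (vne _ _ ny)).2 nar; rewrite Ex Ey => /(inj _ _ cx cy).
  have bw : branch (val (sval w)) by rewrite Ew; exact: bT.
  exact: color_neq bw (vne _ _ wx) (vne _ _ wy) xyw.
have hinj : injective h.
  by move=> x y E; apply: contrapT => xy; apply: (hne x y) => [/sval_inj /esym //|]; rewrite E.
split; first split=> //.
- case=> a; apply: sval_inj; first exact: hroot.
  have E (Q : set P) (clQ : @Defs.fclosed _ (kaleidoscope_base R xi) Q) (b : 'I_3 -> {x | Q x}) :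
    sval (fint (M := comp_substructure (M := K) clQ) Center b) =
    Defs.center (M := K) (sval (b (@Ordinal 3 0 isT))) (sval (b (@Ordinal 3 1 isT))) (sval (b (@Ordinal 3 2 isT))).
    exact: fint_centerE (fun i => sval (b i)).
  have [A1 A2 A3] := center_spec (sval (a (@Ordinal 3 0 isT))) (sval (a (@Ordinal 3 1 isT))) (sval (a (@Ordinal 3 2 isT))).
  rewrite -(E _ clS a) in A1 A2 A3.
  by apply/esym; apply: (etrans (E _ clS' (h \o a))); apply: center_unique; exact: harc.
- by case.
move=> r p q Eq.
pose p' := dpair_val (clS := clS) \o p; pose q' := dpair_val (clS := clS') \o q.
suff : comp_rel (M := K) r (Phi (M := K) \o p') <-> comp_rel (M := K) r (Phi (M := K) \o q').
  by move=> H; apply: iff_trans (sub_comp_rel p) _; apply: iff_trans H _; apply: iff_sym; exact: sub_comp_rel.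
have Eq1 i : (sval (q' i)).1 = sval (h (sval (p i)).1) by rewrite /= Eq.
have Eq2 i : (sval (q' i)).2 = sval (h (sval (p i)).2) by rewrite /= Eq.
have [ar0|ar] := posnP (rel_ar r).
  rewrite (_ : Phi (M := K) \o p' = Phi (M := K) \o q') //.
  by apply: funext => i; have := ltn_ord i; rewrite {2}ar0.
pose i0 : 'I_(rel_ar r) := Ordinal ar.
(* both relations force all the components to sit at one branch point *)
have based l : T l -> val (sval (sval (p i0)).1) = iota l ->
    (forall i, sval (sval (p i)).1 = sval (sval (p i0)).1) ->
    comp_rel (M := K) r (Phi (M := K) \o p') <-> comp_rel (M := K) r (Phi (M := K) \o q').
  move=> Tl E0 Ei; have [phi [_ _ _ Hrel] Hphi] := hcol _ _ Tl E0.
  apply: iff_trans (comp_rel_pair_color (u := iota l) _ _) _.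
  - exact: bT.
  - by move=> i; rewrite /= Ei.
  apply: iff_sym; apply: iff_trans (comp_rel_pair_color (u := iota' (e l)) _ _) _.
  - exact/bT'/T'e.
  - by move=> i; rewrite Eq1; apply: hiota => //; rewrite Ei.
  have pne i : sval (sval (p i)).2 <> sval (sval (p i0)).1.
    by move=> E; apply: (svalP (p i)); apply: sval_inj; rewrite Ei -E.
  have -> : pair_color \o q' = phi \o (pair_color \o p').
    apply: funext => i; have [_ _ H] := Hphi _ (pne i).
    rewrite /= /pair_color Eq1 Eq2 /= Ei -H; congr (color_at (val (sval (h _))) _).
    by apply: sval_inj; rewrite Ei.
  apply: iff_sym; apply: Hrel => i; have [_ H _] := Hphi _ (pne i).
  by rewrite /= /pair_color /= Ei.
split=> H.
  have [u bu Hu] := comp_rel_base H; have [E|[l Tl E]] := spans_cases (sval (p i0)).1.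
    by case: (branch_root_neq bu); rewrite -(Hu i0) /= E.
  by apply/(based _ Tl E) => // i; apply: val_inj; rewrite [RHS](Hu i0) (Hu i).
have [u bu Hu] := comp_rel_base H; have [E|[l Tl E]] := spans_cases (sval (p i0)).1.
  by case: (branch_root_neq bu); rewrite -(Hu i0) Eq1 hroot.
apply/(based _ Tl E) => // i; apply: contrapT => ne; apply: (hne _ _ ne).
by apply: val_inj; rewrite -!Eq1 !Hu.
Qed.

(** Since [h] preserves and reflects betweenness, it preserves and reflects equality
    of colours at each node, so that it acts on them by an injective map [phi]. The
    colour c is fixed because the root is, and the relations are those of the
    components. *)
Lemma comp_embedding_tree_embed (h : sub -> sub') : comp_embedding h ->
  exists2 e, tree_embed T T' e & forall x, (sval x = root -> sval (h x) = root) /\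
    forall l, T l -> val (sval x) = iota l -> val (sval (h x)) = iota' (e l).
Proof.
move=> [[hinj hfun _] hrel].
have bT l : T l -> branch (iota l) by have [H _] := rT; exact: H.
have bT' l : T' l -> branch (iota' l) by have [H _] := rT'; exact: H.
have hroot x : sval x = root -> sval (h x) = root.
  move=> Ex; have -> : x = fint (M := sub) Root (fun i : 'I_0 => x) by apply: sval_inj.
  by rewrite hfun.
have hcenter x y z : h (Defs.center (M := sub) x y z) = Defs.center (M := sub') (h x) (h y) (h z).
  rewrite /Defs.center hfun; congr (fint (M := sub') Center _).
  by apply: funext => -[[|[|[|i]]] ilt] //; rewrite /= !(tnth_nth x) ?(tnth_nth (h x)).
have centerP (Q : set P) (clQ : @Defs.fclosed _ (kaleidoscope_base R xi) Q)
    (x y z : comp_substructure (M := K) clQ) :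
    Defs.center (M := comp_substructure (M := K) clQ) x y z = y <->
    arc (val (sval x)) (val (sval z)) (val (sval y)).
  apply: iff_trans (center_eqP _ _ _); rewrite -sub_centerE; split=> [->//|]; exact: sval_inj.
have harc x y w : arc (val (sval x)) (val (sval y)) (val (sval w)) <->
    arc (val (sval (h x))) (val (sval (h y))) (val (sval (h w))).
  split=> [/centerP E|/centerP]; first by apply/centerP; rewrite -hcenter E.
  by rewrite -hcenter => /hinj /centerP.
have hne x y : sval y <> sval x -> sval (h y) <> sval (h x).
  by move=> yx E; apply: yx; rewrite (hinj _ _ (sval_inj E)).
have elt l : T l -> exists x : sub, val (sval x) = iota l.
  move=> Tl; have [|y Ey] := @point_of (iota l); first by left; exact: bT.
  have Sy : S y by apply/sS; right; exists l.
  by exists (exist _ y Sy).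
have not_root (x : sub) l : T l -> val (sval x) = iota l -> sval x <> root.
  by move=> Tl Ex E; apply: (branch_root_neq (bT _ Tl)); rewrite -Ex E.
have word' (x : sub) l : T l -> val (sval x) = iota l ->
    exists2 l', T' l' & val (sval (h x)) = iota' l'.
  move=> Tl Ex; have [E|//] := (sS' (sval (h x))).1 (svalP (h x)).
  case: (not_root _ _ Tl Ex); apply: contrapT => ne.
  apply: (hne (exist _ root rootS) x ne); rewrite E; apply/esym; exact: hroot.
have /boolp.choice [e He] : forall l, exists l', T l -> T' l' /\
    forall x : sub, val (sval x) = iota l -> val (sval (h x)) = iota' l'.
  move=> l; have [Tl|nTl] := pselect (T l); last by exists l.
  have [x Ex] := elt _ Tl; have [l' Tl' El'] := word' _ _ Tl Ex; exists l' => _; split=> // y Ey.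
  by rewrite -El'; congr (val (sval (h _))); apply: sval_inj; apply: val_inj; rewrite Ey Ex.
exists e; last by move=> x; split; [exact: hroot | move=> l Tl; exact: (He l Tl).2].
move=> u Tu; have [T'u Hu] := He u Tu; split=> //.
have [U EU] := elt _ Tu.
have bU : branch (val (sval U)) by rewrite EU; exact: bT.
have EhU := Hu _ EU; have bhU : branch (val (sval (h U))) by rewrite EhU; exact: bT'.
have vne (a b : P) : a <> b -> val a <> val b by move=> ne /val_inj.
have colh v v' : sval v <> sval U -> sval v' <> sval U ->
    (color_at (val (sval U)) (val (sval v)) = color_at (val (sval U)) (val (sval v')) <->
     color_at (val (sval (h U))) (val (sval (h v))) = color_at (val (sval (h U))) (val (sval (h v')))).
  move=> vU v'U; apply: iff_trans (color_eq bU (vne _ _ vU) (vne _ _ v'U)) _.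
  apply: iff_sym; apply: iff_trans (color_eq bhU (vne _ _ (hne _ _ vU)) (vne _ _ (hne _ _ v'U))) _.
  by rewrite harc.
have Tp m l : T (m ++ l) -> T m by have [_ _ H _] := tT; exact: H.
have T'p m l : T' (m ++ l) -> T' m by have [_ _ H _] := tT'; exact: H.
have T'c m a l : T' (m ++ a :: l) -> a <> c.
  by have [_ _ _ H] := tT' => Tm E; rewrite E in Tm; exact: H Tm.
(* [wit a] lies in the direction [a] from [U] *)
have /boolp.choice [wit Hwit] : forall a, exists v : sub, with_const (succ T u) a ->
    sval v <> sval U /\ color_at (val (sval U)) (val (sval v)) = a.
  move=> a; have [[->|Ta]|na] := pselect (with_const (succ T u) a); last by exists U.
    exists (exist _ root rootS) => _; split=> [E|]; last exact: color_root.
    by case: (not_root _ _ Tu EU); rewrite -E.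
  have [v Ev] := elt _ Ta; exists v => _; rewrite EU Ev (rep_color_prefix rT) //; split=> //.
  by move=> E; apply: (rep_neq rT Ta); rewrite -Ev -EU E.
pose phi a := color_at (val (sval (h U))) (val (sval (h (wit a)))).
have phiE v a : sval v <> sval U -> with_const (succ T u) a -> color_at (val (sval U)) (val (sval v)) = a ->
    phi a = color_at (val (sval (h U))) (val (sval (h v))).
  move=> vU Da Ea; have [wU Ew] := Hwit _ Da; apply/colh => //; by rewrite Ew Ea.
have hword v l : T l -> val (sval v) = iota l -> l <> u ->
    (exists a m, e l = e u ++ a :: m /\ color_at (val (sval (h U))) (val (sval (h v))) = a) \/
    color_at (val (sval (h U))) (val (sval (h v))) = c.
  move=> Tl Ev lu; have [T'l Hl] := He l Tl; rewrite (Hl _ Ev) EhU.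
  have [[a [m E]]|nx] := pselect (exists a m, e l = e u ++ a :: m).
    left; exists a, m; split=> //; rewrite E in T'l *; exact: rep_color_prefix T'l.
  right; have ne : e u <> e l.
    move=> E; apply: lu; apply: (rep_injective tT rT) => //; rewrite -Ev -EU.
    apply: contrapT => vU; have : sval v <> sval U by move=> E'; apply: vU; rewrite E'.
    by move/hne; apply; apply: val_inj; rewrite (Hl _ Ev) EhU E.
  by have [] := rep_color_other tT' rT' T'u T'l ne nx.
have phic : phi c = c.
  rewrite (phiE (exist _ root rootS)) //.
  - by rewrite (hroot (exist _ root rootS)) //; exact: color_root.
  - by move=> E; case: (not_root _ _ Tu EU); rewrite -E.
  - by left.
  - exact: color_root.
have phi_inj a b : with_const (succ T u) a -> with_const (succ T u) b -> phi a = phi b -> a = b.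
  move=> Da Db; have [waU Ea] := Hwit _ Da; have [wbU Eb] := Hwit _ Db.
  by move/colh; rewrite Ea Eb; apply.
have main a l : T (u ++ a :: l) -> exists m, e (u ++ a :: l) = e u ++ phi a :: m.
  move=> Tl; have Da : succ T u a by apply: (@Tp _ l); rewrite -catA.
  have [v Ev] := elt _ Tl.
  have vU : sval v <> sval U by move=> E; apply: (rep_neq rT Tl); rewrite -Ev -EU E.
  have Ecol : color_at (val (sval U)) (val (sval v)) = a by rewrite EU Ev (rep_color_prefix rT).
  have Ephi := phiE _ _ vU (or_intror Da) Ecol.
  have [[b [m [E Eb]]]|E] := hword _ _ Tl Ev (@not_prefix_self _ _ _ _).
    by exists m; rewrite E Ephi Eb.
  have ac : a = c by apply: phi_inj; [right | left | rewrite phic Ephi].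
  by have [_ _ _ H] := tT; rewrite ac in Tl; case: (H _ _ Tl).
exists phi => //; split=> //.
  move=> a Da; have [m Em] := main a [::] Da.
  have [T'a _] := He _ Da; rewrite Em in T'a; apply: (@T'p _ m); by rewrite -catA.
move=> r x Hx.
have pne i : U <> wit (x i) by move=> E; have [] := Hwit _ (Hx i); rewrite -E.
pose p i : Defs.dpair sub := exist (fun q : sub * sub => q.1 <> q.2) (U, wit (x i)) (pne i).
have qne i : h U <> h (wit (x i)) by move=> /hinj; exact: pne.
pose q i : Defs.dpair sub' := exist (fun q : sub' * sub' => q.1 <> q.2) (h U, h (wit (x i))) (qne i).
have Ex : x = pair_color \o (dpair_val (clS := clS) \o p).
  by apply: funext => i; have [_ <-] := Hwit _ (Hx i).
have Ephi : phi \o x = pair_color \o (dpair_val (clS := clS') \o q) by [].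
rewrite Ephi [in X in X <-> _]Ex.
apply: iff_trans (iff_sym (comp_rel_pair_color (q := dpair_val (clS := clS) \o p) bU _)) _ => //.
apply: iff_trans (comp_rel_pair_color (q := dpair_val (clS := clS') \o q) bhU _) => //.
apply: iff_trans (iff_sym (sub_comp_rel p)) _; apply: iff_trans (sub_comp_rel q).
exact: hrel.
Qed.
End Transfer.

Lemma meet_exists x y : branch x -> branch y ->
  exists m, [/\ branch m, below m x, below m y & arc x y m].
Proof.
move=> bx by_; have [m [H1 H2 H3]] := median_exists xi x y; exists m; split=> //.
have [->//|mx] := pselect (m = x); have [->//|my] := pselect (m = y).
have [Em|mxi] := pselect (m = xi); last exact: median_point H1 H2 H3 mxi mx my.
rewrite Em in H2; case: (endpoint_arc H2) => E; [case: (branch_neq_xi bx) | case: (branch_neq_xi by_)];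
  exact: esym.
Qed.

Definition meet_closed (S : set W) := forall x y, S x -> S y ->
  exists2 m, S m & [/\ below m x, below m y & arc x y m].

Lemma meet_closed_least (S : set W) (s : seq W) x0 : meet_closed S -> S x0 ->
  (forall x, S x -> List.In x s) -> exists2 r, S r & forall x, S x -> below r x.
Proof.
move=> mS Sx0 Ss.
suff [r Sr Hr] : exists2 r, S r & forall x, List.In x s -> S x -> below r x.
  by exists r => // x Sx; apply: Hr => //; exact: Ss.
elim: s {Ss} => [|y s [r Sr Hr]]; first by exists x0.
have [Sy|nSy] := pselect (S y); last first.
  by exists r => // x [<- //|xs] Sx; exact: Hr.
have [m Sm [mr my _]] := mS _ _ Sr Sy; exists m => // x [<- //|xs] Sx.
exact: below_trans mr (Hr _ xs Sx).
Qed.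

(** The least element of [S] becomes the empty word. The elements of a given colour
    seen from it are again closed under meets and fewer, and they become the words
    with that first letter. *)
Lemma exists_representation (S : set W) (s : seq W) : (forall x, S x -> branch x) ->
  meet_closed S -> S !=set0 -> (forall x, S x -> List.In x s) ->
  exists T iota, [/\ word_tree T, represents T iota & forall x, S x <-> exists2 l, T l & x = iota l].
Proof.
have [n] := ubnP (size s); elim: n S s => // n IH S s sn Sb mS [x0 Sx0] Ss.
have [r Sr Hr] := meet_closed_least mS Sx0 Ss.
have br := Sb _ Sr.
pose S_ a : set W := [set x | [/\ S x, x <> r & color_at r x = a]].
have mS_ a : meet_closed (S_ a).
  move=> x y [Sx xr cx] [Sy yr cy]; have [m Sm [mx my xym]] := mS _ _ Sx Sy.
  have mr : m <> r.
    by move=> E; rewrite E in xym; apply: (color_neq br xr yr xym); rewrite cx cy.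
  exists m => //; split=> //; rewrite -cx; apply/(color_eq br mr xr) => mxr.
  by apply: mr; apply/esym; exact: below_stop (Hr _ Sm) mxr mx.
have [s1 [s2 Es]] := List.in_split _ _ (Ss _ Sr).
have S_s a x : S_ a x -> List.In x (s1 ++ s2).
  move=> [/Ss + xr _]; rewrite Es => /List.in_app_iff [|[/esym //|]] ?; apply/List.in_app_iff; [left|right] => //.
have sn' : (size (s1 ++ s2) < n)%N.
  by move: sn; rewrite Es !size_cat /= addnS ltnS.
have /boolp.choice [Ti HTi] : forall a, exists Ti : set (seq N) * (seq N -> W), S_ a !=set0 ->
    [/\ word_tree Ti.1, represents Ti.1 Ti.2 & forall x, S_ a x <-> exists2 l, Ti.1 l & x = Ti.2 l].
  move=> a; have [S0|nS] := pselect (S_ a !=set0); last by exists (set0, fun=> xi).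
  have [|T [iota H]] := IH (S_ a) _ sn' _ (mS_ a) S0 (S_s a); first by move=> x [Sx _ _]; exact: Sb.
  by exists (T, iota).
pose F : set N := [set a | S_ a !=set0].
have fF : finite_set F.
  apply: (@sub_finite_set _ _ (color_at r @` [set x | List.In x s])).
    by move=> a [x [Sx _ <-]]; exists x => //; exact: Ss.
  by apply: finite_image; exact: list_finite.
have Fc : ~ F c.
  by move=> [x [Sx xr]]; apply/(below_color br xr); exact: Hr.
exists (node F (fun a => (Ti a).1)), (fun l => if l is a :: l' then (Ti a).2 l' else r); split.
- by apply: node_tree => // a /HTi [].
- split.
    by case=> [//|a l] [/HTi [_ [H _] _] /H].
  case=> [|b m] a l /= [Fa Tl]; have [_ [Hb Hm] HS] := HTi _ Fa.
    by have [_ ne E] : S_ a ((Ti a).2 l) by apply/HS; exists l.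
  exact: Hm.
- move=> x; split=> [Sx|[[_ ->//|a l] [/HTi [_ _ HS] Tl] ->]]; last first.
    by have [] : S_ a ((Ti a).2 l) by apply/HS; exists l.
  have [->|xr] := pselect (x = r); first by exists [::].
  have Sax : S_ (color_at r x) x by [].
  have [_ _ HS] := HTi (color_at r x) (ex_intro _ x Sax).
  by have [l Tl ->] := (HS x).1 Sax; exists (color_at r x :: l) => //; split=> //; exists x.
Qed.

(** Words are read from the right: the point of [rcons l a] is some branch point in
    the direction [a] from the point of [l]. Letters other than c lead away from the
    root, so that later letters stay in the same component at each earlier
    point. *)
Lemma exists_word_points : exists w : seq N -> W, (forall l, branch (w l)) /\
  forall m a l, (forall u b v, a :: l = u ++ b :: v -> b <> c) ->
    w (m ++ a :: l) <> w m /\ color_at (w m) (w (m ++ a :: l)) = a.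
Proof.
have [|x0 bx0 _] := @branch_in_open setT openT; first by exists xi.
have /boolp.choice [pick Hpick] : forall ua : W * N, exists v, branch ua.1 ->
    [/\ branch v, v <> ua.1 & color_at ua.1 v = ua.2].
  move=> [u a] /=; have [bu|nbu] := pselect (branch u); last by exists u.
  by have [v H] := color_surj a bu; exists v.
pose wr := fix wr (l : seq N) : W := if l is a :: l' then pick (wr l', a) else x0.
have bwr l : branch (wr l) by elim: l => //= a l IH; have [] := Hpick (wr l, a) IH.
exists (wr \o rev); split=> [l|]; first exact: bwr.
move=> m a l; elim/last_ind: l => [|l b IH] Hc.
  by rewrite /= cats1 rev_rcons /=; have [_ ne E] := Hpick (wr (rev m), a) (bwr _).
have [|ne E] := IH; first by move=> u x v Ex; apply: (Hc u x (rcons v b)); rewrite -rcons_cons Ex rcons_cat.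
have bc : b <> c by apply: (Hc (a :: l) b [::]); rewrite -rcons_cons cats1.
have ac : a <> c by apply: (Hc [::] a (rcons l b)).
rewrite -rcons_cons -rcons_cat /= rev_rcons /=.
set u := wr (rev m) in ne E *; set v := wr (rev (m ++ a :: l)) in ne E *.
have [_ zv Ez] := Hpick (v, b) (bwr _); set z := pick (v, b) in zv Ez *.
have bu : branch u by exact: bwr.
have bv : branch v by exact: bwr.
have uv : below u v by apply/(below_color bu ne); rewrite E.
have vz : below v z by apply/(below_color bv zv); rewrite Ez.
have zu : z <> u by move=> Ezu; apply: zv; rewrite Ezu; apply: below_anti uv _; rewrite -Ezu.
split=> //; rewrite -E; apply/(color_eq bu zu ne) => zvu.
by apply: ne; apply/esym; apply: below_stop uv _ vz; rewrite arcC.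
Qed.

(** The center lies, on each of the three arcs, below one of the two ends; so it is
    below two of the three points, and it is their meet. *)
Lemma center_below (x y z : P) : exists p : P * P,
  (p = (x, y) \/ p = (y, z) \/ p = (x, z)) /\ Defs.center (M := K) x y z = Defs.center (M := K) root p.1 p.2.
Proof.
have [H1 H2 H3] := center_spec x y z; set w := Defs.center (M := K) x y z in H1 H2 H3 *.
have key (a b : P) : arc (val a) (val b) (val w) -> below (val w) (val a) -> below (val w) (val b) ->
    w = Defs.center (M := K) root a b.
  by move=> abw wa wb; apply/esym; apply: center_unique.
have tri (a b : P) : arc (val a) (val b) (val w) -> below (val w) (val a) \/ below (val w) (val b).
  by move=> /(arc_triangle xi) []; [rewrite arcC; left | right].
have [Bx|By] := tri _ _ H1.
  have [By|Bz] := tri _ _ H2; first by exists (x, y); split; [left | exact: key].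
  by exists (x, z); split; [right; right | exact: key].
have [Bx|Bz] := tri _ _ H3; first by exists (x, y); split; [left | exact: key].
by exists (y, z); split; [right; left | exact: key].
Qed.

Lemma closed_of_meets (S : set P) : S root ->
  (forall x y, S x -> S y -> S (Defs.center (M := K) root x y)) ->
  @Defs.fclosed _ (kaleidoscope_base R xi) S.
Proof.
move=> S0 Sm [] a Sa; first exact: S0.
rewrite fint_centerE; have [p [Ep ->]] := center_below (a (@Ordinal 3 0 isT)) (a (@Ordinal 3 1 isT)) (a (@Ordinal 3 2 isT)).
by case: Ep => [->|[->|->]] /=; apply: Sm.
Qed.

(** The meets of pairs of generators are closed under meets, since the meet of four
    points of a tree is already the meet of two of them. *)
Lemma finite_closure (S : set P) : @finitely_generated _ (kaleidoscope_base R xi) S -> finite_set S.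
Proof.
case=> G fG ->.
pose G0 := [set root] `|` G.
pose M := [set Defs.center (M := K) root x y | x in G0 & y in G0].
have fM : finite_set M.
  by apply: finite_image2; rewrite finite_setU; split=> //; exact: finite_set1.
have inM x : G0 x -> M x.
  by move=> Gx; exists x => //; exists x => //; apply: center_unique; exact: arc_r.
apply: sub_finite_set fM; apply: smallest_sub; last by move=> x Gx; apply: inM; right.
apply: closed_of_meets; first by apply: inM; left.
move=> _ _ [x Gx [y Gy <-]] [x' Gx' [y' Gy' <-]].
set m1 := Defs.center (M := K) root x y; set m2 := Defs.center (M := K) root x' y'.
set m := Defs.center (M := K) root m1 m2.
have [A1 A2 A3] := center_spec root x y; have [B1 B2 B3] := center_spec root x' y'.
have [C1 C2 C3] := center_spec root m1 m2.
rewrite -/m1 in A1 A2 A3; rewrite -/m2 in B1 B2 B3; rewrite -/m in C1 C2 C3.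
have [->|mm1] := pselect (m = m1); first by exists x => //; exists y.
have [->|mm2] := pselect (m = m2); first by exists x' => //; exists y'.
exists x => //; exists x' => //.
have nval (a b : P) : a <> b -> val a <> val b by move=> ne /val_inj.
apply: center_unique.
- exact: below_trans C1 A1.
- have [mx|mx] := arc_triangle (val x) C2.
    by case: (nval _ _ mm1); exact: below_stop C1 mx A1.
  have [//|mx'] := arc_triangle (val x') mx.
  by case: (nval _ _ mm2); apply: below_stop C3 _ B1; rewrite arcC.
- exact: below_trans C3 B1.
Qed.

Lemma exists_spanning (S : set P) (clS : @Defs.fclosed _ (kaleidoscope_base R xi) S) (x0 : P) :
  finite_set S -> S x0 -> x0 <> root ->
  exists T iota, [/\ word_tree T, represents T iota & spans S T iota].
Proof.
move=> fS Sx0 x0r.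
have Sroot : S root.
  have := clS Root (fun i : 'I_0 => root); apply; by case.
have [s Hs] := finite_listP fS.
pose B : set W := [set u | exists2 x, S x & val x = u /\ branch u].
have [||||T [iota [tT rT BT]]] := @exists_representation B (map val s).
- by move=> u [x _ [_ bu]].
- move=> _ _ [x Sx [<- bx]] [y Sy [<- by_]].
  have [m [bm mx my xym]] := meet_exists bx by_.
  have [p Ep] := @point_of m (or_introl bm).
  exists m => //; exists p => //.
  have -> : p = Defs.center (M := K) root x y by apply/esym/center_unique; rewrite Ep.
  have := clS Center (tnth [tuple root; x; y]); apply.
  by case=> [[|[|[|i]]] ilt] //; rewrite (tnth_nth root).
- by exists (val x0); exists x0 => //; split=> //; case: (point_cases x0).
- move=> u [x /Hs + [<- _]]; elim: s {Hs} => //= y s IH [->|/IH ?]; [by left | by right].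
exists T, iota; split=> // x; split=> [Sx|[->//|[l Tl Ex]]].
  have [->|bx] := point_cases x; first by left.
  by right; have [l Tl E] := (BT (val x)).1 (ex_intro2 _ _ x Sx (conj erefl bx)); exists l.
have [y Sy [Ey _]] := (BT (iota l)).2 (ex_intro2 _ _ l Tl erefl).
by rewrite (_ : x = y) //; apply: val_inj; rewrite Ex Ey.
Qed.

(** * The Ramsey property *)
Theorem kaleidoscope_ramsey : ramsey_structure N -> ramsey_comp_structure K.
Proof.
move=> RN A B [SA [clA [fgA [hA [[gA hAK gAK] hAe]]]]] [SB [clB [fgB [hB [[gB hBK gBK] hBe]]]]] [e0 He0] k k0.
have ageB : comp_age K B by exists SB, clB; split=> //; exists hB; split=> //; exists gB.
have fA := finite_closure fgA; have fB := finite_closure fgB.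
have conv (e : A -> B) : comp_embedding e -> comp_embedding (hB \o e \o gA).
  move=> He; apply: comp_embedding_comp; first exact: comp_embedding_inverse hAK gAK hAe.
  exact: comp_embedding_comp He hBe.
have rootE (Q : set P) (clQ : @Defs.fclosed _ (kaleidoscope_base R xi) Q)
    (Q' : set P) (clQ' : @Defs.fclosed _ (kaleidoscope_base R xi) Q')
    (h : comp_substructure (M := K) clQ -> comp_substructure (M := K) clQ') x :
    comp_embedding h -> sval x = root -> sval (h x) = root.
  move=> [[_ hf _] _] Ex; have -> : x = fint (M := comp_substructure (M := K) clQ) Root (fun i : 'I_0 => x).
    exact: sval_inj.
  by rewrite hf.
have [[a0 [Sa0 a0r]]|only] := pselect (exists a, SA a /\ a <> root); last first.
  (* only one map can embed a structure reduced to the root *)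
  exists B => //; split; first by exists e0.
  move=> gamma; exists id; first exact: comp_embedding_id.
  move=> e e' He He'; congr gamma; apply: funext => a /=.
  have ra : sval (hA a) = root.
    by apply: contrapT => ne; apply: only; exists (sval (hA a)); split=> //; exact: svalP.
  apply: (can_inj hBK); apply: sval_inj; rewrite -(hAK a).
  by rewrite [LHS](rootE _ _ _ _ _ _ (conv _ He)) // [RHS](rootE _ _ _ _ _ _ (conv _ He')).
have [TA [iA [tA rA sA]]] := exists_spanning clA fA Sa0 a0r.
have b0r : sval ((hB \o e0 \o gA) (exist _ a0 Sa0)) <> root.
  move=> E; have [[inj _ _] _] := conv _ He0.
  have SAr : SA root by apply/sA; left.
  have Er := rootE _ _ _ _ _ (exist _ root SAr) (conv _ He0) erefl.
  by move: E; rewrite -Er => /sval_inj /inj [].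
have [TB [iB [tB rB sB]]] := exists_spanning clB fB (svalP _) b0r.
have RA := word_tree_ramsey (fun D => @ramsey_structure_const _ _ RN D) tA.
have [TC tC HC] := RA TB k.-1 tB.
have [w [bw Hw]] := exists_word_points.
have rC : represents TC w.
  split=> [l _|m a l Tm]; first exact: bw.
  apply: Hw => u b v E bc; have [_ _ _ H] := tC; apply: (H (m ++ u) v).
  by rewrite -catA -bc -E.
pose SC : set P := [set x | x = root \/ exists2 l, TC l & val x = w l].
have sC : spans SC TC w by [].
have clC : @Defs.fclosed _ (kaleidoscope_base R xi) SC.
  apply: closed_of_meets; first by left.
  have E0 (x : P) : Defs.center (M := K) root root x = root.
    by apply: center_unique; [exact: arc_l | exact: arc_l | exact: arc_l].
  have E1 (x : P) : Defs.center (M := K) root x root = root.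
    by apply: center_unique; [exact: arc_l | exact: arc_r | exact: arc_l].
  have below_center (x y m : P) : below (val m) (val x) -> below (val m) (val y) ->
      arc (val x) (val y) (val m) -> Defs.center (M := K) root x y = m.
    by move=> mx my xym; exact: center_unique.
  move=> x y [->|[l Tl Ex]]; first by move=> _; rewrite E0; left.
  case=> [->|[l' Tl' Ey]]; first by rewrite E1; left.
  have Tp m v : TC (m ++ v) -> TC m by have [_ _ H _] := tC; exact: H.
  case: (words_compare l l') => [E|[a [m E]]|[a [m E]]|[m [a [b [q [q' [ab E E']]]]]]].
  - have -> : y = x by apply: val_inj; rewrite Ex Ey E.
    rewrite (below_center x x x); [by right; exists l | exact: arc_r | exact: arc_r | exact: arc_l].
  - rewrite (below_center x y x); [by right; exists l | exact: arc_r | | exact: arc_l].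
    by rewrite Ex Ey E; rewrite E in Tl'; exact: rep_below tC rC _ _ _ Tl'.
  - rewrite (below_center x y y); [by right; exists l' | | exact: arc_r | exact: arc_r].
    by rewrite Ex Ey E; rewrite E in Tl; exact: rep_below tC rC _ _ _ Tl.
  rewrite E in Tl Ex; rewrite E' in Tl' Ey.
  have [p Ep] := @point_of (w m) (or_introl (bw m)).
  rewrite (below_center x y p).
  - by right; exists m => //; exact: Tp Tl.
  - by rewrite Ex Ep; exact: rep_below tC rC _ _ _ Tl.
  - by rewrite Ey Ep; exact: rep_below tC rC _ _ _ Tl'.
  - by rewrite Ex Ey Ep; exact: rep_diverge tC rC _ _ _ _ _ ab Tl Tl'.
have fC : finite_set SC.
  have [fT _ _ _] := tC.
  apply: (@sub_finite_set _ _ ([set root] `|` val @^-1` (w @` TC))) => [x [->|[l Tl Ex]]|].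
  - by left.
  - by right; exists l.
  rewrite finite_setU; split; first exact: finite_set1.
  by apply: finite_preimage; [move=> x y _ _; exact: val_inj | exact: finite_image].
pose C := comp_substructure (M := K) clC.
have rootC : SC root by left.
pose toC (y : P) : C := if pselect (SC y) is left Sy then exist _ y Sy else exist _ root rootC.
have toCE y (Sy : SC y) : toC y = exist _ y Sy.
  by rewrite /toC; case: pselect => // Sy'; rewrite (Prop_irrelevance Sy Sy').
(* [word] inverts the representation [iA]; points outside of [C] never arise, and
   [toC] sends them to the root *)
have /boolp.choice [word Hword] : forall x : P, exists l, forall l', TA l' -> val x = iA l' -> l = l'.
  move=> x; have [[l [Tl El]]|nl] := pselect (exists l, TA l /\ val x = iA l); last first.
    by exists [::] => l' Tl' El'; case: nl; exists l'.
  by exists l => l' Tl' El'; apply: (rep_injective tA rA) => //; rewrite -El.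
have /boolp.choice [pt Hpt] : forall l, exists p : P, val p = w l.
  by move=> l; apply: point_of; left.
pose mapC (e : seq N -> seq N) : A -> C := fun a =>
  if pselect (sval (hA a) = root) then toC root else toC (pt (e (word (sval (hA a))))).
have [k' Ek] : exists k', k = k'.+1 by exists k.-1; rewrite prednK.
subst k; rewrite /= in HC.
have arrow (gamma : (A -> C) -> 'I_k'.+1) : exists2 f : B -> C, comp_embedding f &
    forall e e' : A -> B, comp_embedding e -> comp_embedding e' -> gamma (f \o e) = gamma (f \o e').
  have local : local_on TA (fun e => gamma (mapC e)).
    move=> e e' ee'; congr gamma; apply: funext => a; rewrite /mapC; case: pselect => //= nr.
    have [//|[l Tl El]] := (sA (sval (hA a))).1 (svalP (hA a)).
    by rewrite (Hword _ _ Tl El) ee'.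
  have [f Hf Hfc] := HC _ local.
  have [F HF HFw] := tree_embed_comp_embedding clB clC tB tC rB rC sB sC Hf.
  exists (F \o hB); first exact: comp_embedding_comp hBe HF.
  have key (e : A -> B) : comp_embedding e -> exists2 e1, tree_embed TA TB e1 &
      (F \o hB) \o e = mapC (f \o e1).
    move=> He; have [e1 He1 Hw1] := comp_embedding_tree_embed tA tB rA rB sA sB (conv _ He).
    exists e1 => //; apply: funext => a; apply: sval_inj; rewrite /mapC /=.
    have [H1 H2] := Hw1 (hA a); rewrite /= hAK in H1 H2.
    have [G1 G2] := HFw (hB (e a)).
    case: pselect => /= [ra|nr]; first by rewrite (toCE _ rootC) /= G1 // H1.
    have [//|[l Tl El]] := (sA (sval (hA a))).1 (svalP (hA a)).
    have TBl : TB (e1 l) by have [] := He1 _ Tl.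
    rewrite (Hword _ _ Tl El).
    have SCl : SC (pt (f (e1 l))).
      by right; exists (f (e1 l)) => //; have [] := Hf _ TBl.
    rewrite (toCE _ SCl) /=; apply: val_inj; rewrite Hpt; apply: G2 => //.
    exact: H2.
  move=> e e' /key [e1 He1 ->] /key [e1' He1' ->].
  exact: Hfc.
exists C.
  exists SC, clC; split; first exact: finite_generation.
  by exists id; split; [exists id | exact: comp_embedding_id].
split=> [|gamma]; last exact: arrow.
have [f Hf _] := arrow (fun=> ord0); exists (f \o e0); exact: comp_embedding_comp.
Qed.

End Kaleidoscope.
End Dendrite.

Section Metrization.
Local Open Scope ring_scope.

Lemma metrizable_metrizes (R : realType) (T : topologicalType) :
  metrizable R T -> exists d : T -> T -> R, metrizes d.
Proof.
case=> M [f [g [cf cg _ _ [fK gK]]]].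
have {}cf := (continuous_subspace_setT f).2 cf.
have {}cg := (continuous_subspace_setT g).2 cg.
have {}fK x : g (f x) = x by apply: fK; rewrite inE.
have mge0 x y : 0 <= mdist (f x) (f y) by exact: mdist_ge0.
have nb x (A : set M) : nbhs x A <-> exists2 e : R, 0 < e & forall y, mdist x y < e -> A y.
  by rewrite -metricType_numDomainType.filter_from_mdist_nbhs.
exists (fun x y => Num.min 1 (mdist (f x) (f y))); split.
- by move=> x; rewrite mdistxx min_r.
- move=> x y; case: lerP => _; first by move/eqP; rewrite oner_eq0.
  by move/mdist_positivity/(congr1 g); rewrite !fK.
- by move=> x y; rewrite metric_sym.
- move=> y x z; have tri := metric_triangle (f x) (f y) (f z).
  have m1 := mge0 x y; have m2 := mge0 y z; have m3 := mge0 x z.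
  by have [?|?] := lerP 1 (mdist (f x) (f y)); have [?|?] := lerP 1 (mdist (f y) (f z));
    have [?|?] := lerP 1 (mdist (f x) (f z)); lra.
split=> [x y|x A]; first by rewrite ge_min lexx.
split.
  move=> Ax; have /nb [e e0 He] : nbhs (f x) (g @^-1` A).
    by apply: (cg (f x) A); apply: (eq_ind_r (fun z => nbhs z A) Ax (fK x)).
  exists (Num.min 1 e); first by rewrite lt_min ltr01.
  move=> y xy; rewrite -(fK y); apply: He; move: xy; rewrite lt_min => /andP [].
  by rewrite !gt_min ltxx /= => H1 /orP [|//]; lra.
case=> e e0 He; have Nx : nbhs (f x) [set z | mdist (f x) z < e] by apply/nb; exists e.
apply: (@filterS _ (nbhs x) _ _ _ _ (cf x _ Nx)) => y /= xy; apply: He; by rewrite gt_min xy orbT.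
Qed.

End Metrization.

Theorem theorem6p8 (R : realType) (L0 : rel_signature)
    (N : structure (add_constant L0))
    (N_countable : countable [set: N])
    (N_ge3 : `I_3 #<= [set: N])
    (N_ultrahomogeneous : ultrahomogeneous N)
    (N_ramsey : ramsey_structure N)
    (W : topologicalType) (W_wazewski : wazewski_dendrite R W N)
    (xi : W) (xi_endpoint : endpoint xi)
    (kappa : W -> set W -> N)
    (kappa_rk : root_kaleidoscopic R (the_constant N) xi kappa) :
  ramsey_comp_structure (kaleidoscope R xi kappa).
Proof.
have [[W_compact /metrizable_metrizes [d d_metric] W_lc W_uac] _ W_dense] := W_wazewski.
have [kappa_bij kappa_root _] := kappa_rk.
exact: (kaleidoscope_ramsey d_metric W_compact W_lc W_uac xi_endpoint W_dense kappa_bij kappa_root N_ramsey).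
Qed.
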